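(* Let $0<\alpha<1$, let $U\subseteq\mathbb{C}$ be open, and let $x_0\in\partial U$. Suppose $U$ satisfies a cone condition at $x_0$, and let $J$ be a non-tangential ray to $x_0$ (the midline of the cone). Let $t$ be a non-negative integer and let $0<\lambda<1$. If $$\sum_{n=1}^{\infty} 2^{(t+1+\lambda)n}\, M_*^{1+\alpha}(A_n\setminus U)<\infty,$$ then there is a constant $C>0$ such that $$\frac{|f^{(t)}(x)-f^{(t)}(x_0)|}{|x-x_0|^{\lambda}}\le C\,\|f\|_{\mathrm{Lip}\alpha(\mathbb{C})}$$ for all $x\in J$ (with $x\neq x_0$) and all $f\in A_\alpha(U)$.
   Context: For $0<\alpha<1$, $\mathrm{Lip}\alpha(\mathbb{C})$ is the space of functions $f:\mathbb{C}\to\mathbb{C}$ for which there is $k>0$ with $|f(z)-f(w)|\le k|z-w|^\alpha$ for all $z,w$; its norm is $\|f\|_{\mathrm{Lip}\alpha(\mathbb{C})}=\sup|f|+k(f)$, where $k(f)$ is the smallest such $k$. The little Lipschitz class $\mathrm{lip}\alpha(\mathbb{C})$ consists of those $f\in\mathrm{Lip}\alpha(\mathbb{C})$ such that for each $\epsilon>0$ there is $\delta>0$ with $|f(z)-f(w)|\le\epsilon|z-w|^\alpha$ whenever $|z-w|<\delta$. $A_\alpha(U)$ denotes the space of functions in $\mathrm{lip}\alpha(\mathbb{C})$ that are analytic on $U$, with the norm $\|\cdot\|_{\mathrm{Lip}\alpha(\mathbb{C})}$. $A_n=\{z: 2^{-n-1}<|z-x_0|<2^{-n}\}$. A measure function is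 a nondecreasing $h:[0,\infty)\to[0,\infty)$; $M_h(E)=\inf\sum h(\operatorname{diam}B)$, the infimum over all countable covers of $E$ by balls $B$. The lower $(1+\alpha)$-dimensional Hausdorff content is $M_*^{1+\alpha}(E)=\sup M_h(E)$, the supremum over measure functions $h$ with $h(r)\le r^{1+\alpha}$ and $r^{-1-\alpha}h(r)\to0$ as $r\to0$. Cone condition: there is an open sector (cone) $\mathscr{C}$ with vertex $x_0$, contained in $U$ near $x_0$, with midline segment $J$ starting at $x_0$, and a constant $K>0$ such that $|x-x_0|\le K|z-x|$ whenever $x\in J$ and $z\notin\mathscr{C}$; $J$ is then called a non-tangential ray to $x_0$. The value $f^{(t)}(x_0)$ for $f\in A_\alpha(U)$: functions in $A_\alpha(U)$ analytic in a neighbourhood of $x_0$ are dense in $A_\alpha(U)$, and under the hypothesis the map $f\mapsto f^{(t)}(x_0)$ on that dense subspace is bounded (a bounded point derivation of order $t$) and extends continuously to $A_\alpha(U)$; $f^{(t)}(x_0)$ denotes this extension. *)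

(* Defs.v *)
From Stdlib Require Import Reals Lra.
Open Scope R_scope.

Definition Cpx : Type := (R * R)%type.
Definition Cadd (z w : Cpx) : Cpx := (fst z + fst w, snd z + snd w).
Definition Csub (z w : Cpx) : Cpx := (fst z - fst w, snd z - snd w).
Definition Cmul (z w : Cpx) : Cpx :=
  (fst z * fst w - snd z * snd w, fst z * snd w + snd z * fst w).
Definition Cnorm (z : Cpx) : R := sqrt (fst z * fst z + snd z * snd z).
Definition Cpolar (s theta : R) : Cpx := (s * cos theta, s * sin theta).

(* real power with 0^a = 0 (a > 0 in all uses) *)
Definition rpow (x a : R) : R :=
  if Rle_dec x 0 then 0 else Rpower x a.

Definition Cset := Cpx -> Prop.

Definition Copen (U : Cset) : Prop :=
  forall z, U z -> exists r, r > 0 /\ forall w, Cnorm (Csub w z) < r -> U w.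

Definition in_boundary (U : Cset) (x0 : Cpx) : Prop :=
  ~ U x0 /\ forall r, r > 0 -> exists u, U u /\ Cnorm (Csub u x0) < r.

Definition has_cderiv (f : Cpx -> Cpx) (z L : Cpx) : Prop :=
  forall eps, eps > 0 -> exists d, d > 0 /\
    forall w, Cnorm (Csub w z) < d ->
      Cnorm (Csub (Csub (f w) (f z)) (Cmul L (Csub w z))) <= eps * Cnorm (Csub w z).

Definition analytic_on (W : Cset) (f : Cpx -> Cpx) : Prop :=
  forall z, W z -> exists L, has_cderiv f z L.

Fixpoint HasDerivN (W : Cset) (n : nat) (f g : Cpx -> Cpx) : Prop :=
  match n with
  | O => forall z, W z -> g z = f z
  | S m => exists h, HasDerivN W m f h /\ forall z, W z -> has_cderiv h z (g z)
  end.

Definition DerivNAt (f : Cpx -> Cpx) (n : nat) (z v : Cpx) : Prop :=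
  exists W, Copen W /\ W z /\ exists g, HasDerivN W n f g /\ g z = v.

Definition LipAlpha (alpha : R) (f : Cpx -> Cpx) : Prop :=
  (exists M, forall z, Cnorm (f z) <= M) /\
  exists k, k > 0 /\ forall z w,
    Cnorm (Csub (f z) (f w)) <= k * rpow (Cnorm (Csub z w)) alpha.

Definition lipAlpha (alpha : R) (f : Cpx -> Cpx) : Prop :=
  LipAlpha alpha f /\
  forall eps, eps > 0 -> exists d, d > 0 /\ forall z w, Cnorm (Csub z w) < d ->
    Cnorm (Csub (f z) (f w)) <= eps * rpow (Cnorm (Csub z w)) alpha.

Definition InA (alpha : R) (U : Cset) (f : Cpx -> Cpx) : Prop :=
  lipAlpha alpha f /\ analytic_on U f.

Definition IsLipConst (alpha : R) (f : Cpx -> Cpx) (k : R) : Prop :=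
  forall z w, Cnorm (Csub (f z) (f w)) <= k * rpow (Cnorm (Csub z w)) alpha.
Definition IsLeastLipConst (alpha : R) (f : Cpx -> Cpx) (K : R) : Prop :=
  IsLipConst alpha f K /\ forall k, IsLipConst alpha f k -> K <= k.

Definition LipNorm (alpha : R) (f : Cpx -> Cpx) (N : R) : Prop :=
  exists S K, is_lub (fun r => exists z, r = Cnorm (f z)) S /\
              IsLeastLipConst alpha f K /\ N = S + K.

Definition Approx (alpha : R) (U : Cset) (x0 : Cpx) (f : Cpx -> Cpx)
    (fk : nat -> Cpx -> Cpx) : Prop :=
  (forall k, InA alpha U (fk k) /\
     exists V, Copen V /\ V x0 /\ analytic_on V (fk k)) /\
  exists Nk, (forall k, LipNorm alpha (fun z => Csub (fk k z) (f z)) (Nk k)) /\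
             Un_cv Nk 0.

(* f^{(t)}(x0) = L as the continuous extension of the point derivation
   from the dense subspace of functions analytic near x0 *)
Definition ExtDeriv (alpha : R) (U : Cset) (t : nat) (x0 : Cpx) (f : Cpx -> Cpx)
    (L : Cpx) : Prop :=
  (exists fk, Approx alpha U x0 f fk) /\
  forall fk vk, Approx alpha U x0 f fk ->
    (forall k, DerivNAt (fk k) t x0 (vk k)) ->
    Un_cv (fun k => Cnorm (Csub (vk k) L)) 0.

Definition Ann (x0 : Cpx) (n : nat) : Cset :=
  fun z => / 2 ^ (S n) < Cnorm (Csub z x0) < / 2 ^ n.

Definition AdmissibleH (alpha : R) (h : R -> R) : Prop :=
  (forall r, 0 <= r -> 0 <= h r) /\
  (forall r s, 0 <= r -> r <= s -> h r <= h s) /\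
  (forall r, 0 <= r -> h r <= rpow r (1 + alpha)) /\
  (forall eps, eps > 0 -> exists d, d > 0 /\ forall r, 0 < r < d ->
     h r / rpow r (1 + alpha) < eps).

(* countable covers by (closed) discs; diam of disc of radius r is 2r *)
Definition BallCover (E : Cset) (c : nat -> Cpx) (rad : nat -> R) : Prop :=
  (forall n, 0 <= rad n) /\
  forall z, E z -> exists n, Cnorm (Csub z (c n)) <= rad n.

Definition Mh (h : R -> R) (E : Cset) (m : R) : Prop :=
  is_lub (fun s => exists c rad, BallCover E c rad /\
                     infinite_sum (fun n => h (2 * rad n)) (- s)) (- m).

Definition LowerContent (alpha : R) (E : Cset) (m : R) : Prop :=
  is_lub (fun v => exists h, AdmissibleH alpha h /\ Mh h E v) m.

(* Main.v *)
(** Let k(z) = (z - x)^(-t-1) - (z - x0)^(-t-1). For f analytic also near x0, Cauchy's formula on a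
    fixed square around x0 expresses f^(t)(x) - f^(t)(x0) by the integral of f k over its boundary,
    up to the contribution of the points where f is not analytic. Goursat's subdivision bounds that
    contribution: a square of side d meeting the singular set contributes at most a multiple of
    d omega(d) sup |k|, where omega is the modulus of continuity of f. Since f is little Lipschitz,
    r omega(r) / ||f|| is an admissible measure function, and the cone condition gives
    |k| <= C |x - x0|^lam 2^((t+1+lam)n) on A_n \ U, so the hypothesis on the contents sums the costs.
    The circles |z - x0| = 2^-n belong to no A_n; they have content zero and are covered separately.

    For general f let Q be a small square around x0, F the Cauchy integral of f over its boundary and
    u = f - F inside Q, u = - F outside. Then f - u is analytic on U and inside Q, and a
    Hardy-Littlewood argument bounds the Lipschitz norm of u by the local Lipschitz constant of f,
    which tends to 0 with the size of Q. *)

From Stdlib Require Import Reals Lra Lia Factorial ClassicalEpsilon.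
From Coquelicot Require Import Coquelicot.
Require Import Defs.
Open Scope R_scope.

(** * Complex continuity and differentiability *)

(** The covers behind a content are countable, their discs overlap and their radii have no lower
    bound, so no grid is adapted to them. A cover is therefore turned into a nonnegative
    superadditive function of squares. Such functions can be added, even in infinite series, and
    halving squares down to the scale attached to their limit point plays the part of compactness.
    The points of differentiability enter in the same form, at arbitrarily small cost.

    The kernel k has its poles x and x0 inside the square, while the subdivision needs a continuous
    integrand. As f is analytic near both, each half of f k is replaced by a quotient with the
    Taylor polynomial of f subtracted: squares that avoid the pole do not see the change, and for
    squares around it the change is the derivative sought.

    In the density argument all estimates are linear in the modulus of continuity, with constants
    that depend on the two exponents alone. They serve twice: once for the smallness of the norm and
    once, with another modulus, for membership in the little Lipschitz class. *)

Lemma Cnorm_Cmod (z : C) : Cnorm z = Cmod z.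
Proof. unfold Cnorm, Cmod; f_equal; ring. Qed.

Definition ccont (f : C -> C) (z : C) : Prop :=
  forall eps, 0 < eps -> exists d, 0 < d /\
    forall w, Cmod (w - z) < d -> Cmod (f w - f z) < eps.

(* Caratheodory's form of complex differentiability, for which the product and quotient rules are algebraic identities. *)
Definition cdiff (f : C -> C) (z L : C) : Prop :=
  exists phi, ccont phi z /\ phi z = L /\ forall w, f w = (f z + phi w * (w - z))%C.

Definition cdiffable (f : C -> C) (z : C) : Prop := exists L, cdiff f z L.

Lemma Cmod_minus_sym (x y : C) : Cmod (x - y) = Cmod (y - x).
Proof. rewrite <- Cmod_opp; f_equal; ring. Qed.

Lemma Cmod_sub_le (x y : C) : Cmod x <= Cmod y + Cmod (x - y).
Proof.
  replace x with (y + (x - y))%C at 1 by ring; apply Cmod_triangle.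
Qed.

Lemma Cmod_minus_le (x y z : C) : Cmod (x - z) <= Cmod (x - y) + Cmod (y - z).
Proof.
  replace (x - z)%C with ((x - y) + (y - z))%C by ring; apply Cmod_triangle.
Qed.

Lemma Cmod_minus_triangle (x y : C) : Cmod (x - y) <= Cmod x + Cmod y.
Proof.
  rewrite <- (Cmod_opp y); apply (Cmod_triangle x (- y)).
Qed.

Lemma Cmod_eq0_sub (x y : C) : Cmod (x - y) = 0 -> x = y.
Proof.
  intros H; apply Cmod_eq_0 in H; now apply Ceq_minus.
Qed.

Lemma Cmod_pos_sub (x y : C) : x <> y -> 0 < Cmod (x - y).
Proof.
  intros H; apply Cmod_gt_0; now apply Cminus_eq_contra.
Qed.

Lemma Cmod_diag (x : C) : Cmod (x - x) = 0.
Proof. replace (x - x)%C with (RtoC 0) by ring; apply Cmod_0. Qed.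

Lemma ccont_ext_loc (f g : C -> C) (z : C) (d : R) :
  0 < d -> (forall w, Cmod (w - z) < d -> f w = g w) -> ccont f z -> ccont g z.
Proof.
  intros Hd He Hf eps Heps.
  destruct (Hf eps Heps) as [d' [Hd' H]].
  exists (Rmin d d'); split; [now apply Rmin_pos|].
  intros w Hw.
  assert (Cmod (w - z) < d) by (eapply Rlt_le_trans; [apply Hw|apply Rmin_l]).
  rewrite <- (He w), <- (He z); [| rewrite Cmod_diag; lra | easy].
  apply H; eapply Rlt_le_trans; [apply Hw|apply Rmin_r].
Qed.

Lemma ccont_const (c z : C) : ccont (fun _ => c) z.
Proof. intros e He; exists 1; split; [lra|]; intros; rewrite Cmod_diag; lra. Qed.

Lemma ccont_id (z : C) : ccont (fun w => w) z.
Proof. intros e He; exists e; split; auto. Qed.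

Lemma ccont_plus (f g : C -> C) z :
  ccont f z -> ccont g z -> ccont (fun w => f w + g w)%C z.
Proof.
  intros Hf Hg e He.
  destruct (Hf (e/2)) as [d1 [H1 H1']]; [lra|].
  destruct (Hg (e/2)) as [d2 [H2 H2']]; [lra|].
  exists (Rmin d1 d2); split; [now apply Rmin_pos|].
  intros w Hw.
  assert (A := Rmin_l d1 d2). assert (B := Rmin_r d1 d2).
  replace (f w + g w - (f z + g z))%C with ((f w - f z) + (g w - g z))%C by ring.
  eapply Rle_lt_trans; [apply Cmod_triangle|].
  specialize (H1' w ltac:(lra)); specialize (H2' w ltac:(lra)); lra.
Qed.

Lemma ccont_mult (f g : C -> C) z :
  ccont f z -> ccont g z -> ccont (fun w => f w * g w)%C z.
Proof.
  intros Hf Hg e He.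
  set (A := Cmod (f z)). set (B := Cmod (g z)).
  assert (HA : 0 <= A) by apply Cmod_ge_0.
  assert (HB : 0 <= B) by apply Cmod_ge_0.
  (* The cap 1 makes the product of the two increments at most [e1], so the total is at most
     [e1 * (A + B + 1)]; the 2 in the denominator makes the inequality strict. *)
  set (e1 := Rmin 1 (e / (A + B + 2))).
  assert (He1 : 0 < e1) by (apply Rmin_pos; [lra| apply Rdiv_lt_0_compat; lra]).
  assert (He1' : e1 * (A + B + 2) <= e).
  { apply Rle_trans with (e / (A+B+2) * (A+B+2)).
    - apply Rmult_le_compat_r; [lra| apply Rmin_r].
    - right; field; lra. }
  assert (He1'' : e1 <= 1) by apply Rmin_l.
  destruct (Hf e1) as [d1 [H1 H1']]; [lra|].
  destruct (Hg e1) as [d2 [H2 H2']]; [lra|].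
  exists (Rmin d1 d2); split; [now apply Rmin_pos|].
  intros w Hw.
  assert (A' := Rmin_l d1 d2). assert (B' := Rmin_r d1 d2).
  replace (f w * g w - (f z * g z))%C
    with ((f w - f z) * (g w - g z) + (f w - f z) * g z + f z * (g w - g z))%C by ring.
  specialize (H1' w ltac:(lra)); specialize (H2' w ltac:(lra)).
  eapply Rle_lt_trans; [eapply Rle_trans; [apply Cmod_triangle| apply Rplus_le_compat_r, Cmod_triangle]|].
  rewrite !Cmod_mult; fold A B.
  pose proof (Cmod_ge_0 (f w - f z)%C). pose proof (Cmod_ge_0 (g w - g z)%C).
  assert (Cmod (f w - f z) * Cmod (g w - g z) <= e1 * 1) by (apply Rmult_le_compat; lra).
  assert (Cmod (f w - f z) * B <= e1 * B) by (apply Rmult_le_compat_r; lra).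
  assert (A * Cmod (g w - g z) <= A * e1) by (apply Rmult_le_compat_l; lra).
  nra.
Qed.

Lemma ccont_opp (f : C -> C) z : ccont f z -> ccont (fun w => - f w)%C z.
Proof.
  intros Hf e He; destruct (Hf e He) as [d [Hd H]]; exists d; split; [easy|].
  intros w Hw; replace (- f w - - f z)%C with (- (f w - f z))%C by ring.
  rewrite Cmod_opp; auto.
Qed.

Lemma ccont_minus (f g : C -> C) z :
  ccont f z -> ccont g z -> ccont (fun w => f w - g w)%C z.
Proof.
  intros; apply (ccont_plus f (fun w => - g w)%C); [|apply ccont_opp]; easy.
Qed.

Lemma ccont_inv (f : C -> C) z : ccont f z -> f z <> 0 -> ccont (fun w => / f w)%C z.
Proof.
  intros Hf Hz e He.
  set (A := Cmod (f z)).
  assert (HA : 0 < A) by now apply Cmod_gt_0.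
  destruct (Hf (Rmin (A/2) (e * A * A / 2))) as [d [Hd H]].
  { apply Rmin_pos; [lra|]. apply Rdiv_lt_0_compat; [|lra]. repeat apply Rmult_lt_0_compat; easy. }
  exists d; split; [easy|]; intros w Hw; specialize (H w Hw).
  pose proof (Rmin_l (A/2) (e * A * A / 2)). pose proof (Rmin_r (A/2) (e * A * A / 2)).
  assert (Hw' : A / 2 < Cmod (f w)).
  { pose proof (Cmod_sub_le (f z) (f w)). rewrite Cmod_minus_sym in H2. fold A in H2. lra. }
  assert (Hn : f w <> 0) by (apply Cmod_gt_0; lra).
  replace (/ f w - / f z)%C with ((f z - f w) * / (f w * f z))%C by (field; split; assumption).
  rewrite Cmod_mult, Cmod_inv, Cmod_mult by now apply Cmult_neq_0.
  rewrite Cmod_minus_sym; fold A.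
  apply Rmult_lt_reg_r with (Cmod (f w) * A); [apply Rmult_lt_0_compat; lra|].
  rewrite Rmult_assoc, Rinv_l, Rmult_1_r by (apply Rgt_not_eq, Rmult_lt_0_compat; lra).
  assert (e * A * (A/2) <= e * A * Cmod (f w)) by (apply Rmult_le_compat_l; [apply Rmult_le_pos|]; lra).
  nra.
Qed.

Lemma ccont_inv_sub (y z : C) : z <> y -> ccont (fun w => / (w - y))%C z.
Proof.
  intros Hz. apply (ccont_inv (fun w => w - y)%C); [|now apply Cminus_eq_contra].
  apply ccont_minus; [apply ccont_id|apply ccont_const].
Qed.

Lemma ccont_pow (f : C -> C) z n : ccont f z -> ccont (fun w => (f w) ^ n)%C z.
Proof.
  intros Hf; induction n as [|n IH]; simpl.
  - apply ccont_const.
  - now apply ccont_mult.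
Qed.

Lemma cdiff_ccont f z L : cdiff f z L -> ccont f z.
Proof.
  intros [phi [Hc [_ He]]].
  apply (ccont_ext_loc (fun w => f z + phi w * (w - z))%C f z 1); [lra| |].
  - intros w _; now rewrite <- He.
  - apply ccont_plus; [apply ccont_const|]. apply ccont_mult; [easy|].
    apply ccont_minus; [apply ccont_id|apply ccont_const].
Qed.

Lemma cdiffable_ccont f z : cdiffable f z -> ccont f z.
Proof. intros [L H]; eapply cdiff_ccont; eauto. Qed.

Lemma has_cderiv_cdiff (f : C -> C) (z L : C) : has_cderiv f z L <-> cdiff f z L.
Proof.
  split.
  - intros H.
    exists (fun w => if Ceq_dec w z then L else ((f w - f z) / (w - z)))%C.
    split; [|split].
    + intros e He. destruct (H (e/2)) as [d [Hd Hd']]; [lra|].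
      exists d; split; [easy|]. intros w Hw.
      destruct (Ceq_dec z z) as [_|n]; [|easy].
      destruct (Ceq_dec w z) as [->|n]; [rewrite Cmod_diag; lra|].
      specialize (Hd' w). rewrite !Cnorm_Cmod in Hd'. specialize (Hd' Hw).
      change (Csub (Csub (f w) (f z)) (Cmul L (Csub w z))) with ((f w - f z) - L * (w - z))%C in Hd'.
      change (Csub w z) with (w - z)%C in Hd'.
      replace ((f w - f z) / (w - z) - L)%C with (((f w - f z) - L * (w - z)) / (w - z))%C
        by (field; now apply Cminus_eq_contra).
      rewrite Cmod_div by now apply Cminus_eq_contra.
      apply Rle_lt_trans with (e/2); [|lra].
      apply Rmult_le_reg_r with (Cmod (w - z)); [now apply Cmod_pos_sub|].
      unfold Rdiv at 1. rewrite Rmult_assoc, Rinv_l, Rmult_1_r; [easy|].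
      apply Rgt_not_eq; now apply Cmod_pos_sub.
    + destruct (Ceq_dec z z); easy.
    + intros w. destruct (Ceq_dec w z) as [->|n]; [ring|].
      field. now apply Cminus_eq_contra.
  - intros [phi [Hc [<- He]]] e Hepos.
    destruct (Hc e Hepos) as [d [Hd H]]. exists d; split; [easy|].
    intros w. rewrite !Cnorm_Cmod.
    change (Csub (Csub (f w) (f z)) (Cmul (phi z) (Csub w z))) with ((f w - f z) - phi z * (w - z))%C.
    change (Csub w z) with (w - z)%C. intros Hw.
    rewrite (He w). replace (f z + phi w * (w - z) - f z - phi z * (w - z))%C
      with ((phi w - phi z) * (w - z))%C by ring.
    rewrite Cmod_mult. apply Rmult_le_compat_r; [apply Cmod_ge_0|]. left; auto.
Qed.

Lemma cdiff_unique f z L L' : cdiff f z L -> cdiff f z L' -> L = L'.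
Proof.
  intros [p [Hp [<- Ep]]] [q [Hq [<- Eq]]].
  destruct (Ceq_dec (p z) (q z)) as [E|n]; [easy|exfalso].
  assert (Hpos := Cmod_pos_sub _ _ n).
  destruct (ccont_minus _ _ _ Hp Hq (Cmod (p z - q z)) Hpos) as [d [Hd H]].
  (* At a point other than [z] both factors equal the difference quotient; if they differed at [z],
     continuity would keep them apart at this [w]. *)
  set (w := (z + RtoC (d/2))%C).
  assert (Hw : (w - z)%C = RtoC (d/2)) by (unfold w; ring).
  assert (Hpq : p w = q w).
  { assert (E1 := Ep w). rewrite (Eq w) in E1.
    assert (E2 : (q w * (w - z) = p w * (w - z))%C).
    { replace (q w * (w - z))%C with ((f z + q w * (w - z)) - f z)%C by ring.
      rewrite E1. ring. }
    assert (nz : (w - z)%C <> 0).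
    { rewrite Hw. intros E. apply RtoC_inj in E. lra. }
    replace (p w) with (p w * (w - z) / (w - z))%C by (field; easy).
    rewrite <- E2. field; easy. }
  specialize (H w). rewrite Hw, Cmod_R in H.
  rewrite Rabs_pos_eq in H by lra. specialize (H ltac:(lra)). rewrite Hpq in H.
  replace (q w - q w - (p z - q z))%C with (- (p z - q z))%C in H by ring.
  rewrite Cmod_opp in H. lra.
Qed.

Lemma cdiff_ext_loc f g z L d :
  0 < d -> (forall w, Cmod (w - z) < d -> f w = g w) -> cdiff f z L -> cdiff g z L.
Proof.
  intros Hd He [p [Hp [<- Ep]]].
  exists (fun w => if Ceq_dec w z then p z else ((g w - g z) / (w - z)))%C.
  split; [|split].
  - apply (ccont_ext_loc p _ z d Hd); [|easy].
    intros w Hw. destruct (Ceq_dec w z) as [->|n]; [easy|].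
    rewrite <- (He w Hw), <- (He z) by (rewrite Cmod_diag; lra).
    rewrite (Ep w). field. now apply Cminus_eq_contra.
  - destruct (Ceq_dec z z); easy.
  - intros w. destruct (Ceq_dec w z) as [->|n]; [ring|].
    field. now apply Cminus_eq_contra.
Qed.

Lemma cdiff_const c z : cdiff (fun _ => c) z 0.
Proof.
  exists (fun _ => RtoC 0); split; [apply ccont_const|split; [easy|]]; intros; ring.
Qed.

Lemma cdiff_id z : cdiff (fun w => w) z 1.
Proof.
  exists (fun _ => RtoC 1); split; [apply ccont_const|split; [easy|]]; intros; ring.
Qed.

Lemma cdiff_plus f g z L M :
  cdiff f z L -> cdiff g z M -> cdiff (fun w => f w + g w)%C z (L + M)%C.
Proof.
  intros [p [Hp [<- Ep]]] [q [Hq [<- Eq]]].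
  exists (fun w => p w + q w)%C; split; [now apply ccont_plus|split; [easy|]].
  intros w; rewrite (Ep w), (Eq w); ring.
Qed.

Lemma cdiff_mult f g z L M :
  cdiff f z L -> cdiff g z M -> cdiff (fun w => f w * g w)%C z (L * g z + f z * M)%C.
Proof.
  intros Hf [q [Hq [<- Eq]]]. assert (Cf := cdiff_ccont _ _ _ Hf).
  destruct Hf as [p [Hp [<- Ep]]].
  exists (fun w => p w * g z + f w * q w)%C; split; [|split; [easy|]].
  - apply ccont_plus; apply ccont_mult; auto using ccont_const.
  - intros w; rewrite (Eq w), (Ep w); ring.
Qed.

Lemma cdiff_opp f z L : cdiff f z L -> cdiff (fun w => - f w)%C z (- L)%C.
Proof.
  intros [p [Hp [<- Ep]]].
  exists (fun w => - p w)%C; split; [now apply ccont_opp|split; [easy|]].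
  intros w; rewrite (Ep w); ring.
Qed.

Lemma cdiff_minus f g z L M :
  cdiff f z L -> cdiff g z M -> cdiff (fun w => f w - g w)%C z (L - M)%C.
Proof.
  intros; apply (cdiff_plus f (fun w => - g w)%C z L (-M)%C); [|apply cdiff_opp]; easy.
Qed.

Lemma cdiffable_plus f g z :
  cdiffable f z -> cdiffable g z -> cdiffable (fun w => f w + g w)%C z.
Proof. intros [L H] [M K]; eexists; apply cdiff_plus; eauto. Qed.

Lemma cdiffable_minus f g z :
  cdiffable f z -> cdiffable g z -> cdiffable (fun w => f w - g w)%C z.
Proof. intros [L H] [M K]; eexists; apply cdiff_minus; eauto. Qed.

Lemma cdiffable_mult f g z :
  cdiffable f z -> cdiffable g z -> cdiffable (fun w => f w * g w)%C z.
Proof. intros [L H] [M K]; eexists; apply cdiff_mult; eauto. Qed.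

Lemma cdiffable_const c z : cdiffable (fun _ => c) z.
Proof. eexists; apply cdiff_const. Qed.

Lemma cdiffable_id z : cdiffable (fun w => w) z.
Proof. eexists; apply cdiff_id. Qed.

Lemma cdiffable_ext_loc f g z d :
  0 < d -> (forall w, Cmod (w - z) < d -> f w = g w) -> cdiffable f z -> cdiffable g z.
Proof. intros H1 H2 [L H]; exists L; eapply cdiff_ext_loc; eauto. Qed.

Lemma cdiffable_pow f z n : cdiffable f z -> cdiffable (fun w => (f w) ^ n)%C z.
Proof.
  intros Hf; induction n as [|n IH]; simpl.
  - apply cdiffable_const.
  - now apply cdiffable_mult.
Qed.

Lemma ccont_neq0 f z : ccont f z -> f z <> 0 ->
  exists d, 0 < d /\ forall w, Cmod (w - z) < d -> f w <> 0.
Proof.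
  intros Hf Hz. assert (Hp : 0 < Cmod (f z)) by now apply Cmod_gt_0.
  destruct (Hf _ Hp) as [d [Hd H]]; exists d; split; [easy|].
  intros w Hw E; specialize (H w Hw). rewrite E in H.
  replace (0 - f z)%C with (- f z)%C in H by ring. rewrite Cmod_opp in H; lra.
Qed.

Lemma cdiffable_inv f z : cdiffable f z -> f z <> 0 -> cdiffable (fun w => / f w)%C z.
Proof.
  intros [L Hf] Hz. assert (Cf := cdiff_ccont _ _ _ Hf).
  destruct Hf as [p [Hp [_ Ep]]].
  destruct (ccont_neq0 f z Cf Hz) as [d [Hd Hn]].
  set (psi := fun w => (- p w * / (f w * f z))%C).
  apply (cdiffable_ext_loc (fun w => / f z + psi w * (w - z))%C _ z d Hd).
  - intros w Hw. specialize (Hn w Hw). unfold psi.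
    replace (- p w * / (f w * f z) * (w - z))%C with (- (p w * (w - z)) * / (f w * f z))%C by ring.
    replace (p w * (w - z))%C with (f w - f z)%C by (rewrite (Ep w); ring).
    field; split; assumption.
  - exists (psi z), psi; split; [|split; [easy|]].
    + apply ccont_mult; [now apply ccont_opp|]. apply ccont_inv.
      * apply ccont_mult; [easy|apply ccont_const].
      * now apply Cmult_neq_0.
    + intros w; ring.
Qed.

Lemma cdiffable_inv_sub (y z : C) : z <> y -> cdiffable (fun w => / (w - y))%C z.
Proof.
  intros Hz. apply (cdiffable_inv (fun w => w - y)%C); [|now apply Cminus_eq_contra].
  apply cdiffable_minus; [apply cdiffable_id|apply cdiffable_const].
Qed.

Lemma Rpower_gt_0 x a : 0 < Rpower x a.
Proof. apply exp_pos. Qed.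

(** * Integrals along segments and boundaries of squares *)

Definition CI (g : R -> C) (a b : R) : C := RInt (V := C_R_CompleteNormedModule) g a b.

Definition rcont (g : R -> C) (t : R) : Prop :=
  forall eps, 0 < eps -> exists d, 0 < d /\
    forall t', Rabs (t' - t) < d -> Cmod (g t' - g t) < eps.

Definition rcont_on (g : R -> C) (a b : R) : Prop := forall t, a <= t <= b -> rcont g t.

Lemma rcont_continuous g t : rcont g t -> continuous (U := C_R_CompleteNormedModule) g t.
Proof.
  intros H.
  apply (proj2 (filterlim_locally (U := C_R_CompleteNormedModule) g (g t))).
  intros eps. destruct (H eps (cond_pos eps)) as [d [Hd H']].
  exists (mkposreal d Hd). intros t' Ht'.
  apply C_NormedModule_mixin_compat1. apply H'. exact Ht'.
Qed.

Lemma rcont_ex_RInt g a b : a <= b -> rcont_on g a b ->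
  ex_RInt (V := C_R_CompleteNormedModule) g a b.
Proof.
  intros Hab H. apply ex_RInt_continuous. intros t. rewrite Rmin_left, Rmax_right by easy.
  intros Ht. now apply rcont_continuous, H.
Qed.

Lemma rcont_on_sub g a b a' b' : a <= a' -> b' <= b -> rcont_on g a b -> rcont_on g a' b'.
Proof. intros H1 H2 H t Ht; apply H; lra. Qed.

Lemma CI_chasles g a b c : a <= b -> b <= c -> rcont_on g a c -> (CI g a b + CI g b c = CI g a c)%C.
Proof.
  intros H1 H2 H. apply (RInt_Chasles (V := C_R_CompleteNormedModule)); apply rcont_ex_RInt; auto.
  - apply (rcont_on_sub g a c); auto; lra.
  - apply (rcont_on_sub g a c); auto; lra.
Qed.

Lemma CI_ext g h a b : a <= b -> (forall t, a <= t <= b -> g t = h t) -> CI g a b = CI h a b.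
Proof.
  intros Hab H. apply (RInt_ext (V := C_R_CompleteNormedModule)).
  rewrite Rmin_left, Rmax_right by easy. intros t Ht; apply H; lra.
Qed.

Lemma CI_plus g h a b : a <= b -> rcont_on g a b -> rcont_on h a b ->
  CI (fun t => g t + h t)%C a b = (CI g a b + CI h a b)%C.
Proof.
  intros; apply (RInt_plus (V := C_R_CompleteNormedModule) g h); now apply rcont_ex_RInt.
Qed.

(** The integral lives in a real module, which only scales by reals; a complex factor is handled by
    components. *)
Lemma is_RInt_mult_C (c : C) (g : R -> C) a b (l : C) :
  is_RInt (V := C_R_NormedModule) g a b l ->
  is_RInt (V := C_R_NormedModule) (fun t => c * g t)%C a b (c * l)%C.
Proof.
  intros H.
  assert (H1 := is_RInt_fct_extend_fst (U := R_NormedModule) (V := R_NormedModule) g a b l H).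
  assert (H2 := is_RInt_fct_extend_snd (U := R_NormedModule) (V := R_NormedModule) g a b l H).
  apply (is_RInt_fct_extend_pair (U := R_NormedModule) (V := R_NormedModule)).
  - apply (is_RInt_minus (V := R_NormedModule)); now apply (is_RInt_scal (V := R_NormedModule)).
  - apply (is_RInt_plus (V := R_NormedModule)); now apply (is_RInt_scal (V := R_NormedModule)).
Qed.

Lemma CI_scal c g a b : a <= b -> rcont_on g a b ->
  CI (fun t => c * g t)%C a b = (c * CI g a b)%C.
Proof.
  intros Hab H. apply (is_RInt_unique (V := C_R_CompleteNormedModule)). apply is_RInt_mult_C.
  apply (RInt_correct (V := C_R_CompleteNormedModule)). now apply rcont_ex_RInt.
Qed.

Lemma CI_const c a b : CI (fun _ => c) a b = (RtoC (b - a) * c)%C.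
Proof.
  unfold CI. rewrite (RInt_const (V := C_R_CompleteNormedModule)). apply scal_R_Cmult.
Qed.

Lemma norm_C_R (z : C) : norm (V := C_R_NormedModule) z = Cmod z.
Proof.
  unfold norm; simpl. unfold prod_norm, Cmod. f_equal.
  unfold norm; simpl. unfold abs; simpl. now rewrite !Rmult_1_r, <- !Rabs_mult, !Rabs_pos_eq by nra.
Qed.

Lemma CI_norm_le (g : R -> C) (h : R -> R) a b : a <= b -> rcont_on g a b -> ex_RInt h a b ->
  (forall t, a <= t <= b -> Cmod (g t) <= h t) -> Cmod (CI g a b) <= RInt h a b.
Proof.
  intros Hab Hg Hh H.
  rewrite <- norm_C_R.
  apply (norm_RInt_le (V := C_R_NormedModule) g h a b); auto.
  - intros t Ht; rewrite norm_C_R; auto.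
  - apply (RInt_correct (V := C_R_CompleteNormedModule)). now apply rcont_ex_RInt.
  - now apply (RInt_correct (V := R_CompleteNormedModule)).
Qed.

(* (a, b) is the lower left corner and d the side. *)
Definition in_sq (a b d : R) (z : C) : Prop :=
  a <= fst z <= a + d /\ b <= snd z <= b + d.

Definition int_sq (a b d : R) (z : C) : Prop :=
  a < fst z < a + d /\ b < snd z < b + d.

Definition on_sq (a b d : R) (z : C) : Prop :=
  (a <= fst z <= a + d /\ (snd z = b \/ snd z = b + d)) \/
  (b <= snd z <= b + d /\ (fst z = a \/ fst z = a + d)).

Definition sub_sq (a b d a' b' d' : R) : Prop :=
  a' <= a /\ a + d <= a' + d' /\ b' <= b /\ b + d <= b' + d'.

(** The boundary is traversed counterclockwise: [Ci] is dz/dt on the vertical sides, and the minus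
    signs reverse the top and the left side. *)
Definition SI (g : C -> C) (a b d : R) : C :=
  (CI (fun t => g (t, b)) a (a + d) + Ci * CI (fun t => g ((a + d)%R, t)) b (b + d)
   - CI (fun t => g (t, (b + d)%R)) a (a + d) - Ci * CI (fun t => g (a, t)) b (b + d))%C.

Lemma on_sq_in a b d z : 0 <= d -> on_sq a b d z -> in_sq a b d z.
Proof. unfold on_sq, in_sq; intros; lra. Qed.

Lemma on_not_int a b d z : on_sq a b d z -> int_sq a b d z -> False.
Proof. unfold on_sq, int_sq; intros; lra. Qed.

Lemma in_sq_cases a b d z : in_sq a b d z -> on_sq a b d z \/ int_sq a b d z.
Proof. unfold on_sq, in_sq, int_sq; intros. lra. Qed.

Lemma in_sq_sub a b d a' b' d' z :
  sub_sq a b d a' b' d' -> in_sq a b d z -> in_sq a' b' d' z.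
Proof. unfold sub_sq, in_sq; intros; lra. Qed.

Lemma Cmod_le_sum (z : C) : Cmod z <= Rabs (fst z) + Rabs (snd z).
Proof.
  destruct z as [x y]; cbn [fst snd].
  replace ((x, y) : C) with (RtoC x + Ci * RtoC y)%C
    by (unfold RtoC, Ci, Cplus, Cmult; cbn [fst snd]; f_equal; ring).
  eapply Rle_trans; [apply Cmod_triangle|]. rewrite Cmod_mult, Cmod_Ci, !Cmod_R; lra.
Qed.

Lemma fst_le_Cmod (z : C) : Rabs (fst z) <= Cmod z.
Proof. eapply Rle_trans; [apply Rmax_l|apply Rmax_Cmod]. Qed.

Lemma snd_le_Cmod (z : C) : Rabs (snd z) <= Cmod z.
Proof. eapply Rle_trans; [apply Rmax_r|apply Rmax_Cmod]. Qed.

Lemma in_sq_dist a b d z w : in_sq a b d z -> in_sq a b d w -> Cmod (z - w) <= 2 * d.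
Proof.
  intros H1 H2. eapply Rle_trans; [apply Cmod_le_sum|].
  unfold in_sq in *. cbn [fst snd Cminus Cplus Copp].
  assert (Rabs (fst z + - fst w) <= d) by (apply Rabs_le; lra).
  assert (Rabs (snd z + - snd w) <= d) by (apply Rabs_le; lra). lra.
Qed.

Definition ccont_bd (g : C -> C) (a b d : R) : Prop := forall z, on_sq a b d z -> ccont g z.

Lemma ccont_hline g y t : ccont g (t, y) -> rcont (fun t => g (t, y)) t.
Proof.
  intros H e He; destruct (H e He) as [d [Hd H']]; exists d; split; [easy|].
  intros t' Ht'; apply H'. replace ((t', y) - (t, y))%C with (RtoC (t' - t)).
  - now rewrite Cmod_R.
  - unfold RtoC, Cminus, Cplus, Copp; cbn [fst snd]; f_equal; ring.
Qed.

Lemma ccont_vline g x t : ccont g (x, t) -> rcont (fun t => g (x, t)) t.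
Proof.
  intros H e He; destruct (H e He) as [d [Hd H']]; exists d; split; [easy|].
  intros t' Ht'; apply H'. replace ((x, t') - (x, t))%C with (Ci * RtoC (t' - t))%C.
  - now rewrite Cmod_mult, Cmod_Ci, Cmod_R, Rmult_1_l.
  - unfold RtoC, Ci, Cminus, Cplus, Copp, Cmult; cbn [fst snd]; f_equal; ring.
Qed.

Lemma ccont_bd_lines g a b d : 0 <= d -> ccont_bd g a b d ->
  rcont_on (fun t => g (t, b)) a (a + d) /\ rcont_on (fun t => g (a + d, t)) b (b + d) /\
  rcont_on (fun t => g (t, b + d)) a (a + d) /\ rcont_on (fun t => g (a, t)) b (b + d).
Proof.
  intros Hd H; repeat split; intros t Ht; first [apply ccont_hline|apply ccont_vline];
  apply H; unfold on_sq; cbn [fst snd]; lra.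
Qed.

Lemma SI_ext g h a b d : 0 <= d -> (forall z, on_sq a b d z -> g z = h z) -> SI g a b d = SI h a b d.
Proof.
  intros Hd H. unfold SI.
  rewrite (CI_ext (fun t => g (t, b)) (fun t => h (t, b))); [| lra| intros; apply H; unfold on_sq; cbn [fst snd]; lra].
  rewrite (CI_ext (fun t => g (a + d, t)) (fun t => h (a + d, t))); [| lra| intros; apply H; unfold on_sq; cbn [fst snd]; lra].
  rewrite (CI_ext (fun t => g (t, b + d)) (fun t => h (t, b + d))); [| lra| intros; apply H; unfold on_sq; cbn [fst snd]; lra].
  rewrite (CI_ext (fun t => g (a, t)) (fun t => h (a, t))); [easy| lra| intros; apply H; unfold on_sq; cbn [fst snd]; lra].
Qed.

Lemma SI_plus g h a b d : 0 <= d -> ccont_bd g a b d -> ccont_bd h a b d ->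
  SI (fun z => g z + h z)%C a b d = (SI g a b d + SI h a b d)%C.
Proof.
  intros Hd Hg Hh.
  destruct (ccont_bd_lines g a b d Hd Hg) as [G1 [G2 [G3 G4]]].
  destruct (ccont_bd_lines h a b d Hd Hh) as [H1 [H2 [H3 H4]]].
  unfold SI.
  rewrite (CI_plus (fun t => g (t, b)) (fun t => h (t, b))) by (auto; lra).
  rewrite (CI_plus (fun t => g (a + d, t)) (fun t => h (a + d, t))) by (auto; lra).
  rewrite (CI_plus (fun t => g (t, b + d)) (fun t => h (t, b + d))) by (auto; lra).
  rewrite (CI_plus (fun t => g (a, t)) (fun t => h (a, t))) by (auto; lra).
  ring.
Qed.

Lemma SI_scal c g a b d : 0 <= d -> ccont_bd g a b d ->
  SI (fun z => c * g z)%C a b d = (c * SI g a b d)%C.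
Proof.
  intros Hd Hg.
  destruct (ccont_bd_lines g a b d Hd Hg) as [G1 [G2 [G3 G4]]].
  unfold SI.
  rewrite (CI_scal c (fun t => g (t, b))) by (auto; lra).
  rewrite (CI_scal c (fun t => g (a + d, t))) by (auto; lra).
  rewrite (CI_scal c (fun t => g (t, b + d))) by (auto; lra).
  rewrite (CI_scal c (fun t => g (a, t))) by (auto; lra).
  ring.
Qed.

Lemma SI_minus g h a b d : 0 <= d -> ccont_bd g a b d -> ccont_bd h a b d ->
  SI (fun z => g z - h z)%C a b d = (SI g a b d - SI h a b d)%C.
Proof.
  intros Hd Hg Hh.
  rewrite (SI_ext (fun z => g z - h z)%C (fun z => g z + (-1) * h z)%C) by (auto; intros; ring).
  rewrite (SI_plus g (fun z => (-1) * h z)%C), SI_scal; auto; [ring|].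
  intros z Hz; apply ccont_mult; [apply ccont_const|auto].
Qed.

Lemma SI_const c a b d : SI (fun _ => c) a b d = 0.
Proof.
  unfold SI. rewrite !CI_const.
  replace (a + d - a) with d by ring. replace (b + d - b) with d by ring. ring.
Qed.

(** The majorant may vary along a side, which is needed for kernels that decay away from one point
    of the boundary. *)
Lemma SI_norm_le_int g a b d (h1 h2 : R -> R) I1 I2 : 0 <= d -> ccont_bd g a b d ->
  is_RInt h1 a (a + d) I1 -> is_RInt h2 b (b + d) I2 ->
  (forall z, on_sq a b d z -> Cmod (g z) <= h1 (fst z) /\ Cmod (g z) <= h2 (snd z)) ->
  Cmod (SI g a b d) <= 2 * I1 + 2 * I2.
Proof.
  intros Hd Hg J1 J2 H.
  destruct (ccont_bd_lines g a b d Hd Hg) as [G1 [G2 [G3 G4]]].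
  assert (E1 : RInt h1 a (a + d) = I1) by (apply (is_RInt_unique (V := R_CompleteNormedModule)); exact J1).
  assert (E2 : RInt h2 b (b + d) = I2) by (apply (is_RInt_unique (V := R_CompleteNormedModule)); exact J2).
  assert (X1 : ex_RInt h1 a (a + d)) by (eexists; apply J1).
  assert (X2 : ex_RInt h2 b (b + d)) by (eexists; apply J2).
  assert (K1 : Cmod (CI (fun t => g (t, b)) a (a + d)) <= I1).
  { rewrite <- E1. apply CI_norm_le; auto; [lra|]. intros t Ht. apply (H (t, b)); unfold on_sq; cbn [fst snd]; lra. }
  assert (K2 : Cmod (CI (fun t => g (a + d, t)) b (b + d)) <= I2).
  { rewrite <- E2. apply CI_norm_le; auto; [lra|]. intros t Ht. apply (H (a + d, t)); unfold on_sq; cbn [fst snd]; lra. }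
  assert (K3 : Cmod (CI (fun t => g (t, b + d)) a (a + d)) <= I1).
  { rewrite <- E1. apply CI_norm_le; auto; [lra|]. intros t Ht. apply (H (t, b + d)); unfold on_sq; cbn [fst snd]; lra. }
  assert (K4 : Cmod (CI (fun t => g (a, t)) b (b + d)) <= I2).
  { rewrite <- E2. apply CI_norm_le; auto; [lra|]. intros t Ht. apply (H (a, t)); unfold on_sq; cbn [fst snd]; lra. }
  unfold SI.
  eapply Rle_trans; [apply Cmod_minus_triangle|].
  eapply Rle_trans; [apply Rplus_le_compat_r, Cmod_minus_triangle|].
  eapply Rle_trans; [apply Rplus_le_compat_r, Rplus_le_compat_r, Cmod_triangle|].
  rewrite !Cmod_mult, Cmod_Ci. lra.
Qed.

Lemma SI_norm_le g M a b d : 0 <= d -> ccont_bd g a b d ->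
  (forall z, on_sq a b d z -> Cmod (g z) <= M) -> Cmod (SI g a b d) <= 4 * d * M.
Proof.
  intros Hd Hg H. replace (4 * d * M) with (2 * ((a + d - a) * M) + 2 * ((b + d - b) * M)) by ring.
  apply (SI_norm_le_int g a b d (fun _ => M) (fun _ => M)); auto;
    apply (is_RInt_const (V := R_NormedModule)).
Qed.

(** Each inner segment belongs to two quarters, which traverse it in opposite directions. *)
Lemma SI_quad g a b d : 0 < d -> (forall z, in_sq a b d z -> ccont g z) ->
  SI g a b d = (SI g a b (d/2) + SI g (a + d/2) b (d/2)
                + SI g a (b + d/2) (d/2) + SI g (a + d/2) (b + d/2) (d/2))%C.
Proof.
  intros Hd Hg. unfold SI.
  replace (a + d/2 + d/2) with (a + d) by field.
  replace (b + d/2 + d/2) with (b + d) by field.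
  assert (HH : forall y, b <= y <= b + d -> (CI (fun t => g (t, y)) a (a + d) =
      CI (fun t => g (t, y)) a (a + d/2) + CI (fun t => g (t, y)) (a + d/2) (a + d))%C).
  { intros y Hy. symmetry; apply CI_chasles; try lra. intros t Ht. apply ccont_hline, Hg.
    unfold in_sq; cbn [fst snd]; lra. }
  assert (HV : forall x, a <= x <= a + d -> (CI (fun t => g (x, t)) b (b + d) =
      CI (fun t => g (x, t)) b (b + d/2) + CI (fun t => g (x, t)) (b + d/2) (b + d))%C).
  { intros x Hx. symmetry; apply CI_chasles; try lra. intros t Ht. apply ccont_vline, Hg.
    unfold in_sq; cbn [fst snd]; lra. }
  rewrite (HH b), (HH (b + d)), (HV a), (HV (a + d)) by lra.
  ring.
Qed.

(** * Goursat's subdivision argument with an exceptional set *)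

(* [Cov g A B D E T]: the exceptional set E costs at most T. The cost w is a superadditive function of
   squares that dominates the boundary integral of g on the squares of side about sigma which contain
   a given point of E. *)
Definition Cov (g : C -> C) (A B D : R) (E : C -> Prop) (T : R) : Prop :=
  exists w : R -> R -> R -> R,
  (forall a b d, 0 < d -> sub_sq a b d A B D -> 0 <= w a b d <= T) /\
  (forall a b d, 0 < d -> sub_sq a b d A B D ->
     w a b (d/2) + w (a + d/2) b (d/2) + w a (b + d/2) (d/2) + w (a + d/2) (b + d/2) (d/2) <= w a b d) /\
  (forall p, in_sq A B D p -> E p -> exists sg, 0 < sg <= D /\
     forall a b d, sub_sq a b d A B D -> in_sq a b d p -> sg / 2 < d <= sg ->
       Cmod (SI g a b d) <= w a b d).

(** The first [n] with [D / 2 ^ n <= sg] works: the scale before it exceeds [sg], and for [n = 0]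
    the two numbers are equal. The window from [sg / 2] to [sg] thus catches one generation of every
    dyadic subdivision. *)
Lemma dyadic_scale (D sg : R) : 0 < sg <= D -> exists n, sg / 2 < D / 2 ^ n <= sg.
Proof.
  intros [Hs HD].
  assert (H0 : exists n, D / 2 ^ n <= sg).
  { destruct (pow_lt_1_zero (/2) ltac:(rewrite Rabs_pos_eq; lra) (sg / D)) as [n Hn].
    { apply Rdiv_lt_0_compat; lra. }
    exists n. specialize (Hn n (Nat.le_refl n)).
    rewrite Rabs_pos_eq in Hn by (apply pow_le; lra).
    rewrite pow_inv in Hn. apply Rle_trans with (D * (sg / D)).
    - apply Rmult_le_compat_l; lra.
    - right; field; lra. }
  destruct H0 as [n Hn]. revert Hn. induction n as [|n IH]; intros Hn.
  - exists 0%nat. simpl in *. lra.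
  - destruct (Rle_dec (D / 2 ^ n) sg) as [H|H]; [auto|].
    exists (S n). split; [|easy]. simpl.
    replace (D / (2 * 2 ^ n)) with (D / 2 ^ n / 2); [lra|]. field. apply pow_nonzero; lra.
Qed.

Section Nested.
Variables (Phi : R -> R -> R -> C) (w : R -> R -> R -> R).

Definition bad (a b d : R) : Prop := w a b d < Cmod (Phi a b d).

(** The last quarter is taken without a test: if the other three are not bad, superadditivity of [w]
    leaves the excess to it. *)
Definition next_corner (d : R) (c : R * R) : R * R :=
  let (a, b) := c in
  if Rlt_dec (w a b (d/2)) (Cmod (Phi a b (d/2))) then (a, b)
  else if Rlt_dec (w (a + d/2) b (d/2)) (Cmod (Phi (a + d/2) b (d/2))) then (a + d/2, b)
  else if Rlt_dec (w a (b + d/2) (d/2)) (Cmod (Phi a (b + d/2) (d/2))) then (a, b + d/2)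
  else (a + d/2, b + d/2).

Fixpoint corner (A B D : R) (n : nat) : R * R :=
  match n with
  | O => (A, B)
  | S m => next_corner (D / 2 ^ m) (corner A B D m)
  end.

Lemma next_corner_cases d a b : let c := next_corner d (a, b) in
  (fst c = a \/ fst c = a + d/2) /\ (snd c = b \/ snd c = b + d/2).
Proof.
  unfold next_corner. repeat destruct Rlt_dec; cbn [fst snd]; lra.
Qed.

Lemma next_corner_bad d a b :
  (Cmod (Phi a b d) <= Cmod (Phi a b (d/2)) + Cmod (Phi (a + d/2) b (d/2))
     + Cmod (Phi a (b + d/2) (d/2)) + Cmod (Phi (a + d/2) (b + d/2) (d/2))) ->
  w a b (d/2) + w (a + d/2) b (d/2) + w a (b + d/2) (d/2) + w (a + d/2) (b + d/2) (d/2) <= w a b d ->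
  bad a b d -> let c := next_corner d (a, b) in bad (fst c) (snd c) (d/2).
Proof.
  unfold bad, next_corner. intros H1 H2 H3. repeat destruct Rlt_dec; cbn [fst snd]; lra.
Qed.

Lemma half_pow D n : D / 2 ^ (S n) = D / 2 ^ n / 2.
Proof. simpl. field. apply pow_nonzero; lra. Qed.

Lemma corner_nested A B D : 0 < D -> forall n m,
  sub_sq (fst (corner A B D (n + m))) (snd (corner A B D (n + m))) (D / 2 ^ (n + m))
         (fst (corner A B D m)) (snd (corner A B D m)) (D / 2 ^ m).
Proof.
  intros HD n m; induction n as [|n IH].
  - simpl. unfold sub_sq; lra.
  - change (S n + m)%nat with (S (n + m)). rewrite half_pow. cbn [corner].
    set (d := D / 2 ^ (n + m)) in *.
    assert (Hd : 0 < d) by (apply Rdiv_lt_0_compat; [easy|apply pow_lt; lra]).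
    destruct (corner A B D (n + m)) as [a b].
    pose proof (next_corner_cases d a b) as [H1 H2].
    unfold sub_sq in *. cbn [fst snd] in IH. lra.
Qed.

(** The lower left corners increase in both coordinates and stay below every upper right corner, so
    their supremum lies in all the squares. *)
Lemma nested_point (A B D : R) : 0 < D -> exists p : C, forall n,
  in_sq (fst (corner A B D n)) (snd (corner A B D n)) (D / 2 ^ n) p.
Proof.
  intros HD.
  assert (Hpos : forall n, 0 < D / 2 ^ n) by (intros; apply Rdiv_lt_0_compat; [easy|apply pow_lt; lra]).
  assert (Hall : forall k n, fst (corner A B D k) <= fst (corner A B D n) + D / 2 ^ n /\
                             snd (corner A B D k) <= snd (corner A B D n) + D / 2 ^ n).
  { intros k n. destruct (Nat.le_ge_cases n k) as [H|H].
    - pose proof (corner_nested A B D HD (k - n) n) as P.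
      replace (k - n + n)%nat with k in P by lia. unfold sub_sq in P. specialize (Hpos k). lra.
    - pose proof (corner_nested A B D HD (n - k) k) as P.
      replace (n - k + k)%nat with n in P by lia. unfold sub_sq in P. specialize (Hpos n). lra. }
  destruct (completeness (fun x => exists n, x = fst (corner A B D n))) as [x Hx].
  { exists (A + D). intros x [n ->]. destruct (Hall n 0%nat) as [H _]. simpl in H. lra. }
  { exists A, 0%nat; easy. }
  destruct (completeness (fun x => exists n, x = snd (corner A B D n))) as [y Hy].
  { exists (B + D). intros y [n ->]. destruct (Hall n 0%nat) as [_ H]. simpl in H. lra. }
  { exists B, 0%nat; easy. }
  exists (x, y). intros n. unfold in_sq; cbn [fst snd].
  destruct Hx as [Hx1 Hx2], Hy as [Hy1 Hy2].
  repeat split.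
  - apply Hx1; eauto.
  - apply Hx2. intros z [k ->]. apply Hall.
  - apply Hy1; eauto.
  - apply Hy2. intros z [k ->]. apply Hall.
Qed.
End Nested.

(** If the integral exceeded the cost, some quarter would inherit the excess at every halving. The
    squares shrink to a point [p], and the one whose side falls in the window of [p] has its
    integral dominated by its cost. *)
Lemma cov_finish g A B D T : 0 < D -> (forall z, in_sq A B D z -> ccont g z) ->
  Cov g A B D (fun _ => True) T -> Cmod (SI g A B D) <= T.
Proof.
  intros HD Hg [w [Hw1 [Hw2 Hw3]]].
  assert (H0 : sub_sq A B D A B D) by (unfold sub_sq; lra).
  apply Rle_trans with (w A B D); [|apply Hw1; auto].
  destruct (Rle_dec (Cmod (SI g A B D)) (w A B D)) as [H|H]; [easy|exfalso].
  apply Rnot_le_lt in H.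
  set (c := corner (SI g) w A B D).
  assert (Hpos : forall n, 0 < D / 2 ^ n) by (intros; apply Rdiv_lt_0_compat; [easy|apply pow_lt; lra]).
  assert (Hsub : forall n, sub_sq (fst (c n)) (snd (c n)) (D / 2 ^ n) A B D).
  { intros n. pose proof (corner_nested (SI g) w A B D HD n 0) as P.
    rewrite Nat.add_0_r in P. simpl in P. replace (D / 1) with D in P by field. exact P. }
  assert (Hbad : forall n, bad (SI g) w (fst (c n)) (snd (c n)) (D / 2 ^ n)).
  { induction n as [|n IH].
    - unfold c, bad; simpl. now replace (D / 1) with D by field.
    - rewrite half_pow. unfold c in *; cbn [corner].
      pose proof (Hsub n) as Hs. set (d := D / 2 ^ n) in *. fold c in IH, Hs.
      fold (c n). destruct (c n) as [a b]. cbn [fst snd] in *.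
      apply next_corner_bad; auto.
      + rewrite SI_quad; auto.
        * eapply Rle_trans; [apply Cmod_triangle|].
          apply Rplus_le_compat_r. eapply Rle_trans; [apply Cmod_triangle|].
          apply Rplus_le_compat_r, Cmod_triangle.
        * apply Hpos.
        * intros z Hz. apply Hg. eapply in_sq_sub; eauto.
      + apply Hw2; auto. apply Hpos. }
  destruct (nested_point (SI g) w A B D HD) as [p Hp].
  assert (Hp0 : in_sq A B D p).
  { specialize (Hp 0%nat). simpl in Hp. replace (D/1) with D in Hp by field. exact Hp. }
  destruct (Hw3 p Hp0 I) as [sg [Hs1 Hs2]].
  destruct (dyadic_scale D sg Hs1) as [n Hn].
  specialize (Hbad n). specialize (Hs2 _ _ _ (Hsub n) (Hp n) Hn). unfold bad in Hbad. lra.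
Qed.

Lemma sub_sq_quad a b d A B D : 0 < d -> sub_sq a b d A B D ->
  sub_sq a b (d/2) A B D /\ sub_sq (a + d/2) b (d/2) A B D /\
  sub_sq a (b + d/2) (d/2) A B D /\ sub_sq (a + d/2) (b + d/2) (d/2) A B D.
Proof. unfold sub_sq; intros; lra. Qed.

Lemma cov_mono g A B D (E E' : C -> Prop) T T' :
  (forall p, in_sq A B D p -> E' p -> E p) -> T <= T' -> Cov g A B D E T -> Cov g A B D E' T'.
Proof.
  intros HE HT [w [H1 [H2 H3]]]. exists w; repeat split.
  - now apply H1.
  - destruct (H1 a b d); auto; lra.
  - apply H2.
  - intros p Hp Ep. apply H3; auto.
Qed.

Lemma cov_union g A B D (E1 E2 : C -> Prop) T1 T2 :
  Cov g A B D E1 T1 -> Cov g A B D E2 T2 -> Cov g A B D (fun p => E1 p \/ E2 p) (T1 + T2).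
Proof.
  intros [w [H1 [H2 H3]]] [v [K1 [K2 K3]]].
  exists (fun a b d => w a b d + v a b d); repeat split.
  - specialize (H1 a b d H H0); specialize (K1 a b d H H0); lra.
  - specialize (H1 a b d H H0); specialize (K1 a b d H H0); lra.
  - intros. specialize (H2 a b d H H0); specialize (K2 a b d H H0); lra.
  - intros p Hp [Ep|Ep].
    + destruct (H3 p Hp Ep) as [sg [Hs Hs']]; exists sg; split; [easy|].
      intros a b d Hab Hin Hd. specialize (Hs' a b d Hab Hin Hd).
      destruct (K1 a b d); auto; lra.
    + destruct (K3 p Hp Ep) as [sg [Hs Hs']]; exists sg; split; [easy|].
      intros a b d Hab Hin Hd. specialize (Hs' a b d Hab Hin Hd).
      destruct (H1 a b d); auto; lra.
Qed.

Lemma cov_finite g A B D (E : nat -> C -> Prop) (T : nat -> R) n :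
  (forall i, (i <= n)%nat -> Cov g A B D (E i) (T i)) ->
  Cov g A B D (fun p => exists i, (i <= n)%nat /\ E i p) (sum_f_R0 T n).
Proof.
  induction n as [|n IH]; intros H.
  - simpl. apply (cov_mono g A B D (E 0%nat) _ (T 0%nat)); [|lra|auto].
    intros p _ [i [Hi Ep]]. now replace i with 0%nat in Ep by lia.
  - cbn [sum_f_R0].
    apply (cov_mono g A B D (fun p => (exists i, (i <= n)%nat /\ E i p) \/ E (S n) p) _
             (sum_f_R0 T n + T (S n))); [|lra|].
    + intros p _ [i [Hi Ep]]. destruct (Nat.eq_dec i (S n)) as [->|]; [now right|].
      left; exists i; split; [lia|easy].
    + apply cov_union; auto.
Qed.

(** A convergent sum of superadditive weights is superadditive. At a point of [E i] the weight with
    index [i] already dominates, and the others only add to it. *)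
Lemma cov_series g A B D (E : nat -> C -> Prop) (T : nat -> R) :
  (forall i, Cov g A B D (E i) (T i)) -> (forall i, 0 <= T i) -> ex_series T ->
  Cov g A B D (fun p => exists i, E i p) (Series T).
Proof.
  intros H HT HS.
  destruct (ClassicalEpsilon.choice _ H) as [w Hw].
  assert (Hex : forall a b d, 0 < d -> sub_sq a b d A B D -> ex_series (fun i => w i a b d)).
  { intros a b d Hd Hs. apply (ex_series_le (V := R_CompleteNormedModule) _ T); [|easy].
    intros i. destruct (Hw i) as [H1 _]. specialize (H1 a b d Hd Hs).
    change (Rabs (w i a b d) <= T i). rewrite Rabs_pos_eq; lra. }
  exists (fun a b d => Series (fun i => w i a b d)); repeat split.
  - rewrite <- (Rmult_0_l (Series (fun _ => 0))). rewrite <- Series_scal_l.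
    apply Series_le; [|auto]. intros i; destruct (Hw i) as [H2 _].
    specialize (H2 a b d H0 H1). lra.
  - apply Series_le; auto. intros i; destruct (Hw i) as [H2 _].
    specialize (H2 a b d H0 H1). lra.
  - intros a b d Hd Hs.
    destruct (sub_sq_quad a b d A B D Hd Hs) as [S1 [S2 [S3 S4]]].
    assert (Hd2 : 0 < d/2) by lra.
    rewrite <- !Series_plus by (repeat apply (ex_series_plus (V := R_NormedModule)); auto).
    apply Series_le; auto.
    intros i; destruct (Hw i) as [W1 [W2 _]]. split; [|now apply W2].
    pose proof (W1 _ _ _ Hd2 S1); pose proof (W1 _ _ _ Hd2 S2);
    pose proof (W1 _ _ _ Hd2 S3); pose proof (W1 _ _ _ Hd2 S4); lra.
  - intros p Hp [i Ep]. destruct (Hw i) as [W1 [W2 W3]].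
    destruct (W3 p Hp Ep) as [sg [Hs Hs']]; exists sg; split; [easy|].
    intros a b d Hab Hin Hd. specialize (Hs' a b d Hab Hin Hd).
    eapply Rle_trans; [apply Hs'|].
    assert (Hdp : 0 < d) by lra.
    assert (Hnn : forall j, 0 <= w j a b d) by (intros j; destruct (Hw j) as [V1 _]; now apply V1).
    rewrite (Series_incr_n _ (S i)); [|lia|now apply Hex].
    simpl pred. rewrite <- (Rplus_0_r (w i a b d)). apply Rplus_le_compat.
    + clear - Hnn. destruct i; [simpl; lra|]. simpl.
      assert (0 <= sum_f_R0 (fun k => w k a b d) i) by (apply cond_pos_sum; auto). lra.
    + rewrite <- (Rmult_0_l (Series (fun _ => 0))), <- Series_scal_l.
      apply Series_le.
      * intros k. rewrite Rmult_0_l. split; [lra|auto].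
      * apply (ex_series_incr_n (fun j => w j a b d) (S i)); auto.
Qed.

(** * Weights given by the area of overlap with a box *)

Definition ovl (l r a d : R) : R := Rmax 0 (Rmin r (a + d) - Rmax l a).

Lemma ovl_nonneg l r a d : 0 <= ovl l r a d.
Proof. apply Rmax_l. Qed.

Lemma ovl_le l r a d : l <= r -> ovl l r a d <= r - l.
Proof.
  unfold ovl. intros H. apply Rmax_lub; [lra|].
  pose proof (Rmin_l r (a+d)). pose proof (Rmax_l l a). lra.
Qed.

Lemma ovl_full l r a d : 0 <= d -> l <= a -> a + d <= r -> ovl l r a d = d.
Proof.
  intros. unfold ovl. rewrite Rmin_right, (Rmax_right l a), Rmax_right by lra. ring.
Qed.

Lemma ovl_half l r a d : 0 < d -> ovl l r a (d/2) + ovl l r (a + d/2) (d/2) <= ovl l r a d.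
Proof.
  intros. unfold ovl, Rmax, Rmin. replace (a + d/2 + d/2) with (a + d) by field.
  repeat destruct Rle_dec; lra.
Qed.

(** The weight is [tau] times the area common to the square and the box, which is superadditive. A
    square from the window of a point of [E] lies inside the box, so its weight is the full
    [tau * (d * d)]. *)
Lemma cov_box g A B D (E : C -> Prop) l1 r1 l2 r2 tau T sg :
  l1 <= r1 -> l2 <= r2 -> 0 <= tau -> 0 < sg <= D -> tau * ((r1 - l1) * (r2 - l2)) <= T ->
  (forall p a b d, in_sq A B D p -> E p -> sub_sq a b d A B D -> in_sq a b d p -> sg/2 < d <= sg ->
     l1 <= a /\ a + d <= r1 /\ l2 <= b /\ b + d <= r2 /\ Cmod (SI g a b d) <= tau * (d * d)) ->
  Cov g A B D E T.
Proof.
  intros Hl1 Hl2 Htau Hsg HT H.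
  exists (fun a b d => tau * (ovl l1 r1 a d * ovl l2 r2 b d)); repeat split.
  - apply Rmult_le_pos; [easy|apply Rmult_le_pos; apply ovl_nonneg].
  - eapply Rle_trans; [|apply HT]. apply Rmult_le_compat_l; [easy|].
    apply Rmult_le_compat; auto using ovl_nonneg, ovl_le.
  - intros a b d Hd _.
    pose proof (ovl_half l1 r1 a d Hd). pose proof (ovl_half l2 r2 b d Hd).
    assert (K : (ovl l1 r1 a (d/2) + ovl l1 r1 (a + d/2) (d/2)) * (ovl l2 r2 b (d/2) + ovl l2 r2 (b + d/2) (d/2))
         <= ovl l1 r1 a d * ovl l2 r2 b d).
    { apply Rmult_le_compat; auto.
      - pose proof (ovl_nonneg l1 r1 a (d/2)); pose proof (ovl_nonneg l1 r1 (a+d/2) (d/2)); lra.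
      - pose proof (ovl_nonneg l2 r2 b (d/2)); pose proof (ovl_nonneg l2 r2 (b+d/2) (d/2)); lra. }
    apply (Rmult_le_compat_l tau) in K; [|easy]. lra.
  - intros p Hp Ep. exists sg; split; [easy|]. intros a b d Hs Hin Hd.
    destruct (H p a b d Hp Ep Hs Hin Hd) as [K1 [K2 [K3 [K4 K5]]]].
    rewrite !ovl_full by lra. easy.
Qed.

(** In the window [2 * d / sg] is at least 1, so a bound by the perimeter becomes a bound by the
    area, at the price of the density [8 * X / sg]. *)
Lemma perimeter_le_area X d sg : 0 <= X -> 0 < sg -> sg / 2 < d -> 4 * d * X <= 8 * X / sg * (d * d).
Proof.
  intros HX Hs Hd. replace (8 * X / sg * (d * d)) with (4 * d * X * (2 * d / sg)) by (field; lra).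
  rewrite <- (Rmult_1_r (4 * d * X)) at 1. apply Rmult_le_compat_l; [apply Rmult_le_pos; lra|].
  apply Rmult_le_reg_r with sg; [easy|]. replace (2 * d / sg * sg) with (2 * d) by (field; lra). lra.
Qed.

Lemma SI_affine_zero c0 c1 p a b d : 0 < d -> SI (fun z => c0 + c1 * (z - p))%C a b d = 0.
Proof.
  intros Hd.
  assert (Hid : SI (fun z => z) a b d = 0).
  { unfold SI.
    assert (HH : forall y, CI (fun t => (t, y)) a (a + d) = ((a * d + d * d / 2)%R, (d * y)%R)).
    { intros y. apply (is_RInt_unique (V := C_R_CompleteNormedModule)).
      apply (is_RInt_fct_extend_pair (U := R_NormedModule) (V := R_NormedModule)); cbn [fst snd].
      - evar_last; [apply (is_RInt_derive (fun t => t * t / 2) (fun t => t))|].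
        + intros; auto_derive; [easy|]. field.
        + intros; apply continuous_id.
        + unfold minus, plus, opp; simpl. field.
      - evar_last; [apply (is_RInt_const (V := R_NormedModule))|].
        unfold scal; simpl; unfold mult; simpl. ring. }
    assert (HV : forall x, CI (fun t => (x, t)) b (b + d) = ((d * x)%R, (b * d + d * d / 2)%R)).
    { intros x. apply (is_RInt_unique (V := C_R_CompleteNormedModule)).
      apply (is_RInt_fct_extend_pair (U := R_NormedModule) (V := R_NormedModule)); cbn [fst snd].
      - evar_last; [apply (is_RInt_const (V := R_NormedModule))|].
        unfold scal; simpl; unfold mult; simpl. ring.
      - evar_last; [apply (is_RInt_derive (fun t => t * t / 2) (fun t => t))|].
        + intros; auto_derive; [easy|]. field.
        + intros; apply continuous_id.
        + unfold minus, plus, opp; simpl. field. }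
    rewrite !HH, !HV. unfold Ci, Cminus, Cplus, Copp, Cmult, RtoC; cbn [fst snd].
    apply injective_projections; cbn [fst snd]; field. }
  rewrite (SI_ext _ (fun z => (c0 - c1 * p) + c1 * z)%C) by (try lra; intros; ring).
  rewrite (SI_plus (fun _ => c0 - c1 * p)%C (fun z => c1 * z)%C); try lra.
  - rewrite SI_const, SI_scal, Hid; [ring|lra|]. intros z _; apply ccont_id.
  - intros z _; apply ccont_const.
  - intros z _; apply ccont_mult; [apply ccont_const|apply ccont_id].
Qed.

(** The affine part of [g] at [p] integrates to zero, and the remainder is o(d) along a boundary of
    length [4 * d]. *)
Lemma SI_diff_small g p : cdiffable g p -> forall eta, 0 < eta -> exists dl, 0 < dl /\
  forall a b d, 0 < d <= dl -> in_sq a b d p -> (forall z, in_sq a b d z -> ccont g z) ->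
    Cmod (SI g a b d) <= eta * (d * d).
Proof.
  intros [L [phi [Hphi [_ He]]]] eta Heta.
  (* A perimeter [4 * d] times a remainder [eta / 8 * (2 * d)] is [eta * (d * d)]; the choice
     [dl / 3] below keeps the diameter bound [2 * d] under [dl]. *)
  destruct (Hphi (eta / 8)) as [dl [Hdl H]]; [lra|].
  exists (dl / 3); split; [lra|]. intros a b d [Hd1 Hd2] Hp Hc.
  assert (E : SI g a b d = SI (fun z => g z - (g p + phi p * (z - p)))%C a b d).
  { rewrite SI_minus; try lra.
    - rewrite SI_affine_zero by easy. ring.
    - intros z Hz; apply Hc; apply on_sq_in; [lra|easy].
    - intros z Hz. apply ccont_plus; [apply ccont_const|].
      apply ccont_mult; [apply ccont_const|apply ccont_minus; [apply ccont_id|apply ccont_const]]. }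
  rewrite E. eapply Rle_trans; [apply (SI_norm_le _ (eta / 8 * (2 * d)))|].
  - lra.
  - intros z Hz. apply ccont_minus; [apply Hc; apply on_sq_in; [lra|easy]|].
    apply ccont_plus; [apply ccont_const|].
    apply ccont_mult; [apply ccont_const|apply ccont_minus; [apply ccont_id|apply ccont_const]].
  - intros z Hz. apply on_sq_in in Hz; [|lra].
    pose proof (in_sq_dist a b d z p Hz Hp) as Hdist.
    rewrite (He z). replace (g p + phi z * (z - p) - (g p + phi p * (z - p)))%C
      with ((phi z - phi p) * (z - p))%C by ring.
    rewrite Cmod_mult. apply Rmult_le_compat; try apply Cmod_ge_0; [|easy].
    left; apply H; lra.
  - right; field.
Qed.

(** The weight is the area, scaled to total [eta]; every point of differentiability supplies its own
    scale. *)
Lemma cov_diff g A B D eta : 0 < D -> 0 < eta -> (forall z, in_sq A B D z -> ccont g z) ->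
  Cov g A B D (cdiffable g) eta.
Proof.
  intros HD He Hc.
  exists (fun a b d => eta / (D * D) * (d * d)); repeat split.
  - assert (0 < eta / (D * D)) by (apply Rdiv_lt_0_compat; [easy|nra]). nra.
  - replace eta with (eta / (D * D) * (D * D)) at 2 by (field; lra).
    assert (0 < eta / (D * D)) by (apply Rdiv_lt_0_compat; [easy|nra]).
    apply Rmult_le_compat_l; [lra|]. unfold sub_sq in H0. nra.
  - intros; lra.
  - intros p Hp Ep.
    destruct (SI_diff_small g p Ep (eta / (D * D))) as [dl [Hdl H]]; [apply Rdiv_lt_0_compat; [easy|nra]|].
    exists (Rmin dl D). split; [split; [now apply Rmin_pos|apply Rmin_r]|].
    intros a b d Hs Hin Hd. pose proof (Rmin_l dl D). assert (0 < Rmin dl D) by now apply Rmin_pos.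
    apply H; auto; [lra|]. intros z Hz; apply Hc. eapply in_sq_sub; eauto.
Qed.

(** * Cauchy's theorem and integral formula on squares *)

(** Continuity bounds [g] by [M] near [z]. A box of side [2 * sg] with density [8 * M / sg] then
    costs [32 * M * sg], which vanishes with [sg]. *)
Lemma cov_point g A B D z : 0 < D -> in_sq A B D z -> (forall p, in_sq A B D p -> ccont g p) ->
  forall e, 0 < e -> Cov g A B D (fun p => p = z) e.
Proof.
  intros HD Hz Hg e He.
  destruct (Hg z Hz 1 Rlt_0_1) as [dl [Hdl Hb]].
  set (M := Cmod (g z) + 1).
  assert (HM : 1 <= M) by (unfold M; pose proof (Cmod_ge_0 (g z)); lra).
  set (sg := Rmin D (Rmin (dl / 3) (e / (32 * M)))).
  assert (Hsg : 0 < sg).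
  { repeat apply Rmin_pos; try lra. apply Rdiv_lt_0_compat; lra. }
  assert (S1 : sg <= D) by apply Rmin_l.
  assert (S2 : sg <= dl / 3) by (eapply Rle_trans; [apply Rmin_r|apply Rmin_l]).
  assert (S3 : sg <= e / (32 * M)) by (eapply Rle_trans; [apply Rmin_r|apply Rmin_r]).
  apply (cov_box g A B D _ (fst z - sg) (fst z + sg) (snd z - sg) (snd z + sg) (8 * M / sg) e sg).
  - lra.
  - lra.
  - apply Rlt_le, Rdiv_lt_0_compat; lra.
  - lra.
  - replace (8 * M / sg * ((fst z + sg - (fst z - sg)) * (snd z + sg - (snd z - sg))))
      with (32 * M * sg) by (field; lra).
    apply Rle_trans with (32 * M * (e / (32 * M))); [|right; field; lra].
    apply Rmult_le_compat_l; lra.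
  - intros p a b d Hp -> Hs Hin Hd. assert (Hin' := Hin). unfold in_sq in Hin'.
    repeat split; try lra.
    assert (Hd0 : 0 < d) by lra.
    eapply Rle_trans; [apply (SI_norm_le g M)|].
    + lra.
    + intros w Hw. apply Hg. eapply in_sq_sub; [apply Hs|apply on_sq_in; [lra|easy]].
    + intros w Hw. apply on_sq_in in Hw; [|lra].
      pose proof (in_sq_dist a b d w z Hw Hin).
      specialize (Hb w ltac:(lra)). pose proof (Cmod_sub_le (g w) (g z)). unfold M; lra.
    + apply perimeter_le_area; lra.
Qed.

Lemma goursat_null g A B D (E : C -> Prop) : 0 < D -> (forall z, in_sq A B D z -> ccont g z) ->
  (forall e, 0 < e -> Cov g A B D E e) ->
  (forall p, in_sq A B D p -> cdiffable g p \/ E p) -> SI g A B D = 0.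
Proof.
  intros HD Hc HE Hp. apply Cmod_eq_0.
  apply Rle_antisym; [|apply Cmod_ge_0].
  apply le_epsilon. intros e He. rewrite Rplus_0_l.
  apply cov_finish; auto.
  apply (cov_mono g A B D (fun p => cdiffable g p \/ E p) _ (e/2 + e/2)); [auto|lra|].
  apply cov_union; [apply cov_diff; auto; lra|apply HE; lra].
Qed.

Lemma goursat g A B D : 0 < D -> (forall z, in_sq A B D z -> cdiffable g z) -> SI g A B D = 0.
Proof.
  intros HD H. apply (goursat_null g A B D (fun _ => False)); auto.
  - intros z Hz. now apply cdiffable_ccont, H.
  - intros e He. apply (cov_mono g A B D (cdiffable g) _ e); [easy|lra|].
    apply cov_diff; auto. intros z Hz. now apply cdiffable_ccont, H.
Qed.

(** * The integral of 1/(w - z) around a square *)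

Lemma atan_div_add (x y : R) : 0 < x -> 0 < y -> atan (x / y) + atan (y / x) = PI / 2.
Proof.
  intros Hx Hy. replace (y / x) with (/ (x / y)) by (field; lra).
  rewrite atan_inv; [ring|]. now apply Rdiv_lt_0_compat.
Qed.

(** The primitive is the complex logarithm: half the logarithm of the squared modulus, and an angle
    written with [atan], which is smooth along a line that misses [z]. *)
Lemma CI_inv_h (z : C) (a b y : R) : y - snd z <> 0 ->
  CI (fun t => / ((t, y) - z))%C a b =
  ((ln ((b - fst z)^2 + (y - snd z)^2) / 2 - ln ((a - fst z)^2 + (y - snd z)^2) / 2)%R,
   (- atan ((b - fst z) / (y - snd z)) - - atan ((a - fst z) / (y - snd z)))%R).
Proof.
  intros Hr. set (r := y - snd z) in *.
  assert (P : forall t, 0 < (t - fst z)^2 + r^2) by (intros t; pose proof (pow2_ge_0 (t - fst z)); pose proof (pow2_gt_0 r Hr); lra).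
  apply (is_RInt_unique (V := C_R_CompleteNormedModule)).
  apply (is_RInt_fct_extend_pair (U := R_NormedModule) (V := R_NormedModule)); cbn [fst snd Cinv Cminus Cplus Copp].
  - apply (is_RInt_ext (V := R_NormedModule) (fun t => (t - fst z) / ((t - fst z)^2 + r^2))); [reflexivity|].
    apply (is_RInt_derive (V := R_CompleteNormedModule) (fun t => ln ((t - fst z)^2 + r^2) / 2)).
    + intros t _. auto_derive; [specialize (P t); simpl in P; exact P|].
      specialize (P t). field. simpl in *. lra.
    + intros t _. apply (ex_derive_continuous (V := R_NormedModule)). auto_derive.
      specialize (P t); simpl in *; lra.
  - apply (is_RInt_ext (V := R_NormedModule) (fun t => - r / ((t - fst z)^2 + r^2))); [reflexivity|].
    apply (is_RInt_derive (V := R_CompleteNormedModule) (fun t => - atan ((t - fst z) / r))).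
    + intros t _. auto_derive; [easy|]. specialize (P t). field. simpl in P. repeat split; try easy; lra.
    + intros t _. apply (ex_derive_continuous (V := R_NormedModule)). auto_derive.
      specialize (P t); simpl in *; lra.
Qed.

Lemma CI_inv_v (z : C) (a b x : R) : x - fst z <> 0 ->
  CI (fun t => / ((x, t) - z))%C a b =
  ((atan ((b - snd z) / (x - fst z)) - atan ((a - snd z) / (x - fst z)))%R,
   (- (ln ((x - fst z)^2 + (b - snd z)^2) / 2) - - (ln ((x - fst z)^2 + (a - snd z)^2) / 2))%R).
Proof.
  intros Hr. set (r := x - fst z) in *.
  assert (P : forall t, 0 < r^2 + (t - snd z)^2) by (intros t; pose proof (pow2_ge_0 (t - snd z)); pose proof (pow2_gt_0 r Hr); lra).
  apply (is_RInt_unique (V := C_R_CompleteNormedModule)).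
  apply (is_RInt_fct_extend_pair (U := R_NormedModule) (V := R_NormedModule)); cbn [fst snd Cinv Cminus Cplus Copp].
  - apply (is_RInt_ext (V := R_NormedModule) (fun t => r / (r^2 + (t - snd z)^2))); [reflexivity|].
    apply (is_RInt_derive (V := R_CompleteNormedModule) (fun t => atan ((t - snd z) / r))).
    + intros t _. auto_derive; [easy|]. specialize (P t). field. simpl in P. repeat split; try easy; lra.
    + intros t _. apply (ex_derive_continuous (V := R_NormedModule)). auto_derive.
      specialize (P t); simpl in *; lra.
  - apply (is_RInt_ext (V := R_NormedModule) (fun t => - (t - snd z) / (r^2 + (t - snd z)^2))); [reflexivity|].
    apply (is_RInt_derive (V := R_CompleteNormedModule) (fun t => - (ln (r^2 + (t - snd z)^2) / 2))).
    + intros t _. auto_derive; [specialize (P t); simpl in P; exact P|].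
      specialize (P t). field. simpl in *. lra.
    + intros t _. apply (ex_derive_continuous (V := R_NormedModule)). auto_derive.
      specialize (P t); simpl in *; lra.
Qed.

Definition C2pi : C := (2 * PI * Ci)%C.

Lemma C2pi_neq0 : C2pi <> 0.
Proof.
  unfold C2pi. repeat apply Cmult_neq_0; intros E; try (apply RtoC_inj in E); pose proof PI_RGT_0; try lra.
  now apply Ci_nz.
Qed.

Lemma Cmod_C2pi : Cmod C2pi = 2 * PI.
Proof.
  unfold C2pi. rewrite !Cmod_mult, Cmod_Ci, !Cmod_R. pose proof PI_RGT_0. rewrite !Rabs_pos_eq; lra.
Qed.

(** The logarithms cancel at the corners. The two [atan] terms at each corner are complementary
    angles, and four right angles make [2 * PI]. *)
Lemma SI_inv a b d z : int_sq a b d z -> SI (fun w => / (w - z))%C a b d = C2pi.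
Proof.
  intros [[H1 H2] [H3 H4]]. unfold SI.
  rewrite !CI_inv_h, !CI_inv_v by lra.
  assert (Neg : forall x y, y <> 0 -> atan (x / - y) = - atan (x / y)).
  { intros x y Hy. rewrite <- atan_opp. f_equal. field. lra. }
  set (p := fst z - a). set (q := a + d - fst z). set (r := snd z - b). set (s := b + d - snd z).
  assert (Hp : 0 < p) by (unfold p; lra). assert (Hq : 0 < q) by (unfold q; lra).
  assert (Hr : 0 < r) by (unfold r; lra). assert (Hs : 0 < s) by (unfold s; lra).
  replace (a - fst z) with (- p) by (unfold p; ring).
  replace (b - snd z) with (- r) by (unfold r; ring).
  replace (q / - r) with (- (q / r)) by (field; lra).
  replace (- p / - r) with (p / r) by (field; lra).
  replace (- r / q) with (- (r / q)) by (field; lra).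
  replace (- p / s) with (- (p / s)) by (field; lra).
  replace (s / - p) with (- (s / p)) by (field; lra).
  replace (- r / - p) with (r / p) by (field; lra).
  rewrite !atan_opp.
  pose proof (atan_div_add p r Hp Hr). pose proof (atan_div_add q r Hq Hr).
  pose proof (atan_div_add p s Hp Hs). pose proof (atan_div_add q s Hq Hs).
  unfold C2pi, Ci, Cminus, Cplus, Copp, Cmult, RtoC; cbn [fst snd].
  apply injective_projections; cbn [fst snd].
  - replace ((- p) ^ 2 + (- r)^2) with (p^2 + r^2) by ring.
    replace ((- p) ^ 2 + s^2) with (p^2 + s^2) by ring.
    replace (q ^ 2 + (- r)^2) with (q^2 + r^2) by ring. ring.
  - lra.
Qed.

Lemma int_sq_in a b d z : int_sq a b d z -> in_sq a b d z.
Proof. unfold int_sq, in_sq; lra. Qed.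

(** [phi] is the difference quotient of [f] at [z]. Its integral vanishes, since [z], where it is
    only known to be continuous, and [E] have arbitrarily small cost; what remains is [f z] times
    the integral of 1/(w - z). *)
Lemma cauchy_formula f phi A B D (E : C -> Prop) z : 0 < D -> int_sq A B D z ->
  (forall p, in_sq A B D p -> ccont f p) ->
  ccont phi z -> (forall w, f w = f z + phi w * (w - z))%C ->
  (forall p, in_sq A B D p -> cdiffable f p \/ E p) ->
  (forall e, 0 < e -> Cov phi A B D E e) ->
  SI (fun w => f w * / (w - z))%C A B D = (C2pi * f z)%C.
Proof.
  intros HD Hz Hc Hphi He Hd HE.
  assert (Hval : forall w, w <> z -> phi w = ((f w - f z) * / (w - z))%C).
  { intros w Hw. rewrite (He w). field. now apply Cminus_eq_contra. }
  assert (Hloc : forall p, p <> z -> exists dl, 0 < dl /\ forall w, Cmod (w - p) < dl ->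
            ((f w - f z) * / (w - z))%C = phi w).
  { intros p Hp. exists (Cmod (p - z)); split; [now apply Cmod_pos_sub|].
    intros w Hw. rewrite Hval; [easy|]. intros ->. rewrite Cmod_minus_sym in Hw; lra. }
  assert (Hcphi : forall p, in_sq A B D p -> ccont phi p).
  { intros p Hp. destruct (Ceq_dec p z) as [->|n]; [easy|].
    destruct (Hloc p n) as [dl [Hdl Hl]].
    apply (ccont_ext_loc _ phi p dl Hdl Hl).
    apply ccont_mult; [apply ccont_minus; [auto|apply ccont_const]|].
    now apply ccont_inv_sub. }
  assert (H0 : SI phi A B D = 0).
  { apply (goursat_null phi A B D (fun p => p = z \/ E p)); auto.
    - intros e Hepos. apply (cov_mono phi A B D (fun p => p = z \/ E p) _ (e/2 + e/2)); [easy|lra|].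
      apply cov_union; [apply cov_point; auto; [now apply int_sq_in|lra]|apply HE; lra].
    - intros p Hp. destruct (Ceq_dec p z) as [->|n]; [auto|].
      destruct (Hd p Hp) as [Hf|Hf]; [left|auto].
      destruct (Hloc p n) as [dl [Hdl Hl]].
      apply (cdiffable_ext_loc _ phi p dl Hdl Hl).
      apply cdiffable_mult; [apply cdiffable_minus; [auto|apply cdiffable_const]|].
      now apply cdiffable_inv_sub. }
  assert (Hne : forall w, on_sq A B D w -> w <> z).
  { intros w Hw ->. eapply on_not_int; eauto. }
  rewrite (SI_ext _ (fun w => phi w + f z * / (w - z))%C); [|lra|].
  - rewrite (SI_plus phi (fun w => f z * / (w - z))%C); [|lra| |].
    + rewrite H0, SI_scal, SI_inv; auto; [ring|lra|].
      intros w Hw. now apply ccont_inv_sub, Hne.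
    + intros w Hw. apply Hcphi, on_sq_in; [lra|easy].
    + intros w Hw. apply ccont_mult; [apply ccont_const|].
      now apply ccont_inv_sub, Hne.
  - intros w Hw. rewrite Hval by auto. field. now apply Cminus_eq_contra, Hne.
Qed.

(** * Cauchy integrals over a square and their derivatives *)

Definition CK (phi : C -> C) (a b d : R) (m : nat) (z : C) : C :=
  SI (fun w => phi w * (/ (w - z)) ^ m)%C a b d.

Lemma on_sq_dist a b d z : 0 < d -> ~ on_sq a b d z -> exists eta, 0 < eta /\
  forall w, on_sq a b d w -> eta <= Cmod (w - z).
Proof.
  intros Hd Hz.
  assert (Hx : forall w : C, Rabs (fst w - fst z) <= Cmod (w - z)) by (intros w; apply (fst_le_Cmod (w - z)%C)).
  assert (Hy : forall w : C, Rabs (snd w - snd z) <= Cmod (w - z)) by (intros w; apply (snd_le_Cmod (w - z)%C)).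
  assert (Abs : forall x, x <= Rabs x) by apply Rle_abs.
  assert (Abs' : forall x, - x <= Rabs x) by (intros x; rewrite <- Rabs_Ropp; apply Rle_abs).
  destruct (Rlt_dec (fst z) a) as [C1|C1].
  { exists (a - fst z); split; [lra|]. intros w Hw. specialize (Hx w). specialize (Abs (fst w - fst z)).
    apply on_sq_in in Hw; [|lra]. unfold in_sq in Hw. lra. }
  destruct (Rlt_dec (a + d) (fst z)) as [C2|C2].
  { exists (fst z - (a + d)); split; [lra|]. intros w Hw. specialize (Hx w). specialize (Abs' (fst w - fst z)).
    apply on_sq_in in Hw; [|lra]. unfold in_sq in Hw. lra. }
  destruct (Rlt_dec (snd z) b) as [C3|C3].
  { exists (b - snd z); split; [lra|]. intros w Hw. specialize (Hy w). specialize (Abs (snd w - snd z)).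
    apply on_sq_in in Hw; [|lra]. unfold in_sq in Hw. lra. }
  destruct (Rlt_dec (b + d) (snd z)) as [C4|C4].
  { exists (snd z - (b + d)); split; [lra|]. intros w Hw. specialize (Hy w). specialize (Abs' (snd w - snd z)).
    apply on_sq_in in Hw; [|lra]. unfold in_sq in Hw. lra. }
  destruct (in_sq_cases a b d z) as [H|H]; [unfold in_sq; lra|easy|].
  unfold int_sq in H.
  exists (Rmin (Rmin (fst z - a) (a + d - fst z)) (Rmin (snd z - b) (b + d - snd z))).
  split; [repeat apply Rmin_pos; lra|]. intros w Hw.
  set (m1 := Rmin (fst z - a) (a + d - fst z)). set (m2 := Rmin (snd z - b) (b + d - snd z)).
  pose proof (Rmin_l m1 m2). pose proof (Rmin_r m1 m2).
  assert (m1 <= fst z - a) by apply Rmin_l. assert (m1 <= a + d - fst z) by apply Rmin_r.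
  assert (m2 <= snd z - b) by apply Rmin_l. assert (m2 <= b + d - snd z) by apply Rmin_r.
  specialize (Hx w); specialize (Hy w).
  pose proof (Abs (fst w - fst z)); pose proof (Abs' (fst w - fst z)).
  pose proof (Abs (snd w - snd z)); pose proof (Abs' (snd w - snd z)).
  unfold on_sq in Hw. lra.
Qed.

(** For q = 1/(w - z), q' = 1/(w - z') and h = z' - z the equation assumed is the resolvent
    identity. The conclusion is the second-order Taylor estimate for (w - z)^(-m), uniform as long
    as q and q' stay bounded. *)
Lemma inv_pow_taylor (B : R) : 0 <= B -> forall m, exists K, 0 <= K /\
  forall q q' h : C, Cmod q <= B -> Cmod q' <= B -> (q' - q = h * (q * q'))%C ->
    Cmod (q' ^ m - q ^ m - RtoC (INR m) * h * q ^ (S m)) <= K * (Cmod h * Cmod h).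
Proof.
  intros HB m; induction m as [|m [K [HK IH]]].
  - exists 0; split; [lra|]. intros q q' h _ _ _. simpl.
    replace (1 - 1 - RtoC 0 * h * (q * 1))%C with (RtoC 0) by ring. rewrite Cmod_0; lra.
  - exists (B * K + INR (S m) * (B ^ S (S m) * B)); split.
    { apply Rplus_le_le_0_compat; [now apply Rmult_le_pos|].
      repeat apply Rmult_le_pos; auto using pos_INR, pow_le. }
    intros q q' h Hq Hq' E.
    replace (q' ^ S m - q ^ S m - RtoC (INR (S m)) * h * q ^ S (S m))%C
      with (q' * (q' ^ m - q ^ m - RtoC (INR m) * h * q ^ (S m))
            + RtoC (INR (S m)) * h * h * q ^ S (S m) * q')%C.
    + eapply Rle_trans; [apply Cmod_triangle|]. rewrite !Cmod_mult, Cmod_pow, Cmod_R.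
      rewrite (Rabs_pos_eq (INR (S m))) by apply pos_INR.
      specialize (IH q q' h Hq Hq' E).
      rewrite Rmult_plus_distr_r. apply Rplus_le_compat.
      * rewrite Rmult_assoc. apply Rmult_le_compat; auto using Cmod_ge_0.
      * replace (INR (S m) * Cmod h * Cmod h * Cmod q ^ S (S m) * Cmod q')
          with (INR (S m) * (Cmod q ^ S (S m) * Cmod q') * (Cmod h * Cmod h)) by ring.
        apply Rmult_le_compat_r; [apply Rmult_le_pos; apply Cmod_ge_0|].
        apply Rmult_le_compat_l; [apply pos_INR|].
        apply Rmult_le_compat; auto using Cmod_ge_0, pow_le.
        apply pow_incr; split; auto using Cmod_ge_0.
    + assert (E1 : (h * (q * q'))%C = (q' - q)%C) by easy.
      rewrite S_INR, RtoC_plus. rewrite !Cpow_S.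
      replace ((RtoC (INR m) + 1) * h * h * (q * (q * q ^ m)) * q')%C
        with ((RtoC (INR m) + 1) * h * (q * q ^ m) * (h * (q * q')))%C by ring.
      rewrite E1.
      replace ((RtoC (INR m) + 1) * h * (q * q ^ m) * (q' - q))%C
        with (RtoC (INR m) * h * (q * q^m) * (q' - q) + q ^ m * (h * (q * q')) - q * q ^ m * h * q)%C by ring.
      rewrite E1. ring.
Qed.

Lemma ccont_kernel phi (z w : C) m : ccont phi w -> w <> z -> ccont (fun w => phi w * (/ (w - z)) ^ m)%C w.
Proof.
  intros H Hn. apply ccont_mult; [easy|].
  apply (ccont_pow (fun w => / (w - z))%C).
  now apply ccont_inv_sub.
Qed.

Lemma CK_diff phi a b d m z M : 0 < d -> ~ on_sq a b d z -> ccont_bd phi a b d ->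
  (forall w, on_sq a b d w -> Cmod (phi w) <= M) ->
  cdiff (CK phi a b d m) z (RtoC (INR m) * CK phi a b d (S m) z)%C.
Proof.
  intros Hd Hz Hc HM. apply has_cderiv_cdiff.
  destruct (on_sq_dist a b d z Hd Hz) as [eta [Heta Hdist]].
  destruct (inv_pow_taylor (2 / eta)) with (m := m) as [K [HK HT]].
  { apply Rlt_le, Rdiv_lt_0_compat; lra. }
  assert (HM0 : 0 <= M).
  { eapply Rle_trans; [apply (Cmod_ge_0 (phi (a, b)))|apply HM]. unfold on_sq; cbn [fst snd]; lra. }
  (* [4 * d * (M * K)] is the coefficient of the quadratic error; the added 1 makes it a divisor. *)
  set (Q := 4 * d * (M * K) + 1).
  assert (HQ : 1 <= Q). { unfold Q. assert (0 <= M * K) by now apply Rmult_le_pos. nra. }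
  intros e He. exists (Rmin (eta / 2) (e / Q)). split.
  { apply Rmin_pos; [lra|apply Rdiv_lt_0_compat; lra]. }
  intros z'. rewrite !Cnorm_Cmod. change (Csub z' z) with (z' - z)%C. intros Hz'.
  pose proof (Rmin_l (eta / 2) (e / Q)). pose proof (Rmin_r (eta / 2) (e / Q)).
  assert (Hd' : forall w, on_sq a b d w -> eta / 2 <= Cmod (w - z')).
  { intros w Hw. specialize (Hdist w Hw). pose proof (Cmod_minus_le w z' z). lra. }
  assert (Hn : forall w, on_sq a b d w -> w <> z).
  { intros w Hw ->. now apply Hz. }
  assert (Hn' : forall w, on_sq a b d w -> w <> z').
  { intros w Hw ->. specialize (Hd' z' Hw). rewrite Cmod_diag in Hd'. lra. }
  change (Csub (Csub (CK phi a b d m z') (CK phi a b d m z)) (Cmul (RtoC (INR m) * CK phi a b d (S m) z)%C (z' - z)%C))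
    with ((CK phi a b d m z' - CK phi a b d m z) - (RtoC (INR m) * CK phi a b d (S m) z) * (z' - z))%C.
  set (h := (z' - z)%C) in *.
  replace ((CK phi a b d m z' - CK phi a b d m z) - (RtoC (INR m) * CK phi a b d (S m) z) * h)%C
    with (SI (fun w => phi w * (/ (w - z')) ^ m - phi w * (/ (w - z)) ^ m
                       - (RtoC (INR m) * h) * (phi w * (/ (w - z)) ^ (S m)))%C a b d).
  2:{ rewrite (SI_minus (fun w => phi w * (/ (w - z')) ^ m - phi w * (/ (w - z)) ^ m)%C
         (fun w => (RtoC (INR m) * h) * (phi w * (/ (w - z)) ^ (S m)))%C); [|lra| |].
      - rewrite (SI_minus (fun w => phi w * (/ (w - z')) ^ m)%C (fun w => phi w * (/ (w - z)) ^ m)%C); [|lra| |].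
        + rewrite SI_scal; [unfold CK; ring|lra|]. intros w Hw; apply ccont_kernel; auto.
        + intros w Hw; apply ccont_kernel; auto.
        + intros w Hw; apply ccont_kernel; auto.
      - intros w Hw; apply ccont_minus; apply ccont_kernel; auto.
      - intros w Hw; apply ccont_mult; [apply ccont_const|apply ccont_kernel; auto]. }
  eapply Rle_trans; [apply (SI_norm_le _ (M * (K * (Cmod h * Cmod h))))|].
  - lra.
  - intros w Hw. apply ccont_minus; [apply ccont_minus; apply ccont_kernel; auto|].
    apply ccont_mult; [apply ccont_const|apply ccont_kernel; auto].
  - intros w Hw.
    replace (phi w * (/ (w - z')) ^ m - phi w * (/ (w - z)) ^ m
                       - (RtoC (INR m) * h) * (phi w * (/ (w - z)) ^ (S m)))%C
      with (phi w * ((/ (w - z')) ^ m - (/ (w - z)) ^ m - RtoC (INR m) * h * (/ (w - z)) ^ (S m)))%C by ring.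
    rewrite Cmod_mult. apply Rmult_le_compat; auto using Cmod_ge_0.
    specialize (Hdist w Hw). specialize (Hd' w Hw).
    assert (N1 := Cminus_eq_contra _ _ (Hn w Hw)). assert (N2 := Cminus_eq_contra _ _ (Hn' w Hw)).
    apply HT.
    + rewrite Cmod_inv by easy. replace (2 / eta) with (/ (eta / 2)) by (field; lra).
      apply Rinv_le_contravar; lra.
    + rewrite Cmod_inv by easy. replace (2 / eta) with (/ (eta / 2)) by (field; lra).
      apply Rinv_le_contravar; lra.
    + unfold h. field. split; easy.
  - pose proof (Cmod_ge_0 h).
    replace (4 * d * (M * (K * (Cmod h * Cmod h)))) with ((4 * d * (M * K)) * Cmod h * Cmod h) by ring.
    apply Rmult_le_compat_r; [easy|].
    apply Rle_trans with (Q * Cmod h); [apply Rmult_le_compat_r; [easy|unfold Q; lra]|].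
    apply Rle_trans with (Q * (e / Q)); [apply Rmult_le_compat_l; lra|right; field; lra].
Qed.

Lemma int_sq_open a b d z : int_sq a b d z -> exists r, 0 < r /\
  forall w, Cmod (w - z) < r -> int_sq a b d w.
Proof.
  intros H. unfold int_sq in H.
  exists (Rmin (Rmin (fst z - a) (a + d - fst z)) (Rmin (snd z - b) (b + d - snd z))).
  split; [repeat apply Rmin_pos; lra|]. intros w Hw.
  set (m1 := Rmin (fst z - a) (a + d - fst z)) in *. set (m2 := Rmin (snd z - b) (b + d - snd z)) in *.
  pose proof (Rmin_l m1 m2). pose proof (Rmin_r m1 m2).
  assert (m1 <= fst z - a) by apply Rmin_l. assert (m1 <= a + d - fst z) by apply Rmin_r.
  assert (m2 <= snd z - b) by apply Rmin_l. assert (m2 <= b + d - snd z) by apply Rmin_r.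
  pose proof (fst_le_Cmod (w - z)%C) as X. pose proof (snd_le_Cmod (w - z)%C) as Y.
  cbn [fst snd Cminus Cplus Copp] in X, Y.
  assert (X' : Rabs (fst w + - fst z) < m1) by lra. assert (Y' : Rabs (snd w + - snd z) < m2) by lra.
  apply Rabs_def2 in X'. apply Rabs_def2 in Y'. unfold int_sq; lra.
Qed.

(** The integral of 1/(w - z) is the constant [C2pi] for [z] inside. Differentiating it repeatedly
    in [z] produces nonzero multiples of the higher powers. *)
Lemma CK_one a b d z m : 0 < d -> int_sq a b d z -> SI (fun w => (/ (w - z)) ^ (S (S m)))%C a b d = 0.
Proof.
  intros Hd Hz.
  assert (Hext : forall k z, SI (fun w => (/ (w - z)) ^ k)%C a b d = CK (fun _ => RtoC 1) a b d k z).
  { intros k y. apply SI_ext; [lra|]. intros; ring. }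
  rewrite Hext.
  assert (Hcst : forall k z, int_sq a b d z -> CK (fun _ => RtoC 1) a b d (S (S k)) z = 0).
  { intros k. induction k as [|k IH]; intros y Hy.
    - assert (H1 := CK_diff (fun _ => RtoC 1) a b d 1 y 1 Hd).
      assert (H2 : cdiff (CK (fun _ => RtoC 1) a b d 1) y 0).
      { destruct (int_sq_open a b d y Hy) as [r [Hr Hi]].
        apply (cdiff_ext_loc (fun _ => C2pi) _ y _ r Hr); [|apply cdiff_const].
        intros w Hw. rewrite <- Hext. rewrite <- (SI_inv a b d w) by auto.
        apply SI_ext; [lra|]. intros; now rewrite Cpow_1_r. }
      assert (E := cdiff_unique _ _ _ _ H2 (H1 ltac:(intros Hon; eapply on_not_int; eauto)
        ltac:(intros w _; apply ccont_const) ltac:(intros; cbv beta; rewrite Cmod_1; lra))).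
      simpl INR in E. rewrite Cmult_1_l in E. now symmetry.
    - assert (H1 := CK_diff (fun _ => RtoC 1) a b d (S (S k)) y 1 Hd).
      assert (H2 : cdiff (CK (fun _ => RtoC 1) a b d (S (S k))) y 0).
      { destruct (int_sq_open a b d y Hy) as [r [Hr Hi]].
        apply (cdiff_ext_loc (fun _ => RtoC 0) _ y _ r Hr); [|apply cdiff_const].
        intros w Hw. symmetry; apply IH; auto. }
      assert (E := cdiff_unique _ _ _ _ H2 (H1 ltac:(intros Hon; eapply on_not_int; eauto)
        ltac:(intros w _; apply ccont_const) ltac:(intros; cbv beta; rewrite Cmod_1; lra))).
      assert (nz : RtoC (INR (S (S k))) <> 0).
      { intros E'. apply RtoC_inj in E'. apply (not_0_INR (S (S k))); [lia|easy]. }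
      set (X := CK _ _ _ _ (S (S (S k))) y) in *.
      replace X with (RtoC (INR (S (S k))) * X / RtoC (INR (S (S k))))%C by (field; easy).
      rewrite <- E. field; easy. }
  auto.
Qed.

(** Cauchy's integral for the derivative of order [n]. *)
Definition CD (f : C -> C) (a b d : R) (n : nat) (z : C) : C :=
  (RtoC (INR (fact n)) / C2pi * CK f a b d (S n) z)%C.

Lemma CD_diff f a b d n z M : 0 < d -> ~ on_sq a b d z -> ccont_bd f a b d ->
  (forall w, on_sq a b d w -> Cmod (f w) <= M) ->
  cdiff (CD f a b d n) z (CD f a b d (S n) z).
Proof.
  intros Hd Hz Hc HM. unfold CD.
  assert (H := CK_diff f a b d (S n) z M Hd Hz Hc HM).
  assert (K := cdiff_mult (fun _ => RtoC (INR (fact n)) / C2pi)%C _ z 0 _ (cdiff_const _ _) H).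
  replace (RtoC (INR (fact (S n))) / C2pi * CK f a b d (S (S n)) z)%C
    with (0 * CK f a b d (S n) z + RtoC (INR (fact n)) / C2pi * (RtoC (INR (S n)) * CK f a b d (S (S n)) z))%C.
  - exact K.
  - rewrite fact_simpl, mult_INR, RtoC_mult. field. apply C2pi_neq0.
Qed.

(** [HasDerivN] hides the lower derivatives behind existential quantifiers; uniqueness of the
    complex derivative identifies them one at a time with Cauchy integrals, on the open set where
    [W] meets the interior of the square. *)
Lemma HasDerivN_CD_unique (W : Cset) f a b d M : 0 < d -> Copen W -> ccont_bd f a b d ->
  (forall w, on_sq a b d w -> Cmod (f w) <= M) ->
  (forall z, int_sq a b d z -> f z = CD f a b d 0 z) ->
  forall n g, HasDerivN W n f g -> forall z, W z -> int_sq a b d z -> g z = CD f a b d n z.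
Proof.
  intros Hd HW Hc HM Hf n. induction n as [|n IH]; intros g Hg z Wz Iz.
  - simpl in Hg. rewrite Hg by easy. auto.
  - destruct Hg as [h [Hh Hg]]. specialize (IH h Hh).
    specialize (Hg z Wz). apply has_cderiv_cdiff in Hg.
    eapply cdiff_unique; [apply Hg|].
    destruct (HW z Wz) as [r1 [Hr1 HW1]].
    destruct (int_sq_open a b d z Iz) as [r2 [Hr2 HW2]].
    apply (cdiff_ext_loc (CD f a b d n) _ z _ (Rmin r1 r2)).
    + apply Rmin_pos; easy.
    + intros w Hw. symmetry. apply IH.
      * apply HW1. rewrite Cnorm_Cmod. eapply Rlt_le_trans; [apply Hw|apply Rmin_l].
      * apply HW2. eapply Rlt_le_trans; [apply Hw|apply Rmin_r].
    + apply (CD_diff f a b d n z M); auto. intros Hon; eapply on_not_int; eauto.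
Qed.

Lemma HasDerivN_CD f a b d M : 0 < d -> ccont_bd f a b d ->
  (forall w, on_sq a b d w -> Cmod (f w) <= M) ->
  (forall z, int_sq a b d z -> f z = CD f a b d 0 z) ->
  forall n, HasDerivN (int_sq a b d) n f (CD f a b d n).
Proof.
  intros Hd Hc HM Hf n. induction n as [|n IH].
  - simpl. intros z Hz. now rewrite <- Hf.
  - exists (CD f a b d n); split; [easy|]. intros z Hz. apply has_cderiv_cdiff.
    apply (CD_diff f a b d n z M); auto. intros Hon; eapply on_not_int; eauto.
Qed.

Lemma int_sq_Copen a b d : Copen (int_sq a b d).
Proof.
  intros z Hz. destruct (int_sq_open a b d z Hz) as [r [Hr H]]. exists r; split; [easy|].
  intros w. rewrite Cnorm_Cmod. apply H.
Qed.

Lemma CD0_formula f a b d z :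
  0 < d -> int_sq a b d z -> (forall p, in_sq a b d p -> cdiffable f p) -> f z = CD f a b d 0 z.
Proof.
  intros Hd Hz Hf.
  destruct (Hf z (int_sq_in _ _ _ _ Hz)) as [L [phi [Hphi [_ He]]]].
  assert (H := cauchy_formula f phi a b d (fun _ => False) z Hd Hz).
  unfold CD, CK. simpl fact. simpl INR.
  rewrite (SI_ext _ (fun w => f w * / (w - z))%C) by (try lra; intros; now rewrite Cpow_1_r).
  rewrite H; auto.
  - field. apply C2pi_neq0.
  - intros p Hp. now apply cdiffable_ccont, Hf.
  - intros e Hepos. apply (cov_mono phi a b d (fun p => p = z) _ e); [easy|lra|].
    apply cov_point; auto; [now apply int_sq_in|].
    intros p Hp. destruct (Ceq_dec p z) as [->|n]; [easy|].
    apply (ccont_ext_loc (fun w => (f w - f z) * / (w - z))%C phi p (Cmod (p - z))).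
    + now apply Cmod_pos_sub.
    + intros w Hw. rewrite (He w). field. apply Cminus_eq_contra. intros ->.
      rewrite Cmod_minus_sym in Hw; lra.
    + apply ccont_mult; [apply ccont_minus; [now apply cdiffable_ccont, Hf|apply ccont_const]|].
      now apply ccont_inv_sub.
Qed.

Lemma DerivNAt_CD f n a b d z v M : 0 < d -> int_sq a b d z ->
  (forall p, in_sq a b d p -> cdiffable f p) -> (forall w, Cmod (f w) <= M) ->
  DerivNAt f n z v -> v = CD f a b d n z.
Proof.
  intros Hd Hz Hf HM [W [HW [Wz [g [Hg <-]]]]].
  apply (HasDerivN_CD_unique W f a b d M); auto.
  - intros w Hw. apply cdiffable_ccont, Hf, on_sq_in; [lra|easy].
  - intros w Hw. apply CD0_formula; auto.
Qed.

Lemma DerivNAt_CD_ex f n a b d z M : 0 < d -> int_sq a b d z ->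
  (forall p, in_sq a b d p -> cdiffable f p) -> (forall w, Cmod (f w) <= M) ->
  DerivNAt f n z (CD f a b d n z).
Proof.
  intros Hd Hz Hf HM. exists (int_sq a b d); split; [apply int_sq_Copen|split; [easy|]].
  exists (CD f a b d n); split; [|easy].
  apply (HasDerivN_CD f a b d M); auto.
  - intros w Hw. apply cdiffable_ccont, Hf, on_sq_in; [lra|easy].
  - intros w Hw. apply CD0_formula; auto.
Qed.

Lemma CD_bound f n a b d z eta M : 0 < d -> 0 < eta ->
  (forall w, on_sq a b d w -> eta <= Cmod (w - z)) -> ccont_bd f a b d ->
  (forall w, on_sq a b d w -> Cmod (f w) <= M) ->
  Cmod (CD f a b d n z) <= INR (fact n) / (2 * PI) * (4 * d * (M * (/ eta) ^ S n)).
Proof.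
  intros Hd Heta Hdist Hc HM. unfold CD.
  rewrite Cmod_mult, Cmod_div, Cmod_C2pi, Cmod_R by apply C2pi_neq0.
  rewrite Rabs_pos_eq by apply pos_INR.
  assert (Hn : forall w, on_sq a b d w -> w <> z).
  { intros w Hw ->. specialize (Hdist z Hw). rewrite Cmod_diag in Hdist. lra. }
  apply Rmult_le_compat_l.
  - pose proof PI_RGT_0. apply Rmult_le_pos; [apply pos_INR|]. left; apply Rinv_0_lt_compat; lra.
  - apply SI_norm_le; [lra| |].
    + intros w Hw. apply ccont_kernel; auto.
    + intros w Hw. rewrite Cmod_mult, Cmod_pow, Cmod_inv by (apply Cminus_eq_contra; auto).
      apply Rmult_le_compat; auto using Cmod_ge_0, pow_le.
      * apply pow_le. left; apply Rinv_0_lt_compat. specialize (Hdist w Hw); lra.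
      * apply pow_incr. split; [left; apply Rinv_0_lt_compat; specialize (Hdist w Hw); lra|].
        apply Rinv_le_contravar; auto.
Qed.

(** * Removing the poles of the kernels *)

Definition ipow (y : C) (m : nat) (w : C) : C := ((/ (w - y)) ^ m)%C.

Lemma ccont_ipow y m w : w <> y -> ccont (ipow y m) w.
Proof.
  intros H. apply (ccont_pow (fun w => / (w - y))%C).
  now apply ccont_inv_sub.
Qed.

Lemma cdiffable_ipow y m w : w <> y -> cdiffable (ipow y m) w.
Proof.
  intros H. apply (cdiffable_pow (fun w => / (w - y))%C).
  now apply cdiffable_inv_sub.
Qed.

(** [n] counts terms, so the highest power is [n - 1]. *)
Fixpoint Tay (F : nat -> C) (y : C) (n : nat) (z : C) : C :=
  match n with
  | O => 0
  | S k => (Tay F y k z + F k * (z - y) ^ k)%C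
  end.

Lemma cdiffable_Tay F y n z : cdiffable (Tay F y n) z.
Proof.
  induction n as [|n IH]; simpl.
  - apply cdiffable_const.
  - apply cdiffable_plus; [easy|]. apply cdiffable_mult; [apply cdiffable_const|].
    apply (cdiffable_pow (fun w => w - y)%C), cdiffable_minus; [apply cdiffable_id|apply cdiffable_const].
Qed.

(** A residue: after division by (w - y)^(t+1) only the coefficient [F t] leaves a simple pole, and
    the poles of higher order integrate to zero. *)
Lemma SI_Tay F y t a b d : 0 < d -> int_sq a b d y ->
  SI (fun w => Tay F y (S t) w * ipow y (S t) w)%C a b d = (C2pi * F t)%C.
Proof.
  intros Hd Hy.
  assert (Hn : forall w, on_sq a b d w -> w <> y) by (intros w Hw ->; eapply on_not_int; eauto).
  assert (Hp : forall n w, on_sq a b d w -> ((w - y) ^ n * ipow y n w = 1)%C).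
  { intros n w Hw. unfold ipow. rewrite <- Cpow_mult_l, Cinv_r, Cpow_1_l; [easy|].
    now apply Cminus_eq_contra, Hn. }
  assert (Hc : forall G, (forall w, on_sq a b d w -> ccont G w) ->
     forall m, ccont_bd (fun w => G w * ipow y m w)%C a b d).
  { intros G HG m w Hw. apply ccont_mult; [auto|]. apply ccont_ipow; auto. }
  assert (HT : forall n, forall w, on_sq a b d w -> ccont (Tay F y n) w).
  { intros n w _. apply cdiffable_ccont, cdiffable_Tay. }
  assert (Hpw : forall n, forall w, on_sq a b d w -> ccont (fun w => F n * (w - y)^n)%C w).
  { intros n w _. apply ccont_mult; [apply ccont_const|].
    apply (ccont_pow (fun w => w - y)%C), ccont_minus; [apply ccont_id|apply ccont_const]. }
  assert (Hstep : forall n, SI (fun w => Tay F y (S n) w * ipow y (S t) w)%C a b d =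
     (SI (fun w => Tay F y n w * ipow y (S t) w)%C a b d + SI (fun w => (F n * (w - y)^n) * ipow y (S t) w)%C a b d)%C).
  { intros n. rewrite <- SI_plus; [|lra| |]; auto.
    apply SI_ext; [lra|]. intros; simpl; ring. }
  assert (Hz : forall n, (n <= t)%nat -> SI (fun w => Tay F y n w * ipow y (S t) w)%C a b d = 0).
  { induction n as [|n IH]; intros Hnt.
    - rewrite (SI_ext _ (fun _ => RtoC 0)), SI_const; [easy|lra|]. intros; simpl; ring.
    - rewrite Hstep, IH by lia.
      rewrite (SI_ext _ (fun w => F n * ((/ (w - y)) ^ (S (S (t - S n)))))%C); [|lra|].
      + rewrite SI_scal, CK_one; auto; [ring|lra|].
        intros w Hw; apply ccont_ipow; auto.
      + intros w Hw. unfold ipow.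
        (* Here n < t, so cancelling (w - y)^n leaves an exponent of at least 2, in the form that
           [CK_one] expects. *)
        replace (S t) with (n + S (S (t - S n)))%nat by lia.
        rewrite Cpow_add_r. fold (ipow y n w).
        replace (F n * (w - y) ^ n * (ipow y n w * (/ (w - y)) ^ S (S (t - S n))))%C
          with (F n * ((w - y) ^ n * ipow y n w) * (/ (w - y)) ^ S (S (t - S n)))%C by ring.
        rewrite Hp by easy. ring. }
  rewrite Hstep, Hz by lia.
  rewrite (SI_ext _ (fun w => F t * / (w - y))%C); [|lra|].
  - rewrite SI_scal, SI_inv; auto; [ring|lra|].
    intros w Hw. now apply ccont_inv_sub, Hn.
  - intros w Hw. unfold ipow. rewrite Cpow_S. fold (ipow y t w).
    replace (F t * (w - y) ^ t * (/ (w - y) * ipow y t w))%C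
      with (F t * ((w - y) ^ t * ipow y t w) * / (w - y))%C by ring.
    rewrite Hp by easy. ring.
Qed.

Lemma SI_Tay_out F y n m a b d : 0 < d -> ~ in_sq a b d y ->
  SI (fun w => Tay F y n w * ipow y m w)%C a b d = 0.
Proof.
  intros Hd Hy. apply goursat; [easy|]. intros z Hz.
  apply cdiffable_mult; [apply cdiffable_Tay|apply cdiffable_ipow]. intros ->; easy.
Qed.

(** Iterates 1/(w - z) = 1/(w - y) + (z - y)/((w - y)(w - z)) under the Cauchy integral; each round
    splits off one Taylor coefficient. *)
Lemma taylor_remainder f a b d y M : 0 < d -> int_sq a b d y ->
  (forall p, in_sq a b d p -> cdiffable f p) -> (forall w, Cmod (f w) <= M) ->
  forall n z, int_sq a b d z ->
  f z = (Tay (fun j => / C2pi * CK f a b d (S j) y) y n z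
         + (z - y) ^ n * (/ C2pi * CK (fun w => f w * ipow y n w) a b d 1 z))%C.
Proof.
  intros Hd Hy Hf HM n. induction n as [|n IH]; intros z Hz.
  - simpl Tay. unfold CK. cbn [Cpow].
    rewrite (CD0_formula f a b d z) at 1 by auto.
    unfold CD, CK; simpl fact; simpl INR.
    rewrite (SI_ext (fun w => f w * ipow y 0 w * (/ (w - z) * 1))%C (fun w => f w * (/ (w - z)) ^ 1)%C).
    + field. apply C2pi_neq0.
    + lra.
    + intros; unfold ipow; simpl; ring.
  - rewrite (IH z Hz) at 1. cbn [Tay]. rewrite Cpow_S.
    set (T := Tay _ y n z).
    assert (Hny : forall w, on_sq a b d w -> w <> y) by (intros w Hw ->; eapply on_not_int; eauto).
    assert (Hnz : forall w, on_sq a b d w -> w <> z) by (intros w Hw ->; eapply on_not_int; eauto).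
    assert (Hfc : ccont_bd f a b d).
    { intros w Hw. apply cdiffable_ccont, Hf, on_sq_in; [lra|easy]. }
    assert (E : (CK (fun w => f w * ipow y n w) a b d 1 z =
       CK f a b d (S n) y + (z - y) * CK (fun w => f w * ipow y (S n) w) a b d 1 z)%C).
    { unfold CK.
      rewrite <- (SI_scal (z - y)%C), <- SI_plus; try lra.
      - apply SI_ext; [lra|]. intros w Hw. unfold ipow. rewrite !Cpow_S. simpl (_ ^ 0)%C.
        field. split; apply Cminus_eq_contra; auto.
      - intros w Hw. apply ccont_kernel; auto.
      - intros w Hw. apply ccont_mult; [apply ccont_const|].
        apply ccont_kernel; auto. apply ccont_mult; auto. apply ccont_ipow; auto.
      - intros w Hw. apply ccont_kernel; auto. apply ccont_mult; auto. apply ccont_ipow; auto. }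
    rewrite E. ring.
Qed.

(* G is (f - T_y f) / (w - y)^(t+1), where T_y f is the Taylor polynomial of degree t at y. *)
Lemma removable_quotient f a b d y M t : 0 < d -> int_sq a b d y ->
  (forall p, in_sq a b d p -> cdiffable f p) -> (forall w, Cmod (f w) <= M) ->
  exists G, (forall p, cdiffable f p -> cdiffable G p) /\ (forall p, p <> y -> ccont f p -> ccont G p) /\
    (forall A B D, 0 < D -> ~ in_sq A B D y -> ccont_bd f A B D ->
       SI G A B D = SI (fun w => f w * ipow y (S t) w)%C A B D) /\
    (forall A B D, 0 < D -> int_sq A B D y -> ccont_bd f A B D ->
       SI G A B D = (SI (fun w => f w * ipow y (S t) w) A B D
                     - C2pi / RtoC (INR (fact t)) * CD f a b d t y)%C).
Proof.
  intros Hd Hy Hf HM.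
  set (F := fun j => (/ C2pi * CK f a b d (S j) y)%C).
  set (Rm := fun z => (/ C2pi * CK (fun w => f w * ipow y (S t) w) a b d 1 z)%C).
  set (Q := fun w => ((f w - Tay F y (S t) w) * ipow y (S t) w)%C).
  (* By Taylor's formula the quotient agrees near [y] with the integral remainder [Rm], which is
     differentiable at [y]; its value fills the gap. *)
  set (G := fun w => if Ceq_dec w y then Rm y else Q w).
  assert (HGQ : forall w, w <> y -> G w = Q w).
  { intros w Hw; unfold G; destruct (Ceq_dec w y); easy. }
  assert (Hloc : forall p, p <> y -> exists dl, 0 < dl /\ forall w, Cmod (w - p) < dl -> Q w = G w).
  { intros p Hp. exists (Cmod (p - y)); split; [now apply Cmod_pos_sub|].
    intros w Hw. rewrite HGQ; [easy|]. intros ->. rewrite Cmod_minus_sym in Hw; lra. }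
  assert (Hfc : ccont_bd f a b d).
  { intros w Hw. apply cdiffable_ccont, Hf, on_sq_in; [lra|easy]. }
  assert (Hny : forall w, on_sq a b d w -> w <> y) by (intros w Hw ->; eapply on_not_int; eauto).
  assert (Hdy : cdiffable G y).
  { destruct (int_sq_open a b d y Hy) as [r [Hr Hi]].
    apply (cdiffable_ext_loc Rm G y r Hr).
    - intros w Hw. unfold G. destruct (Ceq_dec w y) as [->|n]; [easy|].
      unfold Q, Rm. rewrite (taylor_remainder f a b d y M Hd Hy Hf HM (S t) w (Hi w Hw)).
      fold F.
      assert (E : ((w - y) ^ S t * ipow y (S t) w = 1)%C).
      { unfold ipow. rewrite <- Cpow_mult_l, Cinv_r, Cpow_1_l; [easy|]. now apply Cminus_eq_contra. }
      set (X := (/ C2pi * CK (fun w => f w * ipow y (S t) w) a b d 1 w)%C).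
      set (T := Tay F y (S t) w). set (P := ((w - y) ^ S t)%C) in *. set (J := ipow y (S t) w) in *.
      replace ((T + P * X - T) * J)%C with (P * J * X)%C by ring.
      rewrite E. ring.
    - apply cdiffable_mult; [apply cdiffable_const|].
      destruct (on_sq_dist a b d y Hd) as [eta [Heta Hdist]]; [intros Hon; eapply on_not_int; eauto|].
      eexists. apply (CK_diff _ a b d 1 y (M * (/ eta) ^ S t)); auto.
      + intros Hon; eapply on_not_int; eauto.
      + intros w Hw. apply ccont_mult; auto. apply ccont_ipow; auto.
      + intros w Hw. unfold ipow. rewrite Cmod_mult, Cmod_pow, Cmod_inv by (apply Cminus_eq_contra; auto).
        specialize (Hdist w Hw).
        apply Rmult_le_compat; auto using Cmod_ge_0.
        * apply pow_le. left; apply Rinv_0_lt_compat; lra.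
        * apply pow_incr. split; [left; apply Rinv_0_lt_compat; lra|]. apply Rinv_le_contravar; auto. }
  exists G. split; [|split; [|split]].
  - intros p Hp. destruct (Ceq_dec p y) as [->|n]; [easy|].
    destruct (Hloc p n) as [dl [Hdl Hl]]. apply (cdiffable_ext_loc Q G p dl Hdl Hl).
    apply cdiffable_mult; [apply cdiffable_minus; [easy|apply cdiffable_Tay]|now apply cdiffable_ipow].
  - intros p n Hp. destruct (Hloc p n) as [dl [Hdl Hl]]. apply (ccont_ext_loc Q G p dl Hdl Hl).
    apply ccont_mult; [apply ccont_minus; [easy|apply cdiffable_ccont, cdiffable_Tay]|now apply ccont_ipow].
  - intros A B D HD HyD Hc.
    assert (Hn : forall w, on_sq A B D w -> w <> y).
    { intros w Hw ->. apply HyD, on_sq_in; [lra|easy]. }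
    rewrite (SI_ext G (fun w => f w * ipow y (S t) w - Tay F y (S t) w * ipow y (S t) w)%C); [|lra|].
    + rewrite SI_minus; [|lra| |].
      * rewrite SI_Tay_out by easy. ring.
      * intros w Hw; apply ccont_mult; [auto|apply ccont_ipow; auto].
      * intros w Hw; apply ccont_mult; [apply cdiffable_ccont, cdiffable_Tay|apply ccont_ipow; auto].
    + intros w Hw. rewrite HGQ by auto. unfold Q. ring.
  - intros A B D HD HyD Hc.
    assert (Hn : forall w, on_sq A B D w -> w <> y).
    { intros w Hw ->. eapply on_not_int; eauto. }
    rewrite (SI_ext G (fun w => f w * ipow y (S t) w - Tay F y (S t) w * ipow y (S t) w)%C); [|lra|].
    + rewrite SI_minus; [|lra| |].
      * rewrite SI_Tay by easy. unfold F, CD. field. split; [apply C2pi_neq0|].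
        intros E; apply RtoC_inj in E. apply (INR_fact_neq_0 t E).
      * intros w Hw; apply ccont_mult; [auto|apply ccont_ipow; auto].
      * intros w Hw; apply ccont_mult; [apply cdiffable_ccont, cdiffable_Tay|apply ccont_ipow; auto].
    + intros w Hw. rewrite HGQ by auto. unfold Q. ring.
Qed.

(** * The cost of a disc away from the base point *)

Lemma pow_diff_bound (q q' h : C) B m : Cmod q <= B -> Cmod q' <= B -> (q' - q = h * (q * q'))%C ->
  Cmod (q' ^ m - q ^ m) <= INR m * Cmod h * B ^ S m.
Proof.
  intros Hq Hq' E.
  assert (HB : 0 <= B) by (eapply Rle_trans; [apply Cmod_ge_0|apply Hq]).
  induction m as [|m IH].
  - simpl. replace (1 - 1)%C with (RtoC 0) by ring. rewrite Cmod_0; lra.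
  - rewrite !Cpow_S.
    replace (q' * q' ^ m - q * q ^ m)%C with (q' * (q' ^ m - q ^ m) + (q' - q) * q ^ m)%C by ring.
    rewrite E. eapply Rle_trans; [apply Cmod_triangle|]. rewrite !Cmod_mult, Cmod_pow, S_INR.
    assert (H1 : Cmod q' * Cmod (q' ^ m - q ^ m) <= B * (INR m * Cmod h * B ^ S m)).
    { apply Rmult_le_compat; auto using Cmod_ge_0. }
    assert (H2 : Cmod h * (Cmod q * Cmod q') * Cmod q ^ m <= Cmod h * (B * B) * B ^ m).
    { apply Rmult_le_compat; auto using pow_le, Cmod_ge_0.
      - repeat apply Rmult_le_pos; apply Cmod_ge_0.
      - apply Rmult_le_compat_l; [apply Cmod_ge_0|]. apply Rmult_le_compat; auto using Cmod_ge_0.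
      - apply pow_incr; split; auto using Cmod_ge_0. }
    cbn [pow] in *. lra.
Qed.

Lemma Rpower_ge_self y lam : 0 < y <= 1 -> lam <= 1 -> y <= Rpower y lam.
Proof.
  intros [Hy Hy1] Hl. rewrite <- (exp_ln y) at 1 by easy. unfold Rpower.
  assert (ln y <= 0). { rewrite <- ln_1. destruct Hy1 as [H|H]; [left; apply ln_increasing; lra|rewrite H; lra]. }
  destruct (Req_dec (ln y) (lam * ln y)) as [E|E]; [rewrite <- E; lra|].
  left. apply exp_increasing. nra.
Qed.

Lemma Rpower_ge_1 y lam : 1 <= y -> 0 <= lam -> 1 <= Rpower y lam.
Proof.
  intros Hy Hl. rewrite <- (Rpower_O y) by lra. apply Rle_Rpower; lra.
Qed.

(** There are two regimes for y = |h|/rn. For y at least 1 the triangle inequality suffices, as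
    y^lam is at least 1. For y below 1 the first-order difference bound gives a factor y, which is
    at most y^lam. The two summands of the constant belong to these regimes. *)
Lemma kernel_bound (q q' h : C) kap rn lam m : 0 < kap -> 0 < rn -> 0 < lam < 1 -> 0 < Cmod h ->
  Cmod q <= kap / rn -> Cmod q' <= kap / rn -> (q' - q = h * (q * q'))%C ->
  Cmod (q' ^ m - q ^ m) <=
    (2 * kap ^ m + INR m * kap ^ S m) * ((/ rn) ^ m * Rpower (Cmod h / rn) lam).
Proof.
  intros Hk Hr Hl Hh Hq Hq' E.
  set (y := Cmod h / rn).
  assert (Hy : 0 < y) by now apply Rdiv_lt_0_compat.
  assert (Hi : 0 < / rn) by now apply Rinv_0_lt_compat.
  assert (P1 : 0 <= (/ rn) ^ m) by (apply pow_le; lra).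
  assert (P2 : 0 <= kap ^ m) by (apply pow_le; lra).
  assert (P3 : 0 <= INR m * kap ^ S m) by (apply Rmult_le_pos; [apply pos_INR|apply pow_le; lra]).
  assert (P4 : 0 < Rpower y lam) by apply Rpower_gt_0.
  destruct (Rle_dec 1 y) as [H1|H1].
  - apply Rle_trans with (2 * kap ^ m * ((/ rn) ^ m * 1)).
    + eapply Rle_trans; [apply Cmod_minus_triangle|]. rewrite !Cmod_pow.
      assert (A : (kap / rn) ^ m = kap ^ m * (/ rn) ^ m) by apply Rpow_mult_distr.
      assert (Cmod q' ^ m <= (kap / rn) ^ m) by (apply pow_incr; split; [apply Cmod_ge_0|easy]).
      assert (Cmod q ^ m <= (kap / rn) ^ m) by (apply pow_incr; split; [apply Cmod_ge_0|easy]). lra.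
    + apply Rmult_le_compat; try nra. apply Rmult_le_compat_l; [easy|]. apply Rpower_ge_1; lra.
  - apply Rle_trans with (INR m * kap ^ S m * ((/ rn) ^ m * y)).
    + eapply Rle_trans; [apply (pow_diff_bound q q' h (kap / rn) m); auto|].
      right. unfold Rdiv. rewrite Rpow_mult_distr. unfold y, Rdiv. cbn [pow]. ring.
    + apply Rmult_le_compat; try nra. apply Rmult_le_compat_l; [easy|]. apply Rpower_ge_self; lra.
Qed.

Lemma cov_no_point g A B D E T : 0 <= T -> (forall p, in_sq A B D p -> ~ E p) -> Cov g A B D E T.
Proof.
  intros HT H. exists (fun _ _ _ => 0); repeat split; intros; try lra.
  exfalso; eapply H; eauto.
Qed.

Section Ball.
Variables (f Gx G0 : C -> C) (om : R -> R) (t : nat) (lam K a0 : R) (x x0 : C).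
Hypothesis (Hlam : 0 < lam < 1) (HK : 0 < K) (Ha0 : 0 < a0).
Hypothesis (Hfc : forall z, ccont f z).
Hypothesis (Hom : forall z w, Cmod (f z - f w) <= om (Cmod (z - w))).
Hypothesis (Hmono : forall r s, 0 <= r <= s -> om r <= om s).
Hypothesis (Hxx : x <> x0).
Hypothesis (Gxc : forall p, p <> x -> ccont f p -> ccont Gx p).
Hypothesis (G0c : forall p, p <> x0 -> ccont f p -> ccont G0 p).
Hypothesis (GxS : forall A B D, 0 < D -> ~ in_sq A B D x -> ccont_bd f A B D ->
       SI Gx A B D = SI (fun w => f w * ipow x (S t) w)%C A B D).
Hypothesis (G0S : forall A B D, 0 < D -> ~ in_sq A B D x0 -> ccont_bd f A B D ->
       SI G0 A B D = SI (fun w => f w * ipow x0 (S t) w)%C A B D).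

(** The cone condition gives |p - x0| <= (1 + K)|p - x|. So a point [p] of the annulus has distance
    at least [2 * rn / kap] from [x], and the points of a square of side at most [rn / (4 * kap)]
    around it keep distance [rn / kap] from both poles. *)
Definition kap := 4 * (1 + K).
Definition Ck := 2 * kap ^ (S t) + INR (S t) * kap ^ S (S t).
(** The size, up to constants, of the kernel difference on the annulus of outer radius [rn]. *)
Definition Theta (rn : R) := (/ rn) ^ (S t) * Rpower (Cmod (x - x0) / rn) lam.
(** Density 8/sg from [perimeter_le_area] on a box of side [4 * (sg * (4 * kap))]: 128 is 8 times
    the square of 4. *)
Definition Cball := 128 * Ck * (4 * kap) ^ 2.

Lemma Ck_pos : 0 < Ck.
Proof.
  unfold Ck, kap. apply Rplus_lt_le_0_compat.
  - apply Rmult_lt_0_compat; [lra|apply pow_lt; lra].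
  - apply Rmult_le_pos; [apply pos_INR|apply pow_le; lra].
Qed.

Lemma Theta_pos rn : 0 < rn -> 0 < Theta rn.
Proof.
  intros H. unfold Theta. apply Rmult_lt_0_compat; [apply pow_lt; now apply Rinv_0_lt_compat|].
  apply Rpower_gt_0.
Qed.

Lemma om_nonneg r : 0 <= r -> 0 <= om r.
Proof.
  intros H. apply Rle_trans with (om 0); [|apply Hmono; lra].
  pose proof (Hom x0 x0) as P; now rewrite !Cmod_diag in P.
Qed.

(** The square avoids both poles, so the quotients may be traded for [f] times the kernels. The
    kernel difference is analytic there and integrates to zero against the constant [f p], which
    leaves only the oscillation of [f]. *)
Lemma square_integral_bound rn p a b d : 0 < rn -> 0 < d <= rn / (4 * kap) ->
  Cmod (x - x0) <= K * Cmod (p - x) -> rn / 2 < Cmod (p - x0) -> in_sq a b d p ->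
  Cmod (SI (fun z => Gx z - G0 z)%C a b d) <= 4 * d * (om (2 * d) * (Ck * Theta rn)).
Proof.
  intros Hrn Hd Hxi Hp Hin.
  assert (Hkap : 4 < kap) by (unfold kap; lra).
  assert (Hxi0 : 0 < Cmod (x - x0)) by now apply Cmod_pos_sub.
  set (R0 := Cmod (p - x0)) in *.
  assert (HR : R0 <= (1 + K) * Cmod (p - x)).
  { pose proof (Cmod_minus_le p x x0). fold R0 in H. lra. }
  assert (Hd2 : 2 * d <= rn / 2 / kap).
  { replace (rn / 2 / kap) with (2 * (rn / (4 * kap))) by (field; lra). lra. }
  assert (Hs : rn / 2 / kap <= rn / 8).
  { replace (rn / 8) with (rn / 2 / 4) by field. apply Rmult_le_compat_l; [lra|].
    apply Rinv_le_contravar; lra. }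
  assert (Hpx : 4 * (rn / 2 / kap) <= Cmod (p - x)).
  { replace (4 * (rn / 2 / kap)) with (rn / 2 / (1 + K)) by (unfold kap; field; lra).
    apply Rmult_le_reg_r with (1 + K); [lra|].
    replace (rn / 2 / (1 + K) * (1 + K)) with (rn / 2) by (field; lra). lra. }
  assert (Hq : forall z, in_sq a b d z -> rn / kap <= Cmod (z - x) /\ rn / kap <= Cmod (z - x0)).
  { intros z Hz. pose proof (in_sq_dist a b d p z Hin Hz).
    pose proof (Cmod_minus_le p z x). pose proof (Cmod_minus_le p z x0). fold R0 in H1.
    assert (0 < rn / 2 / kap) by (apply Rdiv_lt_0_compat; lra).
    replace (rn / kap) with (2 * (rn / 2 / kap)) by (field; lra). lra. }
  assert (Hkr : 0 < rn / kap) by (apply Rdiv_lt_0_compat; lra).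
  assert (Nx : forall z, in_sq a b d z -> z <> x).
  { intros z Hz ->. destruct (Hq x Hz) as [H _]. rewrite Cmod_diag in H. lra. }
  assert (N0 : forall z, in_sq a b d z -> z <> x0).
  { intros z Hz ->. destruct (Hq x0 Hz) as [_ H]. rewrite Cmod_diag in H. lra. }
  assert (Hon : forall z, on_sq a b d z -> in_sq a b d z) by (intros; apply on_sq_in; [lra|easy]).
  set (k := fun w => (ipow x (S t) w - ipow x0 (S t) w)%C).
  assert (Hkd : forall z, in_sq a b d z -> cdiffable k z).
  { intros z Hz. apply cdiffable_minus; apply cdiffable_ipow; auto. }
  assert (E : SI (fun z => Gx z - G0 z)%C a b d = SI (fun z => (f z - f p) * k z)%C a b d).
  { rewrite SI_minus; [|lra| |].
    - rewrite GxS, G0S; try lra; [| |intros z Hz; auto| |intros z Hz; auto].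
      + rewrite <- SI_minus; [|lra| |].
        * rewrite (SI_ext (fun z => (f z - f p) * k z)%C
             (fun z => (f z * ipow x (S t) z - f z * ipow x0 (S t) z) - f p * k z)%C);
            [|lra|intros; unfold k; ring].
          rewrite (SI_minus (fun z => f z * ipow x (S t) z - f z * ipow x0 (S t) z)%C
              (fun z => f p * k z)%C); [|lra| |].
          -- rewrite SI_scal; [|lra|].
             ++ rewrite (goursat k); [ring|lra|auto].
             ++ intros z Hz. apply cdiffable_ccont; auto.
          -- intros z Hz. apply ccont_minus; apply ccont_mult; auto; apply ccont_ipow; auto.
          -- intros z Hz. apply ccont_mult; [apply ccont_const|apply cdiffable_ccont; auto].
        * intros z Hz. apply ccont_mult; auto; apply ccont_ipow; auto.
        * intros z Hz. apply ccont_mult; auto; apply ccont_ipow; auto.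
      + intros H. eapply N0; eauto.
      + intros H. eapply Nx; eauto.
    - intros z Hz; auto.
    - intros z Hz; auto. }
  rewrite E. apply SI_norm_le; [lra| |].
  - intros z Hz. apply ccont_mult; [apply ccont_minus; [auto|apply ccont_const]|].
    apply cdiffable_ccont; auto.
  - intros z Hz. specialize (Hon z Hz). rewrite Cmod_mult.
    apply Rmult_le_compat; auto using Cmod_ge_0.
    + eapply Rle_trans; [apply Hom|]. apply Hmono. split; [apply Cmod_ge_0|].
      now apply (in_sq_dist a b d).
    + unfold k, ipow. destruct (Hq z Hon) as [Q1 Q2].
      assert (n1 := Cminus_eq_contra _ _ (Nx z Hon)). assert (n2 := Cminus_eq_contra _ _ (N0 z Hon)).
      apply (kernel_bound (/ (z - x0))%C (/ (z - x))%C (x - x0)%C kap rn lam (S t)); auto; try lra.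
      * rewrite Cmod_inv by easy. replace (kap / rn) with (/ (rn / kap)) by (field; lra).
        apply Rinv_le_contravar; lra.
      * rewrite Cmod_inv by easy. replace (kap / rn) with (/ (rn / kap)) by (field; lra).
        apply Rinv_le_contravar; lra.
      * field. split; easy.
Qed.

(** A disc larger than the annulus would call for squares that reach the poles. The scale is
    therefore the smaller of [rho] and a fraction of [rn], and the box is cut down to the annulus as
    well; its side stays comparable to the scale, so the cost is still at most a multiple of
    [rho * om (2 * rho)]. *)
Lemma cov_ball rn (c : C) rho : 0 < rn -> 0 < rho ->
  Cov (fun z => Gx z - G0 z)%C (fst x0 - a0) (snd x0 - a0) (2 * a0)
    (fun p => Cmod (x - x0) <= K * Cmod (p - x) /\ rn / 2 < Cmod (p - x0) <= rn /\ Cmod (p - c) <= rho)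
    (Cball * Theta rn * (rho * om (2 * rho))).
Proof.
  intros Hrn Hrho.
  pose proof Ck_pos as HCk. pose proof (Theta_pos rn Hrn) as HTh.
  assert (Hom2 : 0 <= om (2 * rho)) by (apply om_nonneg; lra).
  assert (Hkap : 4 < kap) by (unfold kap; lra).
  assert (HCb : 0 < Cball).
  { unfold Cball. apply Rmult_lt_0_compat; [lra|]. apply pow_lt; lra. }
  assert (HT : 0 <= Cball * Theta rn * (rho * om (2 * rho))).
  { apply Rmult_le_pos; [apply Rmult_le_pos; lra|apply Rmult_le_pos; lra]. }
  set (E := fun p => Cmod (x - x0) <= K * Cmod (p - x) /\
      rn / 2 < Cmod (p - x0) <= rn /\ Cmod (p - c) <= rho).
  (* A point of the set is needed to see that the scale fits into the large square and that the box
     is not empty. *)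
  destruct (classic (exists p, in_sq (fst x0 - a0) (snd x0 - a0) (2 * a0) p /\ E p)) as [[p0 [Hp0 Ep0]]|Hno].
  2:{ apply cov_no_point; auto. intros p Hp Ep; apply Hno; eauto. }
  set (sg := Rmin rho (rn / (4 * kap))).
  assert (Hc1 : 0 < rn / (4 * kap)) by (apply Rdiv_lt_0_compat; lra).
  assert (Hsg : 0 < sg) by now apply Rmin_pos.
  assert (S1 : sg <= rho) by apply Rmin_l. assert (S2 : sg <= rn / (4 * kap)) by apply Rmin_r.
  assert (Hc2 : rn / (4 * kap) <= rn / 16).
  { apply Rmult_le_compat_l; [lra|]. apply Rinv_le_contravar; lra. }
  assert (Hin : forall p, E p -> (Rabs (fst p - fst x0) <= rn /\ Rabs (snd p - snd x0) <= rn) /\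
     (Rabs (fst p - fst c) <= rho /\ Rabs (snd p - snd c) <= rho)).
  { intros p [_ [[_ H1] H2]].
    pose proof (fst_le_Cmod (p - x0)%C). pose proof (snd_le_Cmod (p - x0)%C).
    pose proof (fst_le_Cmod (p - c)%C). pose proof (snd_le_Cmod (p - c)%C).
    cbn [fst snd Cminus Cplus Copp] in *. unfold Rminus. lra. }
  assert (HsD : sg <= 2 * a0).
  { destruct Ep0 as [_ [[H1 _] _]]. pose proof (Cmod_le_sum (p0 - x0)%C) as H2.
    cbn [fst snd Cminus Cplus Copp] in H2. unfold in_sq in Hp0.
    assert (Rabs (fst p0 + - fst x0) <= a0) by (apply Rabs_le; lra).
    assert (Rabs (snd p0 + - snd x0) <= a0) by (apply Rabs_le; lra). lra. }
  set (mu := Rmin rho rn).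
  assert (Hmu : mu <= sg * (4 * kap)).
  { unfold sg, mu. unfold Rmin at 2. destruct Rle_dec.
    - pose proof (Rmin_l rho rn). nra.
    - replace (rn / (4 * kap) * (4 * kap)) with rn by (field; lra). apply Rmin_r. }
  assert (Hmu0 : 0 < mu) by now apply Rmin_pos.
  set (l1 := Rmax (fst c - 2 * rho) (fst x0 - 2 * rn)). set (r1 := Rmin (fst c + 2 * rho) (fst x0 + 2 * rn)).
  set (l2 := Rmax (snd c - 2 * rho) (snd x0 - 2 * rn)). set (r2 := Rmin (snd c + 2 * rho) (snd x0 + 2 * rn)).
  assert (Hw : forall u v l r, l = Rmax (u - 2 * rho) (v - 2 * rn) -> r = Rmin (u + 2 * rho) (v + 2 * rn) -> r - l <= 4 * mu).
  { intros u v l r -> ->.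
    pose proof (Rmax_l (u - 2 * rho) (v - 2 * rn)). pose proof (Rmax_r (u - 2 * rho) (v - 2 * rn)).
    pose proof (Rmin_l (u + 2 * rho) (v + 2 * rn)). pose proof (Rmin_r (u + 2 * rho) (v + 2 * rn)).
    unfold mu, Rmin at 2. destruct Rle_dec; lra. }
  assert (W1 : r1 - l1 <= 4 * mu) by (apply (Hw (fst c) (fst x0)); reflexivity).
  assert (W2 : r2 - l2 <= 4 * mu) by (apply (Hw (snd c) (snd x0)); reflexivity).
  assert (Hbox : forall p a b d, E p -> in_sq a b d p -> 0 < d <= sg -> l1 <= a /\ a + d <= r1 /\ l2 <= b /\ b + d <= r2).
  { intros p a b d Ep Hq Hd. destruct (Hin p Ep) as [[H1 H2] [H3 H4]].
    apply Rabs_le_between in H1. apply Rabs_le_between in H2. apply Rabs_le_between in H3. apply Rabs_le_between in H4.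
    unfold in_sq in Hq. unfold l1, r1, l2, r2. repeat split.
    - apply Rmax_lub; lra.
    - apply Rmin_glb; lra.
    - apply Rmax_lub; lra.
    - apply Rmin_glb; lra. }
  assert (Hne : l1 <= r1 /\ l2 <= r2).
  { destruct (Hbox p0 (fst p0) (snd p0) sg Ep0) as [B1 [B2 [B3 B4]]]; [unfold in_sq; lra|lra|lra]. }
  set (tau := 8 * (om (2 * rho) * (Ck * Theta rn)) / sg).
  assert (Htau0 : 0 <= om (2 * rho) * (Ck * Theta rn)) by (apply Rmult_le_pos; [easy|apply Rmult_le_pos; lra]).
  assert (Htau : 0 <= tau).
  { unfold tau. apply Rmult_le_pos; [lra|left; now apply Rinv_0_lt_compat]. }
  apply (cov_box _ _ _ _ E l1 r1 l2 r2 tau _ sg); try lra.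
  - apply Rle_trans with (tau * ((4 * (sg * (4 * kap))) * (4 * (sg * (4 * kap))))).
    + apply Rmult_le_compat_l; [easy|]. apply Rmult_le_compat; lra.
    + unfold tau, Cball.
      replace (8 * (om (2 * rho) * (Ck * Theta rn)) / sg * (4 * (sg * (4 * kap)) * (4 * (sg * (4 * kap)))))
        with (128 * (4 * kap) ^ 2 * (om (2 * rho) * (Ck * Theta rn)) * sg) by (field; lra).
      replace (128 * Ck * (4 * kap) ^ 2 * Theta rn * (rho * om (2 * rho)))
        with (128 * (4 * kap) ^ 2 * (om (2 * rho) * (Ck * Theta rn)) * rho) by ring.
      apply Rmult_le_compat_l; [|easy]. apply Rmult_le_pos; [|easy]. pose proof (pow2_ge_0 (4 * kap)); lra.
  - intros p a b d Hp Ep Hs Hq Hd.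
    destruct (Hbox p a b d Ep Hq ltac:(lra)) as [B1 [B2 [B3 B4]]].
    repeat split; auto.
    assert (Ep' := Ep). destruct Ep' as [X1 [X2 X3]].
    eapply Rle_trans; [apply (square_integral_bound rn p a b d); auto; lra|].
    apply Rle_trans with (4 * d * (om (2 * rho) * (Ck * Theta rn))).
    + apply Rmult_le_compat_l; [lra|]. apply Rmult_le_compat_r; [apply Rmult_le_pos; lra|].
      apply Hmono; lra.
    + apply perimeter_le_area; lra.
Qed.
End Ball.

(** * Measure functions and contents *)

Lemma rpow_pos x a : 0 < x -> rpow x a = Rpower x a.
Proof. intros H; unfold rpow; destruct Rle_dec; [lra|easy]. Qed.

Lemma rpow_0 a : rpow 0 a = 0.
Proof. unfold rpow; destruct Rle_dec; [easy|lra]. Qed.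

Lemma rpow_nonneg x a : 0 <= rpow x a.
Proof. unfold rpow; destruct Rle_dec; [lra|]. left; apply Rpower_gt_0. Qed.

Lemma rpow_mono x y a : 0 <= a -> 0 <= x <= y -> rpow x a <= rpow y a.
Proof.
  intros Ha [Hx Hxy]. unfold rpow at 1. destruct Rle_dec; [apply rpow_nonneg|].
  rewrite rpow_pos by lra. apply Rle_Rpower_l; lra.
Qed.

Lemma Rpower_S x a : 0 < x -> Rpower x (1 + a) = x * Rpower x a.
Proof. intros H. rewrite Rpower_plus, Rpower_1; easy. Qed.

Lemma lipschitz_modulus alpha (f : C -> C) N : 0 < alpha < 1 -> 0 < N ->
  (forall z, Cmod (f z) <= N) ->
  (forall z w, Cmod (f z - f w) <= N * rpow (Cmod (z - w)) alpha) ->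
  (forall eps, eps > 0 -> exists d, d > 0 /\ forall z w, Cmod (z - w) < d ->
     Cmod (f z - f w) <= eps * rpow (Cmod (z - w)) alpha) ->
  exists om, (forall z w, Cmod (f z - f w) <= om (Cmod (z - w))) /\
    (forall r s, 0 <= r <= s -> om r <= om s) /\ AdmissibleH alpha (fun r => r * om r / N).
Proof.
  intros Ha HN Hb HL Hl.
  (* [Rabs] keeps the set nonempty for negative [r], so that [om] is defined on the whole line. *)
  set (X := fun r v => exists z w, Cmod (z - w) <= Rabs r /\ v = Cmod (f z - f w)).
  assert (Xb : forall r, bound (X r)).
  { intros r. exists (2 * N). intros v [z [w [_ ->]]].
    pose proof (Cmod_minus_triangle (f z) (f w)). pose proof (Hb z). pose proof (Hb w). lra. }
  assert (Xn : forall r, exists v, X r v).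
  { intros r. exists (Cmod (f 0 - f 0)), (RtoC 0), (RtoC 0). split; [|easy].
    rewrite Cmod_diag. apply Rabs_pos. }
  set (om := fun r => proj1_sig (completeness (X r) (Xb r) (Xn r))).
  assert (Hom : forall r, is_lub (X r) (om r)) by (intros r; unfold om; destruct completeness; easy).
  assert (Hup : forall r M, 0 <= r -> (forall z w, Cmod (z - w) <= r -> Cmod (f z - f w) <= M) -> om r <= M).
  { intros r M Hr H. apply Hom. intros v [z [w [H1 ->]]]. rewrite Rabs_pos_eq in H1 by easy. auto. }
  assert (Hlo : forall z w r, Cmod (z - w) <= r -> Cmod (f z - f w) <= om r).
  { intros z w r H. apply (proj1 (Hom r)). exists z, w. split; [|easy].
    rewrite Rabs_pos_eq; [easy|]. eapply Rle_trans; [apply Cmod_ge_0|apply H]. }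
  assert (Hpos : forall r, 0 <= r -> 0 <= om r).
  { intros r Hr. eapply Rle_trans; [apply Cmod_ge_0|]. apply (Hlo 0 0). now rewrite Cmod_diag. }
  exists om. split; [|split].
  - intros z w. apply Hlo; lra.
  - intros r s Hrs. apply Hup; [lra|]. intros z w H. apply Hlo; lra.
  - split; [|split; [|split]].
    + intros r Hr. apply Rmult_le_pos; [|left; now apply Rinv_0_lt_compat].
      apply Rmult_le_pos; auto.
    + intros r s Hr Hrs. apply Rmult_le_compat_r; [left; now apply Rinv_0_lt_compat|].
      apply Rmult_le_compat; auto. apply Hup; [easy|]. intros z w H. apply Hlo; lra.
    + intros r Hr. destruct Hr as [Hr|<-].
      * rewrite rpow_pos, Rpower_S by easy.
        apply Rmult_le_reg_r with N; [easy|]. replace (r * om r / N * N) with (r * om r) by (field; lra).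
        rewrite Rmult_assoc. apply Rmult_le_compat_l; [lra|].
        apply Hup; [lra|]. intros z w H. eapply Rle_trans; [apply HL|].
        rewrite Rmult_comm, <- (rpow_pos r) by easy. apply Rmult_le_compat_r; [lra|].
        apply rpow_mono; [lra|]. split; [apply Cmod_ge_0|easy].
      * rewrite rpow_0. unfold Rdiv; rewrite !Rmult_0_l; lra.
    + intros eps He. destruct (Hl (N * eps / 2)) as [d [Hd H]].
      { apply Rdiv_lt_0_compat; [apply Rmult_lt_0_compat; lra|lra]. }
      exists d; split; [easy|]. intros r Hr.
      rewrite rpow_pos, Rpower_S by easy.
      assert (HP : 0 < Rpower r alpha) by apply Rpower_gt_0.
      assert (Ho : om r <= N * eps / 2 * Rpower r alpha).
      { apply Hup; [lra|]. intros z w Hzw. eapply Rle_trans; [apply H; lra|].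
        apply Rmult_le_compat_l; [apply Rmult_le_pos; [apply Rmult_le_pos; lra|lra]|].
        rewrite <- rpow_pos by easy. apply rpow_mono; [lra|]. split; [apply Cmod_ge_0|easy]. }
      apply Rle_lt_trans with (eps / 2); [|lra].
      apply Rmult_le_reg_r with (N * Rpower r alpha); [now apply Rmult_lt_0_compat|].
      replace (r * om r / N / (r * Rpower r alpha) * (N * Rpower r alpha)) with (om r)
        by (field; repeat split; lra). lra.
Qed.

(** The lower content dominates the content of the one function [h], so a cover nearly optimal for
    [h] exists. Radii equal to zero are enlarged, because the cost of a disc is only available for
    positive radii. *)
Lemma content_cover alpha h (E : Cset) (x0 : C) rho0 m eps : 0 < alpha < 1 -> AdmissibleH alpha h ->
  0 <= rho0 -> (forall z, E z -> Cmod (z - x0) <= rho0) -> LowerContent alpha E m -> 0 < eps ->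
  0 <= m /\ exists (c : nat -> C) (rad T : nat -> R), (forall i, 0 < rad i) /\
    (forall i, h (2 * rad i) <= T i) /\ ex_series T /\ Series T <= m + eps /\
    forall z, E z -> exists i, Cmod (z - c i) <= rad i.
Proof.
  intros Ha Hadm Hrho HE Hm Heps.
  destruct (Hadm) as [h0 [hm [hp _]]].
  assert (h00 : h 0 = 0).
  { apply Rle_antisym; [|apply h0; lra]. eapply Rle_trans; [apply hp; lra|]. rewrite rpow_0; lra. }
  (* As in [Mh], sums enter with a minus sign, and the infimum over covers becomes a supremum. *)
  set (X := fun s => exists c rad, BallCover E c rad /\ infinite_sum (fun n => h (2 * rad n)) (- s)).
  assert (Xneg : forall s, X s -> s <= 0).
  { intros s [c [rad [[Hr _] Hs]]]. apply is_series_Reals in Hs.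
    apply is_series_unique in Hs as Hs'.
    assert (0 <= - s); [|lra]. rewrite <- Hs'.
    rewrite <- (Rmult_0_l (Series (fun _ => 0))), <- Series_scal_l.
    apply Series_le; [|eexists; apply Hs].
    intros n. rewrite Rmult_0_l. split; [lra|]. apply h0. specialize (Hr n). lra. }
  destruct (completeness X) as [M HM].
  { exists 0. exact Xneg. }
  (* One disc holds the whole set; the other discs have radius 0 and contribute [h 0 = 0]. *)
  { exists (- h (2 * rho0)), (fun _ => x0), (fun n => match n with O => rho0 | _ => 0 end). split.
    - split; [intros [|n]; lra|]. intros z Hz. exists 0%nat. rewrite Cnorm_Cmod. now apply HE.
    - rewrite Ropp_involutive. intros e He. exists 0%nat. intros n _.
      replace (sum_f_R0 (fun k => h (2 * match k with O => rho0 | _ => 0 end)) n) with (h (2 * rho0)).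
      + unfold Rdist. rewrite Rminus_diag, Rabs_R0. easy.
      + induction n as [|n IH]; simpl; [easy|]. rewrite <- IH, Rmult_0_r, h00; ring. }
  assert (HMh : Mh h E (- M)).
  { unfold Mh. rewrite Ropp_involutive. exact HM. }
  assert (Hv : - M <= m).
  { apply (proj1 Hm). now exists h. }
  assert (HM0 : M <= 0) by (apply HM; exact Xneg).
  split; [lra|].
  assert (Hex : exists s, X s /\ M - eps / 2 < s).
  { apply Classical_Prop.NNPP. intros Hno.
    assert (M <= M - eps / 2); [|lra]. apply HM. intros s Hs.
    apply Rnot_lt_le. intros Hlt. apply Hno; eauto. }
  destruct Hex as [s [[c [rad [[Hr Hcov] Hs]]] Hs2]].
  apply is_series_Reals in Hs.
  assert (Hg : is_series (fun i => eps / 4 * (/ 2) ^ i) (eps / 2)).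
  { replace (eps / 2) with (scal (eps / 4) (/ (1 - / 2))) by (unfold scal; simpl; unfold mult; simpl; field).
    apply (is_series_scal (V := R_NormedModule)). apply is_series_geom. rewrite Rabs_pos_eq; lra. }
  assert (Hpw : forall i, 0 < eps / 4 * (/ 2) ^ i).
  { intros i. apply Rmult_lt_0_compat; [lra|apply pow_lt; lra]. }
  set (T := fun i => h (2 * rad i) + eps / 4 * (/ 2) ^ i).
  assert (HT : is_series T (- s + eps / 2)).
  { apply (is_series_plus (V := R_NormedModule)); easy. }
  (* The bound 1/2 makes (2 tau)^alpha at most 1, so an enlarged disc costs at most
     [eps / 4 * (/ 2) ^ i]. These costs sum to [eps / 2]; the other half was spent on approaching
     the supremum. *)
  set (tau := fun i => Rmin (/ 2) (eps / 4 * (/ 2) ^ i / 2)).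
  assert (Htau : forall i, 0 < tau i).
  { intros i. apply Rmin_pos; [lra|]. specialize (Hpw i). lra. }
  exists c, (fun i => if Rle_dec (rad i) 0 then tau i else rad i), T.
  split; [|split; [|split; [|split]]].
  - intros i. destruct Rle_dec; [auto|lra].
  - intros i. specialize (Hpw i). specialize (Hr i). unfold T. destruct Rle_dec as [Hi|Hi].
    + assert (0 <= h (2 * rad i)) by (apply h0; lra).
      assert (h (2 * tau i) <= eps / 4 * (/ 2) ^ i); [|lra].
      specialize (Htau i).
      eapply Rle_trans; [apply hp; lra|]. rewrite rpow_pos, Rpower_S by lra.
      assert (T1 : tau i <= / 2) by apply Rmin_l. assert (T2 : tau i <= eps / 4 * (/ 2) ^ i / 2) by apply Rmin_r.
      assert (Rpower (2 * tau i) alpha <= 1).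
      { replace 1 with (Rpower 1 alpha) by (unfold Rpower; rewrite ln_1, Rmult_0_r; apply exp_0).
        apply Rle_Rpower_l; lra. }
      assert (0 < Rpower (2 * tau i) alpha) by apply Rpower_gt_0.
      nra.
    + lra.
  - eexists; apply HT.
  - rewrite (is_series_unique _ _ HT). lra.
  - intros z Hz. destruct (Hcov z Hz) as [i Hi]. exists i. rewrite Cnorm_Cmod in Hi.
    change (Csub z (c i)) with (z - c i)%C in Hi. specialize (Htau i). destruct Rle_dec; lra.
Qed.

(** * Polar coordinates and covers of a circle *)

Lemma polar_form (z : C) : exists th, - PI <= th <= PI /\
  z = (Cmod z * cos th, Cmod z * sin th).
Proof.
  destruct (Ceq_dec z 0) as [->|Hz].
  { exists 0. pose proof PI_RGT_0. split; [lra|]. rewrite Cmod_0. unfold RtoC; f_equal; ring. }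
  assert (Hp : 0 < Cmod z) by now apply Cmod_gt_0.
  set (u := fst z / Cmod z).
  assert (Hsq : Cmod z * Cmod z = fst z * fst z + snd z * snd z).
  { unfold Cmod. rewrite sqrt_sqrt; [ring|]. nra. }
  assert (Hu : -1 <= u <= 1).
  { pose proof (fst_le_Cmod z) as H. apply Rabs_le_between in H. unfold u. split.
    - apply Rmult_le_reg_r with (Cmod z); [easy|]. replace (fst z / Cmod z * Cmod z) with (fst z) by (field; lra). lra.
    - apply Rmult_le_reg_r with (Cmod z); [easy|]. replace (fst z / Cmod z * Cmod z) with (fst z) by (field; lra). lra. }
  assert (Hc : Cmod z * cos (acos u) = fst z) by (rewrite cos_acos by easy; unfold u; field; lra).
  assert (Hs : Cmod z * sin (acos u) = Rabs (snd z)).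
  { rewrite sin_acos by easy. rewrite <- (sqrt_Rsqr (Cmod z)) at 1 by lra. rewrite <- sqrt_mult_alt by apply Rle_0_sqr.
    rewrite <- sqrt_Rsqr_abs. f_equal. unfold Rsqr, u. rewrite Rmult_minus_distr_l.
    replace (Cmod z * Cmod z * (fst z / Cmod z * (fst z / Cmod z))) with (fst z * fst z) by (field; lra). lra. }
  pose proof (acos_bound u) as Hb.
  destruct (Rle_dec 0 (snd z)) as [H|H].
  - exists (acos u). split; [lra|]. rewrite Hc, Hs, Rabs_pos_eq by easy. now destruct z.
  - exists (- acos u). split; [lra|]. rewrite cos_neg, sin_neg, Hc.
    replace (Cmod z * - sin (acos u)) with (- (Cmod z * sin (acos u))) by ring.
    rewrite Hs, Rabs_left by lra. rewrite Ropp_involutive. now destruct z.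
Qed.

Lemma sin_abs_le x : Rabs (sin x) <= Rabs x.
Proof.
  destruct (Rlt_dec 0 x) as [H|H].
  - rewrite (Rabs_pos_eq x) by lra. destruct (Rle_dec x 1) as [H1|H1].
    + pose proof PI2_1. rewrite Rabs_pos_eq; [left; now apply sin_lt_x|]. apply sin_ge_0; lra.
    + pose proof (SIN_bound x). apply Rabs_le. lra.
  - destruct (Req_dec x 0) as [->|H0]; [rewrite sin_0; lra|].
    rewrite <- (Rabs_Ropp (sin x)), <- sin_neg, <- (Rabs_Ropp x).
    assert (Hx : 0 < - x) by lra.
    rewrite (Rabs_pos_eq (- x)) by lra. destruct (Rle_dec (- x) 1) as [H1|H1].
    + pose proof PI2_1. rewrite Rabs_pos_eq; [left; now apply sin_lt_x|]. apply sin_ge_0; lra.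
    + pose proof (SIN_bound (- x)). apply Rabs_le. lra.
Qed.

Lemma cis_dist a b : Rabs (cos a - cos b) <= Rabs (a - b) /\ Rabs (sin a - sin b) <= Rabs (a - b).
Proof.
  assert (K : forall u, Rabs (2 * sin ((a - b) / 2)) * Rabs u <= Rabs (a - b) * 1 \/ 1 < Rabs u).
  { intros u. destruct (Rle_dec (Rabs u) 1) as [H|H]; [left|right; lra].
    apply Rmult_le_compat; try apply Rabs_pos; [|easy].
    rewrite Rabs_mult, (Rabs_pos_eq 2) by lra.
    pose proof (sin_abs_le ((a - b) / 2)) as Hs. unfold Rdiv in Hs at 2.
    rewrite Rabs_mult, (Rabs_pos_eq (/ 2)) in Hs by lra. lra. }
  split.
  - rewrite form2. replace (-2 * sin ((a - b) / 2) * sin ((a + b) / 2))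
      with (- (2 * sin ((a - b) / 2) * sin ((a + b) / 2))) by ring.
    rewrite Rabs_Ropp, Rabs_mult.
    destruct (K (sin ((a + b) / 2))) as [H|H]; [lra|].
    pose proof (SIN_bound ((a + b) / 2)). apply Rabs_le in H0. lra.
  - rewrite form4. replace (2 * cos ((a + b) / 2) * sin ((a - b) / 2))
      with (2 * sin ((a - b) / 2) * cos ((a + b) / 2)) by ring.
    rewrite Rabs_mult.
    destruct (K (cos ((a + b) / 2))) as [H|H]; [lra|].
    pose proof (COS_bound ((a + b) / 2)). apply Rabs_le in H0. lra.
Qed.

(** About M discs of radius of order 1/M have total cost of order M^(-alpha), which tends to 0:
    circles have dimension 1, below 1 + alpha. *)
Lemma circle_cover alpha (x0 : C) rn eps : 0 < alpha < 1 -> 0 < rn -> 0 < eps ->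
  exists (M : nat) (c : nat -> C) rad, 0 < rad /\ INR (S M) * Rpower (2 * rad) (1 + alpha) <= eps /\
    forall z, Cmod (z - x0) = rn -> exists i, (i <= M)%nat /\ Cmod (z - c i) <= rad.
Proof.
  intros Ha Hrn He. pose proof PI_RGT_0 as Hpi.
  (* Rounding the angle down costs at most [rn * (2 * PI / INR M)] in each coordinate, together
     [L / INR M]. The angle [PI] rounds to the index [M], hence [M + 1] discs. *)
  set (L := 4 * PI * rn). assert (HL : 0 < L) by (unfold L; apply Rmult_lt_0_compat; lra).
  set (y0 := Rpower (eps / (4 * L)) (/ alpha)).
  assert (Hy0 : 0 < y0) by apply Rpower_gt_0.
  destruct (nfloor_ex (2 * L / y0)) as [M0 [_ HM0]]; [left; apply Rdiv_lt_0_compat; lra|].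
  set (M := S M0). assert (HM : 2 * L / y0 < INR M) by (unfold M; rewrite S_INR; easy).
  assert (HMp : 1 <= INR M) by (unfold M; rewrite S_INR; pose proof (pos_INR M0); lra).
  exists M, (fun j => let th := (- PI + 2 * PI * INR j / INR M)%R in Cplus x0 (rn * cos th, rn * sin th)),
     (L / INR M).
  split; [apply Rdiv_lt_0_compat; lra|split].
  - assert (Hy : 0 < 2 * (L / INR M)) by (apply Rmult_lt_0_compat; [lra|apply Rdiv_lt_0_compat; lra]).
    rewrite Rpower_S by easy.
    assert (Hle : 2 * (L / INR M) <= y0).
    { apply Rmult_le_reg_r with (INR M); [lra|].
      replace (2 * (L / INR M) * INR M) with (2 * L) by (field; lra).
      apply Rmult_le_reg_r with (/ y0); [now apply Rinv_0_lt_compat|].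
      replace (y0 * INR M * / y0) with (INR M) by (field; lra). unfold Rdiv in HM. lra. }
    assert (Hp : Rpower (2 * (L / INR M)) alpha <= eps / (4 * L)).
    { apply Rle_trans with (Rpower y0 alpha); [apply Rle_Rpower_l; lra|].
      unfold y0. rewrite Rpower_mult, Rinv_l, Rpower_1; [lra| |lra]. apply Rdiv_lt_0_compat; lra. }
    assert (Hp0 : 0 < Rpower (2 * (L / INR M)) alpha) by apply Rpower_gt_0.
    rewrite S_INR.
    apply Rle_trans with (2 * INR M * (2 * (L / INR M) * Rpower (2 * (L / INR M)) alpha)).
    + apply Rmult_le_compat_r; [|lra]. apply Rmult_le_pos; lra.
    + replace (2 * INR M * (2 * (L / INR M) * Rpower (2 * (L / INR M)) alpha))
        with (4 * L * Rpower (2 * (L / INR M)) alpha) by (field; lra).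
      apply Rle_trans with (4 * L * (eps / (4 * L))); [apply Rmult_le_compat_l; lra|right; field; lra].
  - intros z Hz. destruct (polar_form (z - x0)%C) as [th [Hth Hzx]]. rewrite Hz in Hzx.
    destruct (nfloor_ex ((th + PI) * INR M / (2 * PI))) as [j [Hj1 Hj2]].
    { apply Rmult_le_pos; [apply Rmult_le_pos; lra|left; apply Rinv_0_lt_compat; lra]. }
    assert (Hu : (th + PI) * INR M / (2 * PI) <= INR M).
    { apply Rmult_le_reg_r with (2 * PI); [lra|].
      replace ((th + PI) * INR M / (2 * PI) * (2 * PI)) with ((th + PI) * INR M) by (field; lra). nra. }
    exists j; split.
    { apply INR_le. lra. }
    set (tj := - PI + 2 * PI * INR j / INR M).
    assert (Ht : Rabs (th - tj) <= 2 * PI / INR M).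
    { replace (th - tj) with (((th + PI) * INR M / (2 * PI) - INR j) * (2 * PI / INR M))
        by (unfold tj; field; split; lra).
      rewrite Rabs_mult. rewrite (Rabs_pos_eq (2 * PI / INR M)) by (left; apply Rdiv_lt_0_compat; lra).
      rewrite <- (Rmult_1_l (2 * PI / INR M)) at 2.
      apply Rmult_le_compat_r; [left; apply Rdiv_lt_0_compat; lra|].
      rewrite Rabs_pos_eq; lra. }
    cbv zeta. fold tj. set (e := (rn * cos tj, rn * sin tj)).
    replace (z - (x0 + e))%C with ((z - x0) - e)%C by ring. unfold e.
    rewrite Hzx. eapply Rle_trans; [apply Cmod_le_sum|].
    cbn [fst snd Cminus Cplus Copp].
    replace (rn * cos th + - (rn * cos tj)) with (rn * (cos th - cos tj)) by ring.
    replace (rn * sin th + - (rn * sin tj)) with (rn * (sin th - sin tj)) by ring.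
    rewrite !Rabs_mult, (Rabs_pos_eq rn) by lra.
    destruct (cis_dist th tj) as [C1 C2].
    replace (L / INR M) with (rn * (2 * PI / INR M) + rn * (2 * PI / INR M)) by (unfold L; field; lra).
    apply Rplus_le_compat; apply Rmult_le_compat_l; lra.
Qed.

(** * The estimate for functions analytic near the base point *)

Lemma square_in_open (W : Cset) (y : C) : Copen W -> W y ->
  exists a b d, 0 < d /\ int_sq a b d y /\ forall z, in_sq a b d z -> W z.
Proof.
  intros HW Wy. destruct (HW y Wy) as [r [Hr H]].
  exists (fst y - r/6), (snd y - r/6), (r/3). split; [lra|split].
  - unfold int_sq; lra.
  - intros z Hz. apply H. rewrite Cnorm_Cmod.
    apply Rle_lt_trans with (2 * (r / 3)); [|lra].
    apply (in_sq_dist (fst y - r/6) (snd y - r/6) (r/3)); [easy|]. unfold in_sq; lra.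
Qed.

Lemma holder_ccont alpha (f : C -> C) N : 0 < alpha -> 0 < N ->
  (forall z w, Cmod (f z - f w) <= N * rpow (Cmod (z - w)) alpha) -> forall z, ccont f z.
Proof.
  intros Ha HN HL z e He.
  assert (Hy : 0 < e / (2 * N)) by (apply Rdiv_lt_0_compat; lra).
  exists (Rpower (e / (2 * N)) (/ alpha)). split; [apply Rpower_gt_0|].
  intros w Hw. eapply Rle_lt_trans; [apply HL|].
  apply Rle_lt_trans with (N * (e / (2 * N))); [|replace (N * (e / (2 * N))) with (e/2) by (field; lra); lra].
  apply Rmult_le_compat_l; [lra|].
  replace (e / (2 * N)) with (rpow (Rpower (e / (2 * N)) (/ alpha)) alpha).
  - apply rpow_mono; [lra|]. split; [apply Cmod_ge_0|lra].
  - rewrite rpow_pos by apply Rpower_gt_0.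
    rewrite Rpower_mult, Rinv_l, Rpower_1; lra.
Qed.

(** The annuli include their outer circles, so that they leave no gaps. The index [i] belongs to
    outer radius 2^(-i-1), in step with a series that begins at n = 1. *)
Lemma dyadic_annulus R0 k : / 2 ^ (S k) < R0 -> R0 <= / 2 ->
  exists i, (i <= k)%nat /\ / 2 ^ (S (S i)) < R0 <= / 2 ^ (S i).
Proof.
  induction k as [|k IH]; intros H1 H2.
  - simpl in H1. lra.
  - destruct (Rle_dec R0 (/ 2 ^ S k)) as [H|H].
    + exists k. split; [lia|lra].
    + destruct IH as [i [Hi Hi']]; [lra|easy|]. exists i; split; [lia|easy].
Qed.

Lemma sum_half k : sum_f_R0 (fun i => (/ 2) ^ (S i)) k <= 1.
Proof.
  assert (sum_f_R0 (fun i => (/ 2) ^ (S i)) k = 1 - (/ 2) ^ (S k)).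
  { induction k as [|k IH]; [simpl; lra|]. cbn [sum_f_R0]. rewrite IH. simpl. lra. }
  rewrite H. assert (0 < (/ 2) ^ S k) by (apply pow_lt; lra). lra.
Qed.

Lemma pow_gt_inv d : 0 < d -> exists k, / 2 ^ (S k) < d.
Proof.
  intros Hd. destruct (pow_lt_1_zero (/2) ltac:(rewrite Rabs_pos_eq; lra) d Hd) as [n Hn].
  exists n. specialize (Hn (S n) ltac:(lia)).
  rewrite Rabs_pos_eq in Hn by (apply pow_le; lra). now rewrite pow_inv in Hn.
Qed.

(** Links the kernel bound to the weights in the series of the hypothesis. *)
Lemma Theta_dyadic t lam x x0 n : x <> x0 ->
  Theta t lam x x0 (/ 2 ^ n) = Rpower (Cmod (x - x0)) lam * Rpower 2 ((INR t + 1 + lam) * INR n).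
Proof.
  intros Hx. assert (Hp := Cmod_pos_sub _ _ Hx). unfold Theta.
  assert (H2 : 0 < 2 ^ n) by (apply pow_lt; lra).
  rewrite Rinv_inv. unfold Rdiv. rewrite Rinv_inv.
  rewrite <- Rpower_pow by easy. rewrite <- (Rpower_pow n 2) by lra.
  rewrite Rpower_mult.
  rewrite <- (Rpower_mult_distr (Cmod (x - x0)) (Rpower 2 (INR n))) by (try easy; apply Rpower_gt_0).
  rewrite (Rpower_mult 2 (INR n) lam). rewrite S_INR.
  replace ((INR t + 1 + lam) * INR n) with (INR n * (INR t + 1) + INR n * lam) by ring.
  rewrite (Rpower_plus (INR n * (INR t + 1))). ring.
Qed.

(** The constants are fixed before [f]. The neighbourhood [V] decides how many annuli have to be
    treated, but does not enter the constants; this uniformity is what survives a passage to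
    limits. *)
Lemma near_estimate alpha (U : Cset) (x0 : C) t lam K r (m : nat -> R) l :
  0 < alpha < 1 -> Copen U -> 0 < lam < 1 -> 0 < K -> 0 < r ->
  (forall n, LowerContent alpha (fun z => Ann x0 n z /\ ~ U z) (m n)) ->
  Un_cv (fun N => sum_f_R0 (fun n => Rpower 2 ((INR t + 1 + lam) * INR (S n)) * m (S n)) N) l ->
  exists C1 a1, 0 < C1 /\ 0 < a1 /\ forall (f : C -> C) N (x v v0 : C), 0 < N ->
    (forall z, Cmod (f z) <= N) ->
    (forall z w, Cmod (f z - f w) <= N * rpow (Cmod (z - w)) alpha) ->
    (forall eps, eps > 0 -> exists d, d > 0 /\ forall z w, Cmod (z - w) < d ->
       Cmod (f z - f w) <= eps * rpow (Cmod (z - w)) alpha) ->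
    (forall p, U p -> cdiffable f p) ->
    (exists V, Copen V /\ V x0 /\ forall p, V p -> cdiffable f p) ->
    U x -> x <> x0 -> Cmod (x - x0) <= a1 ->
    (forall z, ~ U z -> Cmod (z - x0) < r -> Cmod (x - x0) <= K * Cmod (z - x)) ->
    DerivNAt f t x v -> DerivNAt f t x0 v0 ->
    Cmod (v - v0) <= C1 * N * Rpower (Cmod (x - x0)) lam.
Proof.
  intros Ha HU Hlam HK Hr Hm Hl.
  (* Points of the square of half side [a0] satisfy |p - x0| <= 2 a0. This is below 1/2, as
     [dyadic_annulus] requires, and below [r], where the cone inequality is available. *)
  set (a0 := Rmin (/ 8) (r / 4)).
  assert (Ha0 : 0 < a0) by (apply Rmin_pos; lra).
  assert (Ha8 : a0 <= / 8) by apply Rmin_l. assert (Har : a0 <= r / 4) by apply Rmin_r.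
  set (W := fun n => Rpower 2 ((INR t + 1 + lam) * INR n)).
  assert (HW : forall n, 0 < W n) by (intros; apply Rpower_gt_0).
  set (Cb := Cball t K).
  assert (HCb : 0 < Cb).
  { unfold Cb, Cball. pose proof (Ck_pos t lam K Hlam HK). apply Rmult_lt_0_compat; [lra|].
    apply pow_lt. unfold kap; lra. }
  (* Bounds the integral of f times the kernel difference over the fixed boundary, per unit of N |x
     - x0|; the boundary keeps distance [a0 / 2] from both poles. *)
  set (B1 := 4 * (2 * a0) * (INR (S t) * (2 / a0) ^ S (S t))).
  assert (HB1 : 0 <= B1).
  { unfold B1. apply Rmult_le_pos; [lra|]. apply Rmult_le_pos; [apply pos_INR|].
    apply pow_le. left; apply Rdiv_lt_0_compat; lra. }
  assert (Hft : 0 < INR (fact t) / (2 * PI)).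
  { pose proof PI_RGT_0. apply Rdiv_lt_0_compat; [apply INR_fact_lt_0|lra]. }
  exists (INR (fact t) / (2 * PI) * (B1 + Cb * (Rabs l + 1) + 1)), (a0 / 2).
  split; [|split; [lra|]].
  { pose proof (Rabs_pos l). apply Rmult_lt_0_compat; [easy|]. nra. }
  intros f N x v v0 HN Hb HL Hlip HUf [V [HV [Vx0 HVf]]] Ux Hxx Hxa Hnt Hv Hv0.
  assert (Hfc := holder_ccont alpha f N (proj1 Ha) HN HL).
  set (xi := Cmod (x - x0)) in *.
  assert (Hxi : 0 < xi) by now apply Cmod_pos_sub.
  destruct (lipschitz_modulus alpha f N Ha HN Hb HL Hlip) as [om [Hom [Hmono Hadm]]].
  destruct (square_in_open U x HU Ux) as [ax [bx [dx [Hdx [Ix Sx]]]]].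
  destruct (square_in_open V x0 HV Vx0) as [av [bv [dv [Hdv [Iv Sv]]]]].
  (* The small squares around [x] and [x0] depend on [f], but they only serve to define the
     quotients, which are then integrated over the fixed square. *)
  destruct (removable_quotient f ax bx dx x N t Hdx Ix) as [Gx [Gx1 [Gx2 [Gx3 Gx4]]]]; auto.
  destruct (removable_quotient f av bv dv x0 N t Hdv Iv) as [G0 [G01 [G02 [G03 G04]]]]; auto.
  rewrite (DerivNAt_CD f t ax bx dx x v N Hdx Ix) by auto.
  rewrite (DerivNAt_CD f t av bv dv x0 v0 N Hdv Iv) by auto.
  set (A := fst x0 - a0). set (B := snd x0 - a0). set (D := 2 * a0).
  assert (HD : 0 < D) by (unfold D; lra).
  assert (Ix0 : int_sq A B D x0) by (unfold int_sq, A, B, D; lra).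
  assert (IxS : int_sq A B D x).
  { pose proof (fst_le_Cmod (x - x0)%C) as X1. pose proof (snd_le_Cmod (x - x0)%C) as X2.
    cbn [fst snd Cminus Cplus Copp] in X1, X2. fold xi in X1, X2.
    assert (X1' : Rabs (fst x + - fst x0) <= a0 / 2) by lra. assert (X2' : Rabs (snd x + - snd x0) <= a0 / 2) by lra.
    apply Rabs_le_between in X1'. apply Rabs_le_between in X2'. unfold int_sq, A, B, D; lra. }
  set (g := fun z => (Gx z - G0 z)%C).
  assert (Hgc : forall z, in_sq A B D z -> ccont g z).
  { intros z _. apply ccont_minus.
    - destruct (Ceq_dec z x) as [->|n]; [apply cdiffable_ccont, Gx1; auto|apply Gx2; auto].
    - destruct (Ceq_dec z x0) as [->|n]; [apply cdiffable_ccont, G01; auto|apply G02; auto]. }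
  assert (Hgd : forall z, cdiffable f z -> cdiffable g z).
  { intros z Hz. apply cdiffable_minus; auto. }
  set (h := fun r => r * om r / N) in *.
  assert (Hh : forall rho, rho * om (2 * rho) = N / 2 * h (2 * rho)) by (intros; unfold h; field; lra).
  assert (Hm0 : forall n, 0 <= m n).
  { intros n. apply (content_cover alpha h (fun z => Ann x0 n z /\ ~ U z) x0 1 (m n) 1); auto; try lra.
    intros z [[_ Hz] _]. rewrite Cnorm_Cmod in Hz. change (Csub z x0) with (z - x0)%C in Hz.
    assert (/ 2 ^ n <= 1). { rewrite <- Rinv_1. apply Rinv_le_contravar; [lra|]. apply pow_R1_Rle; lra. } lra. }
  destruct (HV x0 Vx0) as [dV [HdV HVd]].
  (* Singular points avoid the disc of radius [dV], so they occur only in the annuli with index up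
     to [k]. The number [k] depends on [f], yet every partial sum of the series is at most [l]. *)
  destruct (pow_gt_inv dV HdV) as [k Hk].
  set (En := fun i p => xi <= K * Cmod (p - x) /\ (/ 2 ^ (S (S i)) < Cmod (p - x0) <= / 2 ^ (S i)) /\ ~ U p).
  set (Th := fun i => Rpower xi lam * W (S i)).
  assert (HTh0 : forall i, 0 < Th i).
  { intros i. unfold Th. apply Rmult_lt_0_compat; [apply Rpower_gt_0|apply HW]. }
  assert (Hcov : forall i, Cov g A B D (En i) (Cb * (N / 2) * (Rpower xi lam * (W (S i) * m (S i) + (/ 2) ^ (S i))))).
  { intros i.
    set (rn := / 2 ^ (S i)).
    assert (H2 : 0 < 2 ^ (S i)) by (apply pow_lt; lra).
    assert (Hrn : 0 < rn) by now apply Rinv_0_lt_compat.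
    assert (Hrn2 : / 2 ^ (S (S i)) = rn / 2).
    { unfold rn. change (2 ^ S (S i)) with (2 * 2 ^ (S i)). field. lra. }
    assert (HTh : Theta t lam x x0 rn = Th i) by (apply Theta_dyadic; easy).
    assert (Hball := cov_ball f Gx G0 om t lam K a0 x x0 Hlam HK Ha0 Hfc Hom Hmono Hxx Gx2 G02 Gx3 G03 rn).
    fold A B D g xi Cb in Hball. rewrite HTh in Hball.
    (* The disc cover and the circle cover each lose [eps]; times [W (S i)] the two losses make up
       [(/ 2) ^ (S i)], whose sum is at most 1. *)
    set (eps := (/ 2) ^ (S i) / (2 * W (S i))).
    assert (Hpi : 0 < (/ 2) ^ (S i)) by (apply pow_lt; lra).
    assert (Heps : 0 < eps). { apply Rdiv_lt_0_compat; [easy|]. specialize (HW (S i)); lra. }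
    destruct (content_cover alpha h (fun z => Ann x0 (S i) z /\ ~ U z) x0 rn (m (S i)) eps) as
      [_ [c [rad [T [Hrad [HhT [HexT [HST HcovT]]]]]]]]; auto; [lra| |].
    { intros z [[_ Hz] _]. rewrite Cnorm_Cmod in Hz. left. exact Hz. }
    destruct (circle_cover alpha x0 rn eps Ha Hrn Heps) as [M [c' [rad' [Hrad' [Hsum' Hcov']]]]].
    assert (hnn : forall r, 0 <= r -> 0 <= h r) by apply Hadm.
    assert (HC1 : Cov g A B D (fun p => exists j, xi <= K * Cmod (p - x) /\
         rn / 2 < Cmod (p - x0) <= rn /\ Cmod (p - c j) <= rad j)
         (Series (fun j => Cb * Th i * (N / 2) * T j))).
    { apply cov_series.
      - intros j. eapply cov_mono; [| |apply (Hball (c j) (rad j) Hrn (Hrad j))]; [easy|].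
        rewrite Hh. specialize (HhT j).
        assert (0 <= Cb * Th i * (N / 2)).
        { specialize (HTh0 i). apply Rmult_le_pos; [apply Rmult_le_pos; lra|lra]. }
        rewrite <- Rmult_assoc. apply Rmult_le_compat_l; easy.
      - intros j. specialize (HhT j). specialize (Hrad j). assert (0 <= h (2 * rad j)) by (apply hnn; lra).
        specialize (HTh0 i). apply Rmult_le_pos; [apply Rmult_le_pos; [apply Rmult_le_pos; lra|lra]|lra].
      - apply (ex_series_scal (V := R_NormedModule)). easy. }
    assert (HC2 : Cov g A B D (fun p => exists j, (j <= M)%nat /\ (xi <= K * Cmod (p - x) /\
         rn / 2 < Cmod (p - x0) <= rn /\ Cmod (p - c' j) <= rad'))
         (sum_f_R0 (fun j => Cb * Th i * (N / 2) * h (2 * rad')) M)).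
    { apply cov_finite. intros j _.
      eapply cov_mono; [| |apply (Hball (c' j) rad' Hrn Hrad')]; [easy|]. rewrite Hh. lra. }
    eapply cov_mono; [| |apply (cov_union g A B D _ _ _ _ HC1 HC2)].
    - intros p Hp [E1 [E2 E3]]. rewrite Hrn2 in E2. fold rn in E2.
      destruct (proj2 E2) as [Hlt|Heq].
      + left. destruct (HcovT p) as [j Hj].
        * split; [|easy]. unfold Ann. rewrite Cnorm_Cmod. change (Csub p x0) with (p - x0)%C.
          fold rn. rewrite Hrn2. lra.
        * exists j; auto.
      + right. destruct (Hcov' p Heq) as [j [Hj1 Hj2]]. exists j; auto.
    - rewrite Series_scal_l. rewrite sum_cte.
      assert (Hh' : h (2 * rad') * INR (S M) <= eps).
      { eapply Rle_trans; [|apply Hsum']. rewrite Rmult_comm. apply Rmult_le_compat_l; [apply pos_INR|].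
        rewrite <- rpow_pos by lra. apply Hadm. lra. }
      assert (HK0 : 0 <= Cb * Th i * (N / 2)).
      { specialize (HTh0 i). apply Rmult_le_pos; [apply Rmult_le_pos; lra|lra]. }
      apply Rle_trans with (Cb * Th i * (N / 2) * (m (S i) + eps) + Cb * Th i * (N / 2) * eps).
      + apply Rplus_le_compat; [now apply Rmult_le_compat_l|].
        rewrite Rmult_assoc. now apply Rmult_le_compat_l.
      + right. unfold Th, eps. specialize (HW (S i)). field. lra. }
  assert (Htot := cov_finite g A B D En _ k (fun i _ => Hcov i)).
  set (Tt := sum_f_R0 _ k) in Htot.
  assert (HTt : Tt <= Cb * (Rabs l + 1) * N * Rpower xi lam).
  { unfold Tt.
    rewrite (sum_eq _ (fun i => (Rpower xi lam * (W (S i) * m (S i) + (/ 2) ^ (S i))) * (Cb * (N / 2)))) by (intros; ring).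
    rewrite <- scal_sum.
    rewrite (sum_eq _ (fun i => (W (S i) * m (S i) + (/ 2) ^ (S i)) * Rpower xi lam)) by (intros; ring).
    rewrite <- scal_sum. rewrite plus_sum.
    pose proof (sum_half k). 
    assert (sum_f_R0 (fun i => W (S i) * m (S i)) k <= l).
    { apply (sum_incr (fun i => W (S i) * m (S i))); [exact Hl|].
      intros i. apply Rmult_le_pos; [left; apply HW|apply Hm0]. }
    assert (0 <= sum_f_R0 (fun i => W (S i) * m (S i)) k).
    { apply cond_pos_sum. intros i. apply Rmult_le_pos; [left; apply HW|apply Hm0]. }
    pose proof (Rle_abs l).
    assert (HP : 0 < Rpower xi lam) by apply Rpower_gt_0.
    set (S1 := sum_f_R0 (fun i => W (S i) * m (S i)) k) in *.
    set (S2 := sum_f_R0 (fun i => (/ 2) ^ S i) k) in *.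
    assert (HCN : 0 <= Cb * N * Rpower xi lam) by (apply Rmult_le_pos; [apply Rmult_le_pos|]; lra).
    assert (HS : (S1 + S2) / 2 <= Rabs l + 1) by lra.
    apply (Rmult_le_compat_l _ _ _ HCN) in HS. lra. }
  assert (HSI : Cmod (SI g A B D) <= Cb * (Rabs l + 1) * N * Rpower xi lam).
  { apply le_epsilon. intros e He. apply cov_finish; auto.
    eapply cov_mono; [| |apply (cov_union g A B D _ _ _ _ Htot (cov_diff g A B D e HD He Hgc))]; [|lra].
    (* Points of differentiability cost at most [e]; all others lie outside [U] and [V], hence in
       one of the finitely many annuli. *)
    intros p Hp _. destruct (classic (cdiffable f p)) as [Hdf|Hdf]; [right; auto|left].
    assert (HUp : ~ U p) by auto. assert (HVp : ~ V p) by auto.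
    assert (Hpk : dV <= Cmod (p - x0)).
    { apply Rnot_lt_le. intros Hlt. apply HVp, HVd. now rewrite Cnorm_Cmod. }
    assert (Hp2 : Cmod (p - x0) <= 2 * a0).
    { pose proof (Cmod_le_sum (p - x0)%C) as Q. cbn [fst snd Cminus Cplus Copp] in Q.
      unfold in_sq, A, B, D in Hp.
      assert (Rabs (fst p + - fst x0) <= a0) by (apply Rabs_le; lra).
      assert (Rabs (snd p + - snd x0) <= a0) by (apply Rabs_le; lra). lra. }
    destruct (dyadic_annulus (Cmod (p - x0)) k) as [i [Hi Hi']]; [lra|lra|].
    exists i; split; [easy|]. split; [|split; auto].
    apply Hnt; auto. lra. }
  assert (Hbd : ccont_bd f A B D) by (intros z _; auto).
  assert (Hon : forall z, on_sq A B D z -> a0 / 2 <= Cmod (z - x) /\ a0 / 2 <= Cmod (z - x0)).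
  { intros z Hz.
    assert (H1 : a0 <= Cmod (z - x0)).
    { pose proof (fst_le_Cmod (z - x0)%C) as X1. pose proof (snd_le_Cmod (z - x0)%C) as X2.
      cbn [fst snd Cminus Cplus Copp] in X1, X2. unfold on_sq, A, B, D in Hz.
      pose proof (Rle_abs (fst z + - fst x0)). pose proof (Rle_abs (- (fst z + - fst x0))).
      pose proof (Rle_abs (snd z + - snd x0)). pose proof (Rle_abs (- (snd z + - snd x0))).
      rewrite !Rabs_Ropp in *. lra. }
    pose proof (Cmod_minus_le z x x0). fold xi in H. lra. }
  assert (Nx : forall z, on_sq A B D z -> z <> x).
  { intros z Hz ->. destruct (Hon x Hz) as [Q _]. rewrite Cmod_diag in Q. lra. }
  assert (N0 : forall z, on_sq A B D z -> z <> x0).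
  { intros z Hz ->. destruct (Hon x0 Hz) as [_ Q]. rewrite Cmod_diag in Q. lra. }
  set (Ik := SI (fun w => f w * ipow x (S t) w - f w * ipow x0 (S t) w)%C A B D).
  assert (HIk : Cmod Ik <= B1 * N * Rpower xi lam).
  { apply Rle_trans with (4 * D * (N * (INR (S t) * xi * (2 / a0) ^ S (S t)))).
    - apply SI_norm_le; [lra| |].
      + intros z Hz. apply ccont_minus; apply ccont_mult; auto; apply ccont_ipow; auto.
      + intros z Hz. destruct (Hon z Hz) as [Q1 Q2].
        replace (f z * ipow x (S t) z - f z * ipow x0 (S t) z)%C with (f z * (ipow x (S t) z - ipow x0 (S t) z))%C by ring.
        rewrite Cmod_mult. apply Rmult_le_compat; auto using Cmod_ge_0.
        assert (n1 := Cminus_eq_contra _ _ (Nx z Hz)). assert (n2 := Cminus_eq_contra _ _ (N0 z Hz)).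
        apply (pow_diff_bound (/ (z - x0))%C (/ (z - x))%C (x - x0)%C).
        * rewrite Cmod_inv by easy. replace (2 / a0) with (/ (a0 / 2)) by (field; lra). apply Rinv_le_contravar; lra.
        * rewrite Cmod_inv by easy. replace (2 / a0) with (/ (a0 / 2)) by (field; lra). apply Rinv_le_contravar; lra.
        * field; split; easy.
    - replace (4 * D * (N * (INR (S t) * xi * (2 / a0) ^ S (S t)))) with (B1 * N * xi) by (unfold B1, D; ring).
      apply Rmult_le_compat_l; [apply Rmult_le_pos; lra|]. apply Rpower_ge_self; lra. }
  assert (Hnf : RtoC (INR (fact t)) <> 0).
  { intros E. apply RtoC_inj in E. apply (INR_fact_neq_0 t E). }
  (* Each subtracted Taylor polynomial contributes its residue, a multiple of the derivative,
     because the fixed square contains both poles. *)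
  assert (Eq : (CD f ax bx dx t x - CD f av bv dv t x0 = RtoC (INR (fact t)) / C2pi * (Ik - SI g A B D))%C).
  { unfold g. rewrite SI_minus; [|lra| |].
    - rewrite Gx4, G04 by auto. unfold Ik. rewrite SI_minus; [|lra| |].
      + field. split; [easy|apply C2pi_neq0].
      + intros z Hz. apply ccont_mult; auto; apply ccont_ipow; auto.
      + intros z Hz. apply ccont_mult; auto; apply ccont_ipow; auto.
    - intros z Hz. apply Gx2; auto.
    - intros z Hz. apply G02; auto. }
  rewrite Eq, Cmod_mult, Cmod_div, Cmod_C2pi, Cmod_R by apply C2pi_neq0.
  rewrite Rabs_pos_eq by apply pos_INR.
  apply Rle_trans with (INR (fact t) / (2 * PI) * ((B1 + Cb * (Rabs l + 1) + 1) * (N * Rpower xi lam))); [|right; ring].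
  apply Rmult_le_compat_l; [lra|].
  eapply Rle_trans; [apply Cmod_minus_triangle|].
  assert (0 < N * Rpower xi lam) by (apply Rmult_lt_0_compat; [easy|apply Rpower_gt_0]). lra.
Qed.

(** * Moduli of continuity of Cauchy integrals *)

Lemma rpow_scale c t a : 1 <= c -> 0 <= t -> 0 <= a <= 1 -> rpow (c * t) a <= c * rpow t a.
Proof.
  intros Hc [Ht|<-] Ha.
  - rewrite !rpow_pos by (try apply Rmult_lt_0_compat; lra).
    rewrite <- Rpower_mult_distr by lra.
    apply Rmult_le_compat_r; [left; apply Rpower_gt_0|].
    rewrite <- (Rpower_1 c) at 2 by lra. apply Rle_Rpower; lra.
  - rewrite Rmult_0_r, rpow_0. lra.
Qed.

(* Two exponents: the second term, with coefficient e2 large and gam > al, absorbs the differences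
   f z - f w with |z - w| bounded below, so that the estimate also yields the little-o condition. *)
Definition Om (al gam e1 e2 t : R) : R := e1 * rpow t al + e2 * rpow t gam.

Section Modulus.
Variables (al gam e1 e2 : R).
Hypothesis (Hal : 0 < al < gam) (Hgam : gam < 1) (He1 : 0 <= e1) (He2 : 0 <= e2).
Notation O := (Om al gam e1 e2).

Lemma Om_nonneg t : 0 <= O t.
Proof.
  unfold Om. apply Rplus_le_le_0_compat; apply Rmult_le_pos; auto using rpow_nonneg.
Qed.

Lemma Om_mono s t : 0 <= s <= t -> O s <= O t.
Proof.
  intros H. unfold Om. apply Rplus_le_compat; apply Rmult_le_compat_l; auto; apply rpow_mono; lra.
Qed.

Lemma Om_scale c t : 1 <= c -> 0 <= t -> O (c * t) <= c * O t.
Proof.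
  intros Hc Ht. unfold Om.
  assert (e1 * rpow (c * t) al <= e1 * (c * rpow t al)) by (apply Rmult_le_compat_l; [easy|apply rpow_scale; lra]).
  assert (e2 * rpow (c * t) gam <= e2 * (c * rpow t gam)) by (apply Rmult_le_compat_l; [easy|apply rpow_scale; lra]).
  lra.
Qed.

Lemma Om_le_scale c s t : 1 <= c -> 0 <= s <= c * t -> 0 <= t -> O s <= c * O t.
Proof.
  intros Hc Hs Ht. eapply Rle_trans; [apply Om_mono, Hs|]. now apply Om_scale.
Qed.

(** The factor exceeds 1, so a sum of values of the modulus at doubling arguments is controlled by
    the last one. *)
Lemma Om_double t : 0 < t -> Rpower 2 al * O t <= O (2 * t).
Proof.
  intros Ht. unfold Om. rewrite !rpow_pos by lra. rewrite <- !Rpower_mult_distr by lra.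
  assert (Rpower 2 al <= Rpower 2 gam) by (apply Rle_Rpower; lra).
  assert (0 < Rpower t gam) by apply Rpower_gt_0.
  assert (e2 * (Rpower 2 al * Rpower t gam) <= e2 * (Rpower 2 gam * Rpower t gam)).
  { apply Rmult_le_compat_l; [easy|]. apply Rmult_le_compat_r; lra. }
  lra.
Qed.

Lemma RInt_power_half b m L : b < 1 -> 0 < m -> 0 <= L ->
  exists I, is_RInt (fun t => Rpower (m + t) (b - 2)) 0 L I /\ I <= Rpower m (b - 1) / (1 - b).
Proof.
  intros Hb Hm HL.
  exists (minus (Rpower (m + L) (b - 1) / (b - 1)) (Rpower (m + 0) (b - 1) / (b - 1))). split.
  - apply (is_RInt_derive (V := R_CompleteNormedModule) (fun t => Rpower (m + t) (b - 1) / (b - 1))).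
    + rewrite Rmin_left, Rmax_right by easy. intros t Ht. unfold Rpower. auto_derive; [lra|].
      replace (b - 2) with ((b - 1) + - 1) by ring.
      rewrite Rmult_plus_distr_r, exp_plus. replace (-1 * ln (m + t)) with (- ln (m + t)) by ring.
      rewrite exp_Ropp, exp_ln by lra. field. lra.
    + rewrite Rmin_left, Rmax_right by easy. intros t Ht.
      apply (ex_derive_continuous (V := R_NormedModule)). unfold Rpower. auto_derive. lra.
  - unfold minus, plus, opp; simpl. rewrite Rplus_0_r.
    assert (0 < Rpower (m + L) (b - 1)) by apply Rpower_gt_0.
    assert (0 < / (1 - b)) by (apply Rinv_0_lt_compat; lra).
    replace (Rpower (m + L) (b - 1) / (b - 1)) with (- (Rpower (m + L) (b - 1) * / (1 - b))) by (field; lra).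
    replace (Rpower m (b - 1) / (b - 1)) with (- (Rpower m (b - 1) * / (1 - b))) by (field; lra).
    unfold Rdiv. nra.
Qed.

Lemma RInt_power_full b m c d ta : b < 1 -> 0 < m -> c <= ta <= d ->
  exists I, is_RInt (fun t => Rpower (m + Rabs (t - ta)) (b - 2)) c d I /\ I <= 2 * (Rpower m (b - 1) / (1 - b)).
Proof.
  intros Hb Hm [H1 H2].
  destruct (RInt_power_half b m (ta - c) Hb Hm) as [I1 [J1 K1]]; [lra|].
  destruct (RInt_power_half b m (d - ta) Hb Hm) as [I2 [J2 K2]]; [lra|].
  exists (plus I1 I2). split; [|unfold plus; simpl; lra].
  apply (is_RInt_Chasles (V := R_NormedModule)) with ta.
  - apply (is_RInt_ext (V := R_NormedModule) (fun t => scal (opp 1) (opp (Rpower (m + (-1 * t + ta)) (b - 2))))).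
    { rewrite Rmin_left, Rmax_right by lra. intros t Ht. rewrite Rabs_left by lra.
      unfold scal, opp; simpl; unfold mult; simpl. replace (-1 * t + ta) with (- (t - ta)) by ring. ring. }
    apply (is_RInt_swap (V := R_NormedModule)) in J1. 
    assert (J := is_RInt_comp_lin (V := R_NormedModule) (fun t => Rpower (m + t) (b - 2)) (-1) ta c ta).
    replace (-1 * c + ta) with (ta - c) in J by ring. replace (-1 * ta + ta) with 0 in J by ring.
    specialize (J _ J1).
    apply (is_RInt_scal (V := R_NormedModule) _ _ _ (-1)) in J.
    replace I1 with (scal (-1) (opp I1)) by (unfold scal, opp; simpl; unfold mult; simpl; ring).
    eapply (is_RInt_ext (V := R_NormedModule)); [|apply J].
    intros t _. unfold scal, opp; simpl; unfold mult; simpl. ring.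
  - apply (is_RInt_ext (V := R_NormedModule) (fun t => scal 1 (Rpower (m + (1 * t + - ta)) (b - 2)))).
    { rewrite Rmin_left, Rmax_right by lra. intros t Ht. rewrite Rabs_pos_eq by lra.
      unfold scal; simpl; unfold mult; simpl. replace (1 * t + - ta) with (t - ta) by ring. ring. }
    apply (is_RInt_comp_lin (V := R_NormedModule) (fun t => Rpower (m + t) (b - 2)) 1 (- ta) ta d).
    replace (1 * ta + - ta) with 0 by ring. replace (1 * d + - ta) with (d - ta) by ring. exact J2.
Qed.

(** A decreasing majorant of [Om y / (m + y)^2] with an elementary primitive. *)
Definition psi (m y : R) : R := e1 * Rpower (m + y) (al - 2) + e2 * Rpower (m + y) (gam - 2).

Lemma psi_integral m c d ta : 0 < m -> c <= ta <= d ->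
  exists I, is_RInt (fun t => psi m (Rabs (t - ta))) c d I /\ I <= 2 / (1 - gam) * (O m / m).
Proof.
  intros Hm Ht.
  destruct (RInt_power_full al m c d ta) as [I1 [J1 K1]]; try lra.
  destruct (RInt_power_full gam m c d ta) as [I2 [J2 K2]]; try lra.
  exists (plus (scal e1 I1) (scal e2 I2)). split.
  - apply (is_RInt_plus (V := R_NormedModule)); now apply (is_RInt_scal (V := R_NormedModule)).
  - unfold plus, scal; simpl; unfold mult; simpl.
    assert (Ev : forall b, Rpower m (b - 1) = Rpower m b / m).
    { intros b. unfold Rminus. rewrite Rpower_plus, Rpower_Ropp, Rpower_1 by easy. easy. }
    rewrite Ev in K1, K2. unfold Om. rewrite !rpow_pos by easy.
    assert (Hi : / (1 - al) <= / (1 - gam)) by (apply Rinv_le_contravar; lra).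
    assert (P1 : 0 < Rpower m al / m) by (apply Rdiv_lt_0_compat; [apply Rpower_gt_0|easy]).
    assert (K1' : I1 <= 2 / (1 - gam) * (Rpower m al / m)).
    { eapply Rle_trans; [apply K1|]. unfold Rdiv in *. nra. }
    apply (Rmult_le_compat_l e1) in K1'; [|easy].
    apply (Rmult_le_compat_l e2) in K2; [|easy].
    replace (2 / (1 - gam) * ((e1 * Rpower m al + e2 * Rpower m gam) / m))
      with (e1 * (2 / (1 - gam) * (Rpower m al / m)) + e2 * (2 * (Rpower m gam / m / (1 - gam)))) by (field; lra).
    lra.
Qed.

Lemma psi_antitone m y y' : 0 < m -> 0 <= y' <= y -> psi m y <= psi m y'.
Proof.
  intros Hm Hy. unfold psi.
  assert (K : forall b, b < 1 -> Rpower (m + y) (b - 2) <= Rpower (m + y') (b - 2)).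
  { intros b Hb. replace (b - 2) with (- (2 - b)) by ring. rewrite !Rpower_Ropp.
    apply Rinv_le_contravar; [apply Rpower_gt_0|]. apply Rle_Rpower_l; lra. }
  apply Rplus_le_compat; apply Rmult_le_compat_l; auto; apply K; lra.
Qed.

Lemma Om_psi m y : 0 < m -> 0 <= y -> O y / ((m + y) * (m + y)) <= psi m y.
Proof.
  intros Hm Hy.
  assert (Ev : forall b, Rpower (m + y) (b - 2) = Rpower (m + y) b / ((m + y) * (m + y))).
  { intros b. unfold Rminus. rewrite Rpower_plus, Rpower_Ropp.
    replace 2 with (1 + 1) at 1 by ring. rewrite Rpower_plus, Rpower_1 by lra. easy. }
  unfold psi. rewrite !Ev.
  replace (e1 * (Rpower (m + y) al / ((m + y) * (m + y))) + e2 * (Rpower (m + y) gam / ((m + y) * (m + y))))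
    with (O (m + y) / ((m + y) * (m + y))).
  - apply Rmult_le_compat_r; [left; apply Rinv_0_lt_compat; nra|]. apply Om_mono; lra.
  - unfold Om. rewrite !rpow_pos by lra. field. lra.
Qed.
End Modulus.

(** The difference of the two kernels is (z - z')/((w - z)(w - z')). With [phi] of size [Om] near
    [a], the integrand is dominated by [psi], first of |w - a| and then, by monotonicity, of one
    coordinate of w - a. Four sides at [2 / (1 - gam)] each give the 8. *)
Lemma CK_difference_bound al gam e1 e2 phi A B D (a z z' : C) m kp M :
  0 < al < gam -> gam < 1 -> 0 <= e1 -> 0 <= e2 -> 0 < D -> 0 < m -> 0 < kp ->
  ccont_bd phi A B D -> on_sq A B D a -> ~ on_sq A B D z -> ~ on_sq A B D z' ->
  (forall w, on_sq A B D w -> Cmod (phi w) <= Om al gam e1 e2 (Cmod (w - a))) ->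
  (forall w, on_sq A B D w -> m + Cmod (w - a) <= kp * Cmod (w - z)) ->
  (forall w, on_sq A B D w -> m + Cmod (w - a) <= kp * Cmod (w - z')) ->
  M = 8 / (1 - gam) * (kp * kp) ->
  Cmod (CK phi A B D 1 z - CK phi A B D 1 z') <= M * (Cmod (z - z') * (Om al gam e1 e2 m / m)).
Proof.
  intros Hal Hgam He1 He2 HD Hm Hk Hc Ha Hz Hz' Hphi H1 H2 ->.
  assert (Ain := on_sq_in A B D a ltac:(lra) Ha). unfold in_sq in Ain.
  destruct (psi_integral al gam e1 e2 Hal Hgam He1 He2 m A (A + D) (fst a) Hm (proj1 Ain)) as [I1 [J1 K1]].
  destruct (psi_integral al gam e1 e2 Hal Hgam He1 He2 m B (B + D) (snd a) Hm (proj2 Ain)) as [I2 [J2 K2]].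
  assert (Nz : forall w, on_sq A B D w -> w <> z) by (intros w Hw ->; easy).
  assert (Nz' : forall w, on_sq A B D w -> w <> z') by (intros w Hw ->; easy).
  set (c := kp * kp * Cmod (z - z')).
  assert (Hc0 : 0 <= c) by (unfold c; apply Rmult_le_pos; [nra|apply Cmod_ge_0]).
  unfold CK. rewrite <- SI_minus; [|lra| |].
  - eapply Rle_trans; [apply (SI_norm_le_int _ A B D (fun t => scal c (psi al gam e1 e2 m (Rabs (t - fst a))))
       (fun t => scal c (psi al gam e1 e2 m (Rabs (t - snd a)))) (scal c I1) (scal c I2))|].
    + lra.
    + intros w Hw. apply ccont_minus; apply ccont_kernel; auto.
    + now apply (is_RInt_scal (V := R_NormedModule)).
    + now apply (is_RInt_scal (V := R_NormedModule)).
    + intros w Hw. unfold scal; simpl; unfold mult; simpl.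
      assert (Hb : Cmod (phi w * (/ (w - z)) ^ 1 - phi w * (/ (w - z')) ^ 1)
                   <= c * psi al gam e1 e2 m (Cmod (w - a))).
      { assert (n1 := Cminus_eq_contra _ _ (Nz w Hw)). assert (n2 := Cminus_eq_contra _ _ (Nz' w Hw)).
        rewrite !Cpow_1_r.
        replace (phi w * / (w - z) - phi w * / (w - z'))%C
          with (phi w * (z - z') * / ((w - z) * (w - z')))%C by (field; split; easy).
        rewrite !Cmod_mult, Cmod_inv, Cmod_mult by now apply Cmult_neq_0.
        specialize (Hphi w Hw). specialize (H1 w Hw). specialize (H2 w Hw).
        set (y := Cmod (w - a)) in *. assert (Hy : 0 <= y) by apply Cmod_ge_0.
        apply Rle_trans with (c * (Om al gam e1 e2 y / ((m + y) * (m + y)))).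
        - assert (P1 : 0 < Cmod (w - z)) by (apply Cmod_gt_0; easy).
          assert (P2 : 0 < Cmod (w - z')) by (apply Cmod_gt_0; easy).
          assert (Hi : / (Cmod (w - z) * Cmod (w - z')) <= kp * kp * / ((m + y) * (m + y))).
          { replace (kp * kp * / ((m + y) * (m + y))) with (/ ((m + y) / kp * ((m + y) / kp))) by (field; split; lra).
            assert (0 < (m + y) / kp) by (apply Rdiv_lt_0_compat; lra).
            apply Rinv_le_contravar; [now apply Rmult_lt_0_compat|].
            apply Rmult_le_compat; try lra.
            - apply Rmult_le_reg_r with kp; [easy|]. replace ((m + y) / kp * kp) with (m + y) by (field; lra). lra.
            - apply Rmult_le_reg_r with kp; [easy|]. replace ((m + y) / kp * kp) with (m + y) by (field; lra). lra. }
          replace (c * (Om al gam e1 e2 y / ((m + y) * (m + y))))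
            with (Om al gam e1 e2 y * Cmod (z - z') * (kp * kp * / ((m + y) * (m + y))))
            by (unfold c; field; lra).
          apply Rmult_le_compat.
          + apply Rmult_le_pos; apply Cmod_ge_0.
          + left. apply Rinv_0_lt_compat. now apply Rmult_lt_0_compat.
          + apply Rmult_le_compat_r; [apply Cmod_ge_0|easy].
          + easy.
        - apply Rmult_le_compat_l; [easy|]. now apply Om_psi. }
      split; (eapply Rle_trans; [apply Hb|]; apply Rmult_le_compat_l; [easy|];
        apply psi_antitone; auto; split; [apply Rabs_pos|]).
      * apply (fst_le_Cmod (w - a)%C).
      * apply (snd_le_Cmod (w - a)%C).
    + unfold scal; simpl; unfold mult; simpl.
      replace (8 / (1 - gam) * (kp * kp) * (Cmod (z - z') * (Om al gam e1 e2 m / m)))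
        with (c * (4 * (2 / (1 - gam) * (Om al gam e1 e2 m / m)))) by (unfold c; field; lra).
      replace (2 * (c * I1) + 2 * (c * I2)) with (c * (2 * I1 + 2 * I2)) by ring.
      apply Rmult_le_compat_l; [easy|]. lra.
  - intros w Hw. apply ccont_kernel; auto.
  - intros w Hw. apply ccont_kernel; auto.
Qed.

(** * The singular part of a function in a small square *)

(** The balls of the sup norm are the squares, so the distance to the boundary of a square has a
    simple formula. *)
Definition nrm (z : C) : R := Rmax (Rabs (fst z)) (Rabs (snd z)).

Lemma nrm_nonneg z : 0 <= nrm z.
Proof. eapply Rle_trans; [apply Rabs_pos|apply Rmax_l]. Qed.

Lemma nrm_le_Cmod z : nrm z <= Cmod z.
Proof. apply Rmax_Cmod. Qed.

Lemma Cmod_le_nrm z : Cmod z <= 2 * nrm z.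
Proof.
  eapply Rle_trans; [apply Cmod_le_sum|]. unfold nrm.
  pose proof (Rmax_l (Rabs (fst z)) (Rabs (snd z))). pose proof (Rmax_r (Rabs (fst z)) (Rabs (snd z))). lra.
Qed.

Lemma nrm_triangle (x y : C) : nrm (x + y) <= nrm x + nrm y.
Proof.
  unfold nrm; cbn [fst snd Cplus].
  pose proof (Rmax_l (Rabs (fst x)) (Rabs (snd x))). pose proof (Rmax_r (Rabs (fst x)) (Rabs (snd x))).
  pose proof (Rmax_l (Rabs (fst y)) (Rabs (snd y))). pose proof (Rmax_r (Rabs (fst y)) (Rabs (snd y))).
  pose proof (Rabs_triang (fst x) (fst y)). pose proof (Rabs_triang (snd x) (snd y)).
  apply Rmax_lub; lra.
Qed.

Lemma nrm_sym (x y : C) : nrm (x - y) = nrm (y - x).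
Proof.
  unfold nrm; cbn [fst snd Cminus Cplus Copp].
  replace (fst x + - fst y) with (- (fst y + - fst x)) by ring.
  replace (snd x + - snd y) with (- (snd y + - snd x)) by ring. now rewrite !Rabs_Ropp.
Qed.

Lemma nrm_minus_le (x y z : C) : nrm (x - z) <= nrm (x - y) + nrm (y - z).
Proof. replace (x - z)%C with ((x - y) + (y - z))%C by ring. apply nrm_triangle. Qed.

Lemma nrm_scal (c : R) (z : C) : nrm (RtoC c * z) = Rabs c * nrm z.
Proof.
  unfold nrm, RtoC, Cmult; cbn [fst snd].
  replace (c * fst z - 0 * snd z) with (c * fst z) by ring. replace (c * snd z + 0 * fst z) with (c * snd z) by ring.
  rewrite !Rabs_mult. apply RmaxRmult. apply Rabs_pos.
Qed.

Section Localize.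
Variables (x0 : C) (s : R) (f : C -> C).
Hypothesis (Hs : 0 < s) (Hfc : forall z, ccont f z).
Let A := fst x0 - s.
Let B := snd x0 - s.
Let D := 2 * s.

Definition nn (z : C) : R := nrm (z - x0).

Lemma nn_on z : on_sq A B D z <-> nn z = s.
Proof.
  unfold on_sq, nn, nrm, A, B, D; cbn [fst snd Cminus Cplus Copp]. split.
  - intros H. unfold Rmax, Rabs. repeat destruct Rcase_abs; destruct Rle_dec; lra.
  - unfold Rmax, Rabs. repeat destruct Rcase_abs; destruct Rle_dec; lra.
Qed.

Lemma nn_int z : int_sq A B D z <-> nn z < s.
Proof.
  unfold int_sq, nn, nrm, A, B, D; cbn [fst snd Cminus Cplus Copp]. split.
  - intros H. apply Rmax_lub_lt; apply Rabs_def1; lra.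
  - intros H. apply Rmax_Rlt in H. destruct H as [H1 H2]. apply Rabs_def2 in H1. apply Rabs_def2 in H2. lra.
Qed.

Lemma nn_in z : in_sq A B D z <-> nn z <= s.
Proof.
  split.
  - intros H. apply in_sq_cases in H. destruct H as [H|H]; [apply nn_on in H|apply nn_int in H]; lra.
  - intros [H|H]; [apply nn_int in H; now apply int_sq_in|apply nn_on in H; apply on_sq_in; [unfold D; lra|easy]].
Qed.

Lemma nn_lip z w : Rabs (nn z - nn w) <= nrm (z - w).
Proof.
  apply Rabs_le. pose proof (nrm_minus_le z w x0). pose proof (nrm_minus_le w z x0).
  rewrite (nrm_sym w z) in H0. unfold nn. lra.
Qed.

(** On the boundary of the square the integrand is singular and the value carries no meaning; the
    estimates concern only points off it. *)
Definition u0 (z : C) : C :=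
  ((if Rlt_dec (nn z) s then f z else 0) - / C2pi * CK f A B D 1 z)%C.

Definition dd (z : C) : R := Rabs (nn z - s).

Lemma dd_pos z : nn z <> s -> 0 < dd z.
Proof. intros H. apply Rabs_pos_lt. lra. Qed.

Lemma dd_le w z : nn w = s -> dd z <= nrm (w - z).
Proof. intros H. unfold dd. rewrite <- H, Rabs_minus_sym. apply nn_lip. Qed.

(** The Cauchy integral of the constant [f a] is [f a] inside and 0 outside. The constant can
    therefore be subtracted on both sides, which makes the density vanish at [a]. *)
Lemma u0_base (a z : C) : nn z <> s ->
  u0 z = ((if Rlt_dec (nn z) s then f z - f a else 0) - / C2pi * CK (fun w => f w - f a) A B D 1 z)%C.
Proof.
  intros Hz. assert (HD : 0 < D) by (unfold D; lra).
  assert (Hn : forall w, on_sq A B D w -> w <> z) by (intros w Hw ->; apply nn_on in Hw; easy).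
  assert (E : CK (fun w => f w - f a)%C A B D 1 z = (CK f A B D 1 z - f a * SI (fun w => / (w - z)) A B D)%C).
  { unfold CK. rewrite <- SI_scal; [|lra|].
    - rewrite <- SI_minus; [|lra| |].
      + apply SI_ext; [lra|]. intros w Hw. rewrite Cpow_1_r. ring.
      + intros w Hw. apply ccont_kernel; auto.
      + intros w Hw. apply ccont_mult; [apply ccont_const|].
        apply ccont_inv_sub; auto.
    - intros w Hw. apply ccont_inv_sub; auto. }
  rewrite E. unfold u0. destruct Rlt_dec as [H|H].
  - rewrite SI_inv by now apply nn_int. field. apply C2pi_neq0.
  - rewrite (goursat (fun w => / (w - z))%C); [field; apply C2pi_neq0|easy|].
    intros w Hw. apply cdiffable_inv_sub. intros ->. apply nn_in in Hw. lra.
Qed.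

(** A radial move from the boundary point [a], always outward: there the height [tau] has no upper
    limit, and chains may be as long as required. *)
Definition pt (a : C) (tau : R) : C := (x0 + RtoC (1 + tau / s) * (a - x0))%C.

Lemma pt_nn a tau : nn a = s -> 0 <= tau -> nn (pt a tau) = s + tau.
Proof.
  intros Ha Ht. unfold nn, pt.
  replace (x0 + RtoC (1 + tau / s) * (a - x0) - x0)%C with (RtoC (1 + tau / s) * (a - x0))%C by ring.
  rewrite nrm_scal. fold (nn a). rewrite Ha, Rabs_pos_eq.
  - field. lra.
  - assert (0 <= tau / s) by (apply Rmult_le_pos; [easy|left; now apply Rinv_0_lt_compat]). lra.
Qed.

Lemma pt_dist a tau tau' : nn a = s -> nrm (pt a tau - pt a tau') = Rabs (tau - tau').
Proof.
  intros Ha. unfold pt.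
  replace (x0 + RtoC (1 + tau / s) * (a - x0) - (x0 + RtoC (1 + tau' / s) * (a - x0)))%C
    with (RtoC ((tau - tau') / s) * (a - x0))%C.
  - rewrite nrm_scal. fold (nn a). rewrite Ha. unfold Rdiv. rewrite Rabs_mult, (Rabs_pos_eq (/ s)).
    + field. lra.
    + left; now apply Rinv_0_lt_compat.
  - replace ((tau - tau') / s) with ((1 + tau / s) - (1 + tau' / s)) by (field; lra).
    rewrite (RtoC_minus (1 + tau / s)). ring.
Qed.

Lemma pt_0 a : pt a 0 = a.
Proof. unfold pt. replace (1 + 0 / s) with 1 by (field; lra). ring. Qed.

Lemma pt_dist_a a tau : nn a = s -> 0 <= tau -> nrm (pt a tau - a) = tau.
Proof.
  intros Ha Ht. rewrite <- (pt_0 a) at 2. rewrite pt_dist by easy. rewrite Rabs_pos_eq; lra.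
Qed.

Lemma pt_dd a tau : nn a = s -> 0 <= tau -> dd (pt a tau) = tau.
Proof. intros Ha Ht. unfold dd. rewrite pt_nn by easy. rewrite Rabs_pos_eq; lra. Qed.

Lemma proj_ex z : exists a, nn a = s /\ nrm (z - a) = dd z.
Proof.
  destruct (Req_dec (nn z) 0) as [H0|H0].
  - exists (x0 + RtoC s)%C.
    assert (Ha : nn (x0 + RtoC s)%C = s).
    { unfold nn. replace (x0 + RtoC s - x0)%C with (RtoC s * 1)%C by ring. rewrite nrm_scal.
      unfold nrm, RtoC; cbn [fst snd]. rewrite Rabs_R1, Rabs_R0, Rmax_left, Rabs_pos_eq; lra. }
    split; [easy|]. apply Rle_antisym.
    + eapply Rle_trans; [apply (nrm_minus_le z x0)|]. fold (nn z). rewrite H0, (nrm_sym x0).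
      fold (nn (x0 + RtoC s)%C). rewrite Ha. unfold dd. rewrite H0. rewrite Rabs_left; lra.
    + rewrite nrm_sym. now apply dd_le.
  - assert (Hp : 0 < nn z) by (pose proof (nrm_nonneg (z - x0)%C); unfold nn in *; lra).
    exists (x0 + RtoC (s / nn z) * (z - x0))%C. split.
    + unfold nn at 1. replace (x0 + RtoC (s / nn z) * (z - x0) - x0)%C with (RtoC (s / nn z) * (z - x0))%C by ring.
      rewrite nrm_scal. fold (nn z). rewrite Rabs_pos_eq; [field; lra|]. left; now apply Rdiv_lt_0_compat.
    + replace (z - (x0 + RtoC (s / nn z) * (z - x0)))%C with (RtoC (1 - s / nn z) * (z - x0))%C.
      * rewrite nrm_scal. fold (nn z). unfold dd. replace (nn z - s) with ((1 - s / nn z) * nn z) by (field; lra).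
        rewrite Rabs_mult, (Rabs_pos_eq (nn z)); lra.
      * rewrite RtoC_minus. ring.
Qed.

(** * Hardy-Littlewood estimates for the singular part *)

Section WithModulus.
Variables (al gam e1 e2 : R).
Hypothesis (Hal : 0 < al < gam) (Hgam : gam < 1) (He1 : 0 <= e1) (He2 : 0 <= e2).
Notation O := (Om al gam e1 e2).
Hypothesis (Hmod : forall z w, nn z <= s -> nn w <= s -> Cmod (f z - f w) <= O (Cmod (z - w))).

(** The 13 comes from [CK_hop]: for [w] on the boundary and D the sup distance from w to y, m <= D
    and |w - a| <= 2 (D + 5m), so m + |w - a| <= 13 D. *)
Definition K0 := 8 / (1 - gam) * (13 * 13).

Lemma K0_pos : 0 < K0.
Proof using Hgam. unfold K0. assert (0 < / (1 - gam)) by (apply Rinv_0_lt_compat; lra). unfold Rdiv. nra. Qed.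

Lemma O_nonneg t : 0 <= O t.
Proof using He1 He2. now apply Om_nonneg. Qed.

Lemma CK_hop a z z' m : nn a = s -> 0 < m -> m <= dd z -> m <= dd z' ->
  nrm (z - a) <= 5 * m -> nrm (z' - a) <= 5 * m ->
  Cmod (CK (fun w => f w - f a) A B D 1 z - CK (fun w => f w - f a) A B D 1 z')%C
    <= K0 * (Cmod (z - z') * (O m / m)).
Proof.
  intros Ha Hm Hz Hz' Hza Hza'.
  assert (Hfar : forall y, m <= dd y -> nrm (y - a) <= 5 * m ->
     ~ on_sq A B D y /\ forall w, on_sq A B D w -> m + Cmod (w - a) <= 13 * Cmod (w - y)).
  { intros y Hy Hya. split.
    - intros Hon. apply nn_on in Hon. unfold dd in Hy. rewrite Hon, Rminus_diag, Rabs_R0 in Hy. lra.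
    - intros w Hw. apply nn_on in Hw. pose proof (dd_le w y Hw). pose proof (Cmod_le_nrm (w - a)%C).
      pose proof (nrm_minus_le w y a). pose proof (nrm_le_Cmod (w - y)%C). lra. }
  destruct (Hfar z Hz Hza) as [F1 F2]. destruct (Hfar z' Hz' Hza') as [F3 F4].
  apply (CK_difference_bound al gam e1 e2 _ A B D a z z' m 13); auto; try lra.
  - unfold D; lra.
  - intros w Hw. apply ccont_minus; [auto|apply ccont_const].
  - now apply nn_on.
  - intros w Hw. apply nn_on in Hw. apply Hmod; lra.
Qed.

Lemma two_pi_ge1 : 1 <= 2 * PI.
Proof. pose proof PI2_1. lra. Qed.

Lemma inv_C2pi_le z : Cmod (/ C2pi * z) <= Cmod z.
Proof.
  rewrite Cmod_mult, Cmod_inv, Cmod_C2pi by apply C2pi_neq0.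
  pose proof two_pi_ge1. pose proof (Cmod_ge_0 z).
  assert (/ (2 * PI) <= 1) by (rewrite <- Rinv_1; apply Rinv_le_contravar; lra).
  rewrite <- (Rmult_1_l (Cmod z)) at 2. apply Rmult_le_compat_r; easy.
Qed.

(** Two differences from [f a] cost 10 each, and the points of a hop are at most [20 * m] apart. *)
Definition K1 := 20 + 20 * K0.

(** The points may lie on opposite sides of the boundary: with base point [a] the inner term
    [f z - f a] is as small as the hop allows, so its disappearance outside does no harm. *)
Lemma u0_hop a z z' m : nn a = s -> 0 < m -> m <= dd z -> m <= dd z' ->
  nrm (z - a) <= 5 * m -> nrm (z' - a) <= 5 * m ->
  Cmod (u0 z - u0 z') <= K1 * O m.
Proof.
  intros Ha Hm Hz Hz' Hza Hza'.
  assert (Hn : forall y, m <= dd y -> nn y <> s).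
  { intros y Hy E. unfold dd in Hy. rewrite E, Rminus_diag, Rabs_R0 in Hy. lra. }
  rewrite (u0_base a z), (u0_base a z') by auto.
  assert (Hin : forall y, nrm (y - a) <= 5 * m -> Cmod (if Rlt_dec (nn y) s then f y - f a else 0) <= 10 * O m).
  { intros y Hy. pose proof (O_nonneg m). destruct Rlt_dec as [H'|H']; [|rewrite Cmod_0; lra].
    eapply Rle_trans; [apply Hmod; lra|]. apply Om_le_scale; auto; try lra.
    split; [apply Cmod_ge_0|]. pose proof (Cmod_le_nrm (y - a)%C). lra. }
  set (X := (if Rlt_dec (nn z) s then f z - f a else 0)%C).
  set (X' := (if Rlt_dec (nn z') s then f z' - f a else 0)%C).
  set (Y := CK (fun w => f w - f a)%C A B D 1 z). set (Y' := CK (fun w => f w - f a)%C A B D 1 z').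
  replace (X - / C2pi * Y - (X' - / C2pi * Y'))%C with ((X - X') - / C2pi * (Y - Y'))%C by ring.
  eapply Rle_trans; [apply Cmod_minus_triangle|].
  pose proof (Cmod_minus_triangle X X'). pose proof (inv_C2pi_le (Y - Y')%C).
  pose proof (Hin z Hza). pose proof (Hin z' Hza'). fold X in H1. fold X' in H2.
  pose proof (CK_hop a z z' m Ha Hm Hz Hz' Hza Hza') as HY. fold Y Y' in HY.
  assert (Hd : Cmod (z - z') <= 20 * m).
  { pose proof (Cmod_le_nrm (z - z')%C). pose proof (nrm_minus_le z a z'). rewrite (nrm_sym a z') in H4. lra. }
  assert (HY2 : K0 * (Cmod (z - z') * (O m / m)) <= 20 * K0 * O m).
  { replace (20 * K0 * O m) with (K0 * (20 * m * (O m / m))) by (field; lra).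
    pose proof K0_pos. pose proof (O_nonneg m).
    apply Rmult_le_compat_l; [lra|]. apply Rmult_le_compat_r; [|easy].
    apply Rmult_le_pos; [easy|left; now apply Rinv_0_lt_compat]. }
  unfold K1. lra.
Qed.

(** On one side of the boundary the values [f a] cancel, and the bound improves with |z - z'|
    instead of staying at the size of the hop. *)
Lemma u0_hop_near a z z' m : nn a = s -> 0 < m -> m <= dd z -> m <= dd z' ->
  nrm (z - a) <= 5 * m -> nrm (z' - a) <= 5 * m -> (nn z < s <-> nn z' < s) ->
  Cmod (u0 z - u0 z') <= O (Cmod (z - z')) + K0 * (Cmod (z - z') * (O m / m)).
Proof.
  intros Ha Hm Hz Hz' Hza Hza' Hside.
  assert (Hn : forall y, m <= dd y -> nn y <> s).
  { intros y Hy E. unfold dd in Hy. rewrite E, Rminus_diag, Rabs_R0 in Hy. lra. }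
  rewrite (u0_base a z), (u0_base a z') by auto.
  set (X := (if Rlt_dec (nn z) s then f z - f a else 0)%C).
  set (X' := (if Rlt_dec (nn z') s then f z' - f a else 0)%C).
  set (Y := CK (fun w => f w - f a)%C A B D 1 z). set (Y' := CK (fun w => f w - f a)%C A B D 1 z').
  replace (X - / C2pi * Y - (X' - / C2pi * Y'))%C with ((X - X') - / C2pi * (Y - Y'))%C by ring.
  eapply Rle_trans; [apply Cmod_minus_triangle|].
  pose proof (inv_C2pi_le (Y - Y')%C).
  pose proof (CK_hop a z z' m Ha Hm Hz Hz' Hza Hza') as HY. fold Y Y' in HY.
  assert (HX : Cmod (X - X') <= O (Cmod (z - z'))).
  { unfold X, X'. destruct Rlt_dec as [H1|H1], Rlt_dec as [H2|H2]; try tauto.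
    - replace (f z - f a - (f z' - f a))%C with (f z - f z')%C by ring. apply Hmod; lra.
    - rewrite Cmod_diag. apply O_nonneg. }
  lra.
Qed.

(** Solves [K2 + K1 = K2 * Rpower 2 al], the equation that closes the induction along a chain. *)
Definition K2 := K1 / (Rpower 2 al - 1).

Lemma two_al : 1 < Rpower 2 al.
Proof using Hal. rewrite <- (Rpower_O 2) by lra. apply Rpower_lt; lra. Qed.

Lemma K1_pos : 0 < K1.
Proof using Hal Hgam. unfold K1. pose proof K0_pos. lra. Qed.

Lemma K2_pos : 0 < K2.
Proof using Hal Hgam. unfold K2. pose proof two_al. pose proof K1_pos. apply Rdiv_lt_0_compat; lra. Qed.

(* Hardy-Littlewood chain: the hops double the distance to the boundary, so their costs form a geometric series. *)
Lemma u0_chain a tau : nn a = s -> 0 < tau -> forall J,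
  Cmod (u0 (pt a tau) - u0 (pt a (2 ^ J * tau))) <= K2 * O (2 ^ J * tau).
Proof.
  intros Ha Ht J. pose proof two_al as H2. pose proof K2_pos as HK2. pose proof K1_pos as HK1.
  induction J as [|J IH].
  - simpl. rewrite Rmult_1_l, Cmod_diag. apply Rmult_le_pos; [lra|apply O_nonneg].
  - set (m := 2 ^ J * tau) in *.
    assert (Hm : 0 < m) by (apply Rmult_lt_0_compat; [apply pow_lt; lra|easy]).
    replace (2 ^ S J * tau) with (2 * m) by (unfold m; simpl; ring).
    eapply Rle_trans; [apply (Cmod_minus_le _ (u0 (pt a m)))|].
    assert (Hh : Cmod (u0 (pt a m) - u0 (pt a (2 * m))) <= K1 * O m).
    { apply (u0_hop a); auto; rewrite ?pt_dd, ?pt_dist_a by (auto; lra); lra. }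
    pose proof (Om_double al gam e1 e2 Hal He2 m Hm) as HD2.
    assert (E : (K2 + K1) * O m = K2 * (Rpower 2 al * O m)) by (unfold K2; field; lra).
    apply (Rmult_le_compat_l K2) in HD2; lra.
Qed.

Definition K3 := 2 * K1 + 4 * K2.

(** A first hop leads from [z] to the point outside at the same distance from the boundary, across
    it if necessary; a chain then climbs to a height comparable to [dl]. *)
Lemma u0_approach z dl : nn z <> s -> 0 < dl -> dd z < 2 * dl ->
  exists a tau, nn a = s /\ nrm (z - a) = dd z /\ 2 * dl <= tau <= 4 * dl /\
    Cmod (u0 z - u0 (pt a tau)) <= K3 * O dl.
Proof.
  intros Hz Hdl Hd. destruct (proj_ex z) as [a [Ha Hza]].
  assert (Hp := dd_pos z Hz). set (d := dd z) in *.
  (* Halving the inverses is doubling the heights: the result is a [J] with 2 dl <= 2^J d < 4 dl. *)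
  destruct (dyadic_scale (/ d) (/ (2 * dl))) as [J [HJ1 HJ2]].
  { split; [apply Rinv_0_lt_compat; lra|]. apply Rinv_le_contravar; lra. }
  assert (HpJ : 0 < 2 ^ J) by (apply pow_lt; lra).
  exists a, (2 ^ J * d). split; [easy|split; [easy|split]].
  - replace (/ d / 2 ^ J) with (/ (2 ^ J * d)) in HJ1, HJ2 by (field; lra).
    assert (Hq : 0 < 2 ^ J * d) by now apply Rmult_lt_0_compat.
    split.
    + rewrite <- (Rinv_inv (2 * dl)), <- (Rinv_inv (2 ^ J * d)). apply Rinv_le_contravar; [now apply Rinv_0_lt_compat|easy].
    + rewrite <- (Rinv_inv (4 * dl)), <- (Rinv_inv (2 ^ J * d)). apply Rinv_le_contravar; [apply Rinv_0_lt_compat; lra|].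
      replace (/ (4 * dl)) with (/ (2 * dl) / 2) by (field; lra). lra.
  - assert (Hq4 : 2 ^ J * d <= 4 * dl).
    { replace (/ d / 2 ^ J) with (/ (2 ^ J * d)) in HJ1, HJ2 by (field; lra).
      rewrite <- (Rinv_inv (4 * dl)), <- (Rinv_inv (2 ^ J * d)). apply Rinv_le_contravar; [apply Rinv_0_lt_compat; lra|].
      replace (/ (4 * dl)) with (/ (2 * dl) / 2) by (field; lra). lra. }
    eapply Rle_trans; [apply (Cmod_minus_le _ (u0 (pt a d)))|].
    assert (H1 : Cmod (u0 z - u0 (pt a d)) <= K1 * O d).
    { apply (u0_hop a); auto; rewrite ?pt_dd, ?pt_dist_a by (auto; lra); try lra. fold d; lra. }
    pose proof (u0_chain a d Ha Hp J) as H2.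
    assert (O1 : O d <= 2 * O dl) by (apply Om_le_scale; auto; lra).
    assert (O2 : O (2 ^ J * d) <= 4 * O dl).
    { apply Om_le_scale; auto; try lra. split; [|easy]. apply Rmult_le_pos; lra. }
    pose proof K1_pos. pose proof K2_pos.
    apply (Rmult_le_compat_l K1) in O1; [|lra]. apply (Rmult_le_compat_l K2) in O2; [|lra].
    unfold K3. lra.
Qed.

Definition K4 := 1 + 2 * K0 + 2 * K3 + 2 * K1.

Lemma K4_pos : 0 < K4.
Proof using Hal Hgam. unfold K4, K3. pose proof K0_pos. pose proof K1_pos. pose proof K2_pos. lra. Qed.

(** The points are close together compared with their distance to the boundary, so one hop at scale
    [m = dd z / 2] suffices; since [Om m / m] decreases in [m], the scale may then be lowered to the
    distance of the points. *)
Lemma u0_modulus_far z z' : nn z <> s -> nn z' <> s -> z <> z' -> 2 * nrm (z - z') <= dd z ->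
  Cmod (u0 z - u0 z') <= (1 + 2 * K0) * O (Cmod (z - z')).
Proof.
  intros Hz Hz' Hzz Hfar. set (dl := nrm (z - z')) in *.
  assert (Hc := Cmod_pos_sub _ _ Hzz).
  assert (Hc2 : Cmod (z - z') <= 2 * dl) by apply Cmod_le_nrm.
  assert (Hc1 : dl <= Cmod (z - z')) by apply nrm_le_Cmod.
  assert (Hdl : 0 < dl) by lra.
  destruct (proj_ex z) as [a [Ha Hza]].
  assert (Hn : Rabs (nn z - nn z') <= dl) by apply nn_lip.
  set (m := dd z / 2).
  assert (Hd' : m <= dd z').
  { unfold m. assert (Q : dd z <= dd z' + dl).
    { unfold dd. replace (nn z - s) with ((nn z' - s) + (nn z - nn z')) by ring.
      eapply Rle_trans; [apply Rabs_triang|]. lra. }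
    lra. }
  assert (Hm : dl <= m) by (unfold m; lra).
  eapply Rle_trans; [apply (u0_hop_near a z z' m)|]; auto; try lra; try (unfold m in *; lra).
  - pose proof (nrm_minus_le z' z a). rewrite (nrm_sym z' z) in H. fold dl in H. unfold m in *; lra.
  - apply Rabs_le_between in Hn. unfold dd in *. revert Hfar Hz Hz'. unfold Rabs. destruct Rcase_abs; intros; split; intros; lra.
  - assert (Hr : O m / m <= O dl / dl).
    { assert (O m <= m / dl * O dl).
      { replace m with (m / dl * dl) at 1 by (field; lra). apply Om_scale; auto; [|lra].
        apply Rmult_le_reg_r with dl; [easy|]. replace (m / dl * dl) with m by (field; lra). lra. }
      apply Rmult_le_reg_r with m; [lra|]. replace (O m / m * m) with (O m) by (field; lra).
      replace (O dl / dl * m) with (m / dl * O dl) by (field; lra). easy. }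
    assert (Hr2 : Cmod (z - z') * (O m / m) <= 2 * O dl).
    { apply Rle_trans with (2 * dl * (O dl / dl)); [|right; field; lra].
      apply Rmult_le_compat; try lra.
      apply Rmult_le_pos; [apply O_nonneg|left; apply Rinv_0_lt_compat; lra]. }
    assert (Hmn : O dl <= O (Cmod (z - z'))) by (apply Om_mono; auto; lra).
    pose proof K0_pos. apply (Rmult_le_compat_l K0) in Hr2; [|lra].
    apply (Rmult_le_compat_l (2 * K0)) in Hmn; [|lra]. lra.
Qed.

(** If both points are near the boundary compared with their distance [dl], each climbs to a height
    between 2 dl and 4 dl, and one hop joins the tops. *)
Lemma u0_modulus z z' : nn z <> s -> nn z' <> s -> Cmod (u0 z - u0 z') <= K4 * O (Cmod (z - z')).
Proof.
  intros Hz Hz'. destruct (Ceq_dec z z') as [->|Hzz].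
  { rewrite Cmod_diag. apply Rmult_le_pos; [left; apply K4_pos|apply O_nonneg]. }
  pose proof K0_pos. pose proof K1_pos. pose proof K2_pos. pose proof (O_nonneg (Cmod (z - z'))) as HO.
  assert (HK3 : 0 < K3) by (unfold K3; lra).
  destruct (Rle_dec (2 * nrm (z - z')) (dd z)) as [C1|C1].
  { eapply Rle_trans; [apply u0_modulus_far; auto|]. apply Rmult_le_compat_r; [easy|]. unfold K4; lra. }
  destruct (Rle_dec (2 * nrm (z - z')) (dd z')) as [C2|C2].
  { rewrite Cmod_minus_sym, (Cmod_minus_sym z z').
    eapply Rle_trans; [apply u0_modulus_far; auto; rewrite nrm_sym; lra|].
    rewrite (Cmod_minus_sym z' z). apply Rmult_le_compat_r; [easy|]. unfold K4; lra. }
  set (dl := nrm (z - z')) in *.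
  assert (Hdl : 0 < dl) by (pose proof (Cmod_pos_sub _ _ Hzz); pose proof (Cmod_le_nrm (z - z')%C); fold dl in H3; lra).
  assert (Hmn : O dl <= O (Cmod (z - z'))) by (apply Om_mono; auto; pose proof (nrm_le_Cmod (z - z')%C); fold dl in H2; lra).
  destruct (u0_approach z dl Hz Hdl) as [a [ta [Ha [Hza [Hta Hua]]]]]; [lra|].
  destruct (u0_approach z' dl Hz' Hdl) as [b [tb [Hb [Hzb [Htb Hub]]]]]; [lra|].
  (* The second top lies within 4 + 2 + 1 + 2 = 9 times [dl] of [a], inside the reach [5 * m] of a
     hop with [m = 2 * dl]. *)
  assert (Hhop : Cmod (u0 (pt a ta) - u0 (pt b tb)) <= K1 * O (2 * dl)).
  { apply (u0_hop a); auto; try (rewrite ?pt_dd, ?pt_dist_a by (auto; lra); lra).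
    pose proof (nrm_minus_le (pt b tb) b a). rewrite (pt_dist_a b) in H2 by (auto; lra).
    pose proof (nrm_minus_le b z' a). pose proof (nrm_minus_le z' z a).
    rewrite (nrm_sym b z') in H3. rewrite (nrm_sym z' z) in H4. fold dl in H4. lra. }
  assert (Ht : Cmod (u0 z - u0 z') <= K3 * O dl + (K1 * O (2 * dl) + K3 * O dl)).
  { eapply Rle_trans; [apply (Cmod_minus_le _ (u0 (pt a ta)))|]. apply Rplus_le_compat; [easy|].
    eapply Rle_trans; [apply (Cmod_minus_le _ (u0 (pt b tb)))|]. apply Rplus_le_compat; [easy|].
    rewrite Cmod_minus_sym. easy. }
  assert (O2 : O (2 * dl) <= 2 * O dl) by (apply Om_scale; auto; lra).
  apply (Rmult_le_compat_l K1) in O2; [|lra].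
  apply Rle_trans with ((2 * K3 + 2 * K1) * O dl); [lra|].
  apply Rmult_le_compat; try lra; [apply O_nonneg|unfold K4; lra].
Qed.

Definition K5 := 8 * K4 + 32.

(** Where [nn] is at least [2 * s] the Cauchy integral is estimated directly, which gives the 32.
    Any other point is within [8 * s] of the outside point [pt a s], and the modulus does the
    rest. *)
Lemma u0_bound z : nn z <> s -> Cmod (u0 z) <= K5 * O s.
Proof.
  intros Hz. pose proof K4_pos as HK4. pose proof (O_nonneg s) as HO.
  set (a := (x0 + RtoC s)%C).
  assert (Ha : nn a = s).
  { unfold nn, a. replace (x0 + RtoC s - x0)%C with (RtoC s * 1)%C by ring. rewrite nrm_scal.
    unfold nrm, RtoC; cbn [fst snd]. rewrite Rabs_R1, Rabs_R0, Rmax_left, Rabs_pos_eq; lra. }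
  assert (Hout : forall y, 2 * s <= nn y -> Cmod (u0 y) <= 32 * O s).
  { intros y Hy. rewrite (u0_base a y) by lra. destruct Rlt_dec as [H|_]; [lra|].
    set (Y := CK (fun w => f w - f a)%C A B D 1 y).
    replace (0 - / C2pi * Y)%C with (- (/ C2pi * Y))%C by ring. rewrite Cmod_opp.
    eapply Rle_trans; [apply inv_C2pi_le|].
    apply Rle_trans with (4 * D * (4 * O s * / s)); [|right; unfold D; field; lra].
    assert (Hd : forall w, on_sq A B D w -> s <= Cmod (w - y)).
    { intros w Hw. apply nn_on in Hw. pose proof (dd_le w y Hw). unfold dd in H. rewrite Rabs_pos_eq in H by lra.
      pose proof (nrm_le_Cmod (w - y)%C). lra. }
    assert (Hn : forall w, on_sq A B D w -> w <> y).
    { intros w Hw ->. specialize (Hd y Hw). rewrite Cmod_diag in Hd. lra. }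
    apply SI_norm_le; [unfold D; lra| |].
    - intros w Hw. apply ccont_kernel; auto. apply ccont_minus; [auto|apply ccont_const].
    - intros w Hw. rewrite Cpow_1_r, Cmod_mult, Cmod_inv by (apply Cminus_eq_contra; auto).
      apply Rmult_le_compat; try apply Cmod_ge_0.
      + left. apply Rinv_0_lt_compat. specialize (Hd w Hw). lra.
      + apply nn_on in Hw. eapply Rle_trans; [apply Hmod; lra|]. apply Om_le_scale; auto; try lra.
        split; [apply Cmod_ge_0|]. pose proof (Cmod_le_nrm (w - a)%C). pose proof (nrm_minus_le w x0 a).
        rewrite (nrm_sym x0 a) in H0. fold (nn w) (nn a) in H0. lra.
      + apply Rinv_le_contravar; auto. }
  unfold K5. destruct (Rle_dec (2 * s) (nn z)) as [C1|C1].
  { eapply Rle_trans; [apply Hout, C1|]. apply Rmult_le_compat_r; lra. }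
  pose proof (pt_nn a s Ha ltac:(lra)) as Hp.
  pose proof (Hout (pt a s) ltac:(lra)) as H1.
  pose proof (u0_modulus z (pt a s) Hz ltac:(lra)) as H2.
  assert (H3 : O (Cmod (z - pt a s)) <= 8 * O s).
  { apply Om_le_scale; auto; try lra. split; [apply Cmod_ge_0|].
    pose proof (Cmod_le_nrm (z - pt a s)%C). pose proof (nrm_minus_le z x0 (pt a s)).
    rewrite (nrm_sym x0 (pt a s)) in H0. fold (nn z) (nn (pt a s)) in H0. lra. }
  apply (Rmult_le_compat_l K4) in H3; [|lra].
  pose proof (Cmod_sub_le (u0 z) (u0 (pt a s))). lra.
Qed.
End WithModulus.
End Localize.

(** * Density of the functions analytic near the base point *)

Lemma rpow_small a e : 0 < a -> 0 < e -> exists d, 0 < d /\ forall t, 0 <= t <= d -> rpow t a <= e.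
Proof.
  intros Ha He. exists (Rpower e (/ a)). split; [apply Rpower_gt_0|].
  intros t Ht. eapply Rle_trans; [apply (rpow_mono t (Rpower e (/ a))); lra|].
  rewrite rpow_pos by apply Rpower_gt_0. rewrite Rpower_mult, Rinv_l, Rpower_1; lra.
Qed.

Lemma Om_small al gam e1 e2 e : 0 < al < gam -> 0 <= e1 -> 0 <= e2 -> 0 < e ->
  exists d, 0 < d /\ forall t, 0 <= t <= d -> Om al gam e1 e2 t <= e.
Proof.
  intros Hal He1 He2 He.
  destruct (rpow_small al (e / (2 * (e1 + 1)))) as [d1 [D1 H1]]; [lra|apply Rdiv_lt_0_compat; lra|].
  destruct (rpow_small gam (e / (2 * (e2 + 1)))) as [d2 [D2 H2]]; [lra|apply Rdiv_lt_0_compat; lra|].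
  exists (Rmin d1 d2). split; [now apply Rmin_pos|]. intros t Ht.
  pose proof (Rmin_l d1 d2). pose proof (Rmin_r d1 d2).
  specialize (H1 t ltac:(lra)). specialize (H2 t ltac:(lra)). unfold Om.
  assert (K : forall c r, 0 <= c -> 0 <= r -> r <= e / (2 * (c + 1)) -> c * r <= e / 2).
  { intros c r Hc Hr Hle. apply Rle_trans with ((c + 1) * (e / (2 * (c + 1)))).
    - apply Rmult_le_compat; lra.
    - right; field; lra. }
  pose proof (K e1 _ He1 (rpow_nonneg t al) H1). pose proof (K e2 _ He2 (rpow_nonneg t gam) H2). lra.
Qed.

Lemma C_complete (v : nat -> C) :
  (forall e, 0 < e -> exists n0, forall n k, (n >= n0)%nat -> (k >= n0)%nat -> Cmod (v n - v k) < e) ->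
  exists L, forall e, 0 < e -> exists n0, forall n, (n >= n0)%nat -> Cmod (v n - L) < e.
Proof.
  intros H.
  destruct (Rcomplete.R_complete (fun n => fst (v n))) as [l1 H1].
  { intros e He. destruct (H e He) as [n0 Hn]. exists n0. intros n k Hn1 Hk1.
    eapply Rle_lt_trans; [apply (fst_le_Cmod (v n - v k)%C)|auto]. }
  destruct (Rcomplete.R_complete (fun n => snd (v n))) as [l2 H2].
  { intros e He. destruct (H e He) as [n0 Hn]. exists n0. intros n k Hn1 Hk1.
    eapply Rle_lt_trans; [apply (snd_le_Cmod (v n - v k)%C)|auto]. }
  exists (l1, l2). intros e He.
  destruct (H1 (e/2)) as [n1 N1]; [lra|]. destruct (H2 (e/2)) as [n2 N2]; [lra|].
  exists (max n1 n2). intros n Hn. specialize (N1 n ltac:(lia)). specialize (N2 n ltac:(lia)).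
  unfold Rdist in *. eapply Rle_lt_trans; [apply Cmod_le_sum|].
  cbn [fst snd Cminus Cplus Copp]. unfold Rminus in *. lra.
Qed.

(** * Extension to the boundary of the square *)

Section Extend.
Variables (x0 : C) (s : R).
Hypothesis (Hs : 0 < s).

Definition off (z : C) (tau : R) : C := if Req_dec_T (nn x0 z) s then pt x0 s z tau else z.

Lemma off_nn z tau : 0 < tau -> nn x0 (off z tau) <> s.
Proof.
  intros Ht. unfold off. destruct Req_dec_T as [H|H]; [|easy]. rewrite pt_nn by (auto; lra). lra.
Qed.

Lemma off_dist z tau : 0 < tau -> Cmod (off z tau - z) <= 2 * tau.
Proof.
  intros Ht. unfold off. destruct Req_dec_T as [H|H].
  - eapply Rle_trans; [apply Cmod_le_nrm|]. rewrite pt_dist_a by (auto; lra). lra.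
  - rewrite Cmod_diag. lra.
Qed.

(** [u] is the limit of [v] along outward shifts. Points off the boundary are not shifted, so there
    [u] equals [v]. *)
Definition ext_of (v u : C -> C) : Prop :=
  forall z e, 0 < e -> exists d, 0 < d /\ forall tau, 0 < tau < d -> Cmod (v (off z tau) - u z) < e.

Lemma ext_exists v c al gam e1 e2 : 0 < al < gam -> 0 <= e1 -> 0 <= e2 -> 0 < c ->
  (forall z z', nn x0 z <> s -> nn x0 z' <> s -> Cmod (v z - v z') <= c * Om al gam e1 e2 (Cmod (z - z'))) ->
  exists u, ext_of v u.
Proof.
  intros Hal He1 He2 Hc Hv.
  assert (Hsm : forall z e, 0 < e -> exists d, 0 < d /\ forall ta tb, 0 < ta < d -> 0 < tb < d ->
      Cmod (v (off z ta) - v (off z tb)) < e).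
  { intros z e He.
    destruct (Om_small al gam e1 e2 (e / (2 * c)) Hal He1 He2) as [d [Hd H]]; [apply Rdiv_lt_0_compat; lra|].
    exists (d / 4). split; [lra|]. intros ta tb Ha Hb.
    eapply Rle_lt_trans; [apply Hv; apply off_nn; lra|].
    apply Rle_lt_trans with (c * (e / (2 * c))); [|replace (c * (e / (2 * c))) with (e / 2) by (field; lra); lra].
    apply Rmult_le_compat_l; [lra|]. apply H. split; [apply Cmod_ge_0|].
    pose proof (Cmod_minus_le (off z ta) z (off z tb)). rewrite (Cmod_minus_sym z) in H0.
    pose proof (off_dist z ta ltac:(lra)). pose proof (off_dist z tb ltac:(lra)). lra. }
  assert (Hex : forall z, exists L, forall e, 0 < e -> exists d, 0 < d /\ forall tau, 0 < tau < d ->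
      Cmod (v (off z tau) - L) < e).
  { intros z.
    assert (Hinv : forall d, 0 < d -> exists n0, forall n, (n >= n0)%nat -> 0 < / (INR n + 1) < d).
    { intros d Hd. destruct (nfloor_ex (/ d)) as [n0 [_ Hn0]]; [left; now apply Rinv_0_lt_compat|].
      exists n0. intros n Hn. apply le_INR in Hn. pose proof (pos_INR n).
      split; [apply Rinv_0_lt_compat; lra|]. rewrite <- (Rinv_inv d).
      apply Rinv_lt_contravar; [|lra]. apply Rmult_lt_0_compat; [now apply Rinv_0_lt_compat|lra]. }
    destruct (C_complete (fun n => v (off z (/ (INR n + 1))))) as [L HL].
    { intros e He. destruct (Hsm z e He) as [d [Hd H]]. destruct (Hinv d Hd) as [n0 Hn0].
      exists n0. intros n k Hn Hk. apply H; auto. }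
    exists L. intros e He. destruct (Hsm z (e/2)) as [d [Hd H]]; [lra|].
    exists d. split; [easy|]. intros tau Ht.
    destruct (HL (e/2)) as [n1 Hn1]; [lra|]. destruct (Hinv d Hd) as [n0 Hn0].
    set (n := max n0 n1). specialize (Hn1 n ltac:(lia)). specialize (Hn0 n ltac:(lia)).
    eapply Rle_lt_trans; [apply (Cmod_minus_le _ (v (off z (/ (INR n + 1)))))|].
    specialize (H tau (/ (INR n + 1)) Ht Hn0). lra. }
  destruct (ClassicalEpsilon.choice _ Hex) as [u Hu]. exists u. exact Hu.
Qed.

Lemma ext_off v u z : ext_of v u -> nn x0 z <> s -> u z = v z.
Proof.
  intros Hu Hz. symmetry. apply Cmod_eq0_sub. apply Rle_antisym; [|apply Cmod_ge_0].
  apply le_epsilon. intros e He. rewrite Rplus_0_l.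
  destruct (Hu z e He) as [d [Hd H]]. specialize (H (d/2) ltac:(lra)).
  unfold off in H. destruct Req_dec_T; [easy|]. lra.
Qed.

Lemma ext_bound v u b : ext_of v u -> (forall z, nn x0 z <> s -> Cmod (v z) <= b) -> forall z, Cmod (u z) <= b.
Proof.
  intros Hu Hb z. apply le_epsilon. intros e He.
  destruct (Hu z e He) as [d [Hd H]]. specialize (H (d/2) ltac:(lra)).
  specialize (Hb (off z (d/2)) (off_nn z (d/2) ltac:(lra))).
  pose proof (Cmod_sub_le (u z) (v (off z (d/2)))). rewrite Cmod_minus_sym in H0. lra.
Qed.

(** The shifts are taken so small that each point moves by at most a quarter of the distance between
    the two; the shifted points are then at most twice as far apart, whence the factor 2. *)
Lemma ext_modulus v u c al gam e1 e2 : ext_of v u -> 0 < al < gam -> gam < 1 -> 0 <= e1 -> 0 <= e2 -> 0 < c ->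
  (forall z z', nn x0 z <> s -> nn x0 z' <> s -> Cmod (v z - v z') <= c * Om al gam e1 e2 (Cmod (z - z'))) ->
  forall z z', Cmod (u z - u z') <= 2 * c * Om al gam e1 e2 (Cmod (z - z')).
Proof.
  intros Hu Hal Hgam He1 He2 Hc Hv z z'.
  destruct (Ceq_dec z z') as [->|n].
  { rewrite Cmod_diag. apply Rmult_le_pos; [lra|]. now apply Om_nonneg. }
  assert (Ht := Cmod_pos_sub _ _ n). set (t := Cmod (z - z')) in *.
  apply le_epsilon. intros e He.
  destruct (Hu z (e/2)) as [d1 [D1 H1]]; [lra|]. destruct (Hu z' (e/2)) as [d2 [D2 H2]]; [lra|].
  set (tau := Rmin (t / 4) (Rmin d1 d2) / 2).
  assert (0 < Rmin (t / 4) (Rmin d1 d2)) by (repeat apply Rmin_pos; lra).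
  pose proof (Rmin_l (t / 4) (Rmin d1 d2)). pose proof (Rmin_r (t / 4) (Rmin d1 d2)).
  pose proof (Rmin_l d1 d2). pose proof (Rmin_r d1 d2).
  assert (Htau : 0 < tau) by (unfold tau; lra).
  specialize (H1 tau ltac:(unfold tau in *; lra)). specialize (H2 tau ltac:(unfold tau in *; lra)).
  pose proof (Hv _ _ (off_nn z tau Htau) (off_nn z' tau Htau)) as HV.
  assert (HO : Om al gam e1 e2 (Cmod (off z tau - off z' tau)) <= 2 * Om al gam e1 e2 t).
  { apply Om_le_scale; auto; try lra. split; [apply Cmod_ge_0|].
    pose proof (Cmod_minus_le (off z tau) z (off z' tau)) as Q1. pose proof (Cmod_minus_le z z' (off z' tau)) as Q2.
    rewrite (Cmod_minus_sym z') in Q2. fold t in Q2.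
    pose proof (off_dist z tau Htau). pose proof (off_dist z' tau Htau). unfold tau in *; lra. }
  apply (Rmult_le_compat_l c) in HO; [|lra].
  pose proof (Cmod_minus_le (u z) (v (off z tau)) (u z')) as Q1.
  pose proof (Cmod_minus_le (v (off z tau)) (v (off z' tau)) (u z')).
  rewrite (Cmod_minus_sym (u z) (v _)) in Q1. lra.
Qed.
End Extend.

(** * Removability of the boundary of a square *)

Lemma SI_osc g a b d p e : 0 < d -> (forall z, in_sq a b d z -> ccont g z) -> 
  (forall z, in_sq a b d z -> Cmod (g z - g p) <= e) -> Cmod (SI g a b d) <= 4 * d * e.
Proof.
  intros Hd Hc Ho.
  assert (E : SI g a b d = SI (fun z => g z - g p)%C a b d).
  { rewrite SI_minus; [|lra| |].
    - rewrite SI_const. ring.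
    - intros z Hz. apply Hc, on_sq_in; [lra|easy].
    - intros z Hz. apply ccont_const. }
  rewrite E. apply SI_norm_le; [lra| |].
  - intros z Hz. apply ccont_minus; [apply Hc, on_sq_in; [lra|easy]|apply ccont_const].
  - intros z Hz. apply Ho, on_sq_in; [lra|easy].
Qed.

(** The strip has width [2 * sg] and density proportional to 1/sg, so thinness alone gains nothing.
    The gain comes from subtracting a constant, which replaces the size of [g] by its oscillation at
    scale [sg]. *)
Lemma cov_line g A B D (E : C -> Prop) : 0 < D -> (forall z, in_sq A B D z -> ccont g z) ->
  (exists c, (forall p, E p -> fst p = c) \/ (forall p, E p -> snd p = c)) ->
  (forall e, 0 < e -> exists sg, 0 < sg /\ forall p w, E p -> Cmod (w - p) <= sg -> Cmod (g w - g p) <= e) ->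
  forall e, 0 < e -> Cov g A B D E e.
Proof.
  intros HD Hc [c Hline] Hosc e He.
  destruct (Hosc (e / (16 * D))) as [sg0 [Hsg0 Ho]]; [apply Rdiv_lt_0_compat; lra|].
  set (sg := Rmin D (sg0 / 2)).
  assert (Hsg : 0 < sg) by (apply Rmin_pos; lra).
  assert (S1 : sg <= D) by apply Rmin_l. assert (S2 : sg <= sg0 / 2) by apply Rmin_r.
  set (tau := 8 * (e / (16 * D)) / sg).
  assert (He' : 0 < e / (16 * D)) by (apply Rdiv_lt_0_compat; lra).
  assert (Htau : 0 <= tau) by (unfold tau; left; apply Rdiv_lt_0_compat; lra).
  assert (Hsq : forall p a b d, in_sq A B D p -> E p -> sub_sq a b d A B D -> in_sq a b d p -> sg / 2 < d <= sg ->
     Cmod (SI g a b d) <= tau * (d * d)).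
  { intros p a b d Hp Ep Hs Hin Hd.
    eapply Rle_trans; [apply (SI_osc g a b d p (e / (16 * D)))|].
    - lra.
    - intros z Hz. apply Hc. eapply in_sq_sub; eauto.
    - intros z Hz. apply Ho; auto. pose proof (in_sq_dist a b d z p Hz Hin). lra.
    - apply perimeter_le_area; lra. }
  assert (HT : tau * (2 * sg * D) <= e) by (unfold tau; right; field; lra).
  destruct Hline as [Hl|Hl].
  - apply (cov_box g A B D E (c - sg) (c + sg) B (B + D) tau e sg); try lra.
    intros p a b d Hp Ep Hs Hin Hd. assert (Hin' := Hin). unfold in_sq in Hin'. rewrite (Hl p Ep) in Hin'.
    assert (Hs' := Hs). unfold sub_sq in Hs'. repeat split; try lra. eapply Hsq; eauto.
  - apply (cov_box g A B D E A (A + D) (c - sg) (c + sg) tau e sg); try lra.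
    intros p a b d Hp Ep Hs Hin Hd. assert (Hin' := Hin). unfold in_sq in Hin'. rewrite (Hl p Ep) in Hin'.
    assert (Hs' := Hs). unfold sub_sq in Hs'. repeat split; try lra. eapply Hsq; eauto.
Qed.

(* Painleve's argument: the boundary of the square lies on four lines, and a thin strip around a line has small cost. *)
Lemma square_removable x0 s g alpha N M (W : Cset) p : 0 < s -> 0 < alpha -> 0 < N ->
  (forall z w, Cmod (g z - g w) <= N * rpow (Cmod (z - w)) alpha) -> (forall z, Cmod (g z) <= M) ->
  Copen W -> W p -> (forall z, W z -> nn x0 z <> s -> cdiffable g z) -> cdiffable g p.
Proof.
  intros Hs Ha HN HL HM HW Wp Hd.
  assert (Hgc := holder_ccont alpha g N Ha HN HL).
  assert (HM0 : 0 <= M) by (eapply Rle_trans; [apply (Cmod_ge_0 (g p))|apply HM]).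
  destruct (square_in_open W p HW Wp) as [a [b [d [Hd0 [Ip Sp]]]]].
  set (H := fun z => (/ C2pi * CK g a b d 1 z)%C).
  assert (HHd : forall z, int_sq a b d z -> cdiffable H z).
  { intros z Hz. apply cdiffable_mult; [apply cdiffable_const|].
    eexists. apply (CK_diff g a b d 1 z M); auto; [|intros w _; auto].
    intros Hon; eapply on_not_int; eauto. }
  assert (Hoff : forall z, int_sq a b d z -> nn x0 z <> s -> g z = H z).
  { intros z Iz Hz.
    destruct (Hd z (Sp z (int_sq_in _ _ _ _ Iz)) Hz) as [L [phi [Hphi [_ He]]]].
    assert (Heta := dd_pos x0 s z Hz). set (eta := dd x0 s z) in *.
    assert (Hval : forall w, w <> z -> phi w = ((g w - g z) * / (w - z))%C).
    { intros w Hw. rewrite (He w). field. now apply Cminus_eq_contra. }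
    assert (Hcphi : forall w, ccont phi w).
    { intros w. destruct (Ceq_dec w z) as [->|n]; [easy|].
      apply (ccont_ext_loc (fun w => (g w - g z) * / (w - z))%C phi w (Cmod (w - z))).
      - now apply Cmod_pos_sub.
      - intros w' Hw'. rewrite Hval; [easy|]. intros ->. rewrite Cmod_minus_sym in Hw'; lra.
      - apply ccont_mult; [apply ccont_minus; [auto|apply ccont_const]|].
        now apply ccont_inv_sub. }
    (* The boundary keeps distance [eta] from [z], so near it the difference quotient is uniformly
       continuous, as [cov_line] demands. *)
    assert (Hosc : forall e, 0 < e -> exists sg, 0 < sg /\ forall q w, nn x0 q = s ->
        Cmod (w - q) <= sg -> Cmod (phi w - phi q) <= e).
    { intros e Hepos.
      destruct (rpow_small alpha (e * eta / (4 * N)) Ha) as [d1 [D1 R1]].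
      { apply Rdiv_lt_0_compat; [apply Rmult_lt_0_compat; lra|lra]. }
      set (d2 := e * (eta * eta) / (8 * (M + 1))).
      assert (D2 : 0 < d2).
      { apply Rdiv_lt_0_compat; [|lra]. apply Rmult_lt_0_compat; [lra|]. now apply Rmult_lt_0_compat. }
      exists (Rmin (eta / 2) (Rmin d1 d2)). split; [repeat apply Rmin_pos; lra|].
      intros q w Hq Hw.
      pose proof (Rmin_l (eta / 2) (Rmin d1 d2)). pose proof (Rmin_r (eta / 2) (Rmin d1 d2)).
      pose proof (Rmin_l d1 d2). pose proof (Rmin_r d1 d2).
      assert (Hqz : eta <= Cmod (q - z)).
      { pose proof (dd_le x0 s q z Hq). pose proof (nrm_le_Cmod (q - z)%C). fold eta in H4. lra. }
      assert (Hwz : eta / 2 <= Cmod (w - z)).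
      { pose proof (Cmod_minus_le q w z). rewrite (Cmod_minus_sym q w) in H4. lra. }
      assert (nq : q <> z) by (intros ->; rewrite Cmod_diag in Hqz; lra).
      assert (nw : w <> z) by (intros ->; rewrite Cmod_diag in Hwz; lra).
      assert (zq := Cminus_eq_contra _ _ nq). assert (zw := Cminus_eq_contra _ _ nw).
      rewrite (Hval q nq), (Hval w nw).
      replace ((g w - g z) * / (w - z) - (g q - g z) * / (q - z))%C
        with ((g w - g q) * / (w - z) + (g q - g z) * (q - w) * (/ (w - z) * / (q - z)))%C by (field; split; easy).
      eapply Rle_trans; [apply Cmod_triangle|]. rewrite !Cmod_mult, !Cmod_inv by easy.
      assert (I1 : / Cmod (w - z) <= / (eta / 2)) by (apply Rinv_le_contravar; lra).
      assert (I2 : / Cmod (q - z) <= / eta) by (apply Rinv_le_contravar; lra).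
      assert (P1 : 0 < / Cmod (w - z)) by (apply Rinv_0_lt_compat; lra).
      assert (P2 : 0 < / Cmod (q - z)) by (apply Rinv_0_lt_compat; lra).
      assert (T1 : Cmod (g w - g q) * / Cmod (w - z) <= N * (e * eta / (4 * N)) * / (eta / 2)).
      { apply Rmult_le_compat; auto using Cmod_ge_0; [lra|].
        eapply Rle_trans; [apply HL|]. apply Rmult_le_compat_l; [lra|]. apply R1. split; [apply Cmod_ge_0|lra]. }
      assert (T2 : Cmod (g q - g z) * Cmod (q - w) * (/ Cmod (w - z) * / Cmod (q - z))
                   <= 2 * (M + 1) * d2 * (/ (eta / 2) * / eta)).
      { apply Rmult_le_compat.
        - apply Rmult_le_pos; apply Cmod_ge_0.
        - apply Rmult_le_pos; lra.
        - apply Rmult_le_compat; try apply Cmod_ge_0.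
          + pose proof (Cmod_minus_triangle (g q) (g z)). pose proof (HM q). pose proof (HM z). lra.
          + rewrite Cmod_minus_sym. lra.
        - apply Rmult_le_compat; lra. }
      replace (N * (e * eta / (4 * N)) * / (eta / 2)) with (e / 2) in T1 by (field; lra).
      replace (2 * (M + 1) * d2 * (/ (eta / 2) * / eta)) with (e / 2) in T2 by (unfold d2; field; lra).
      lra. }
    assert (HC := cauchy_formula g phi a b d (fun w => nn x0 w = s) z Hd0 Iz).
    unfold H, CK. rewrite (SI_ext _ (fun w => g w * / (w - z))%C) by (try lra; intros; now rewrite Cpow_1_r).
    rewrite HC; auto.
    - field. apply C2pi_neq0.
    - intros q Hq. destruct (Req_dec (nn x0 q) s) as [Eq|Nq]; [now right|left; auto].
    - intros e Hepos.
      set (El := fun c (pr : C -> R) (w : C) => nn x0 w = s /\ pr w = c).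
      assert (Hl : forall c pr, (forall w, pr w = fst w) \/ (forall w, pr w = snd w) -> Cov phi a b d (El c pr) (e / 4)).
      { intros c pr Hpr. apply cov_line; auto; [| |lra].
        - exists c. destruct Hpr as [Hpr|Hpr]; [left|right]; intros w [_ Hw]; now rewrite <- Hpr.
        - intros e' He'. destruct (Hosc e' He') as [sg [Hsg Hsg']]. exists sg; split; [easy|].
          intros q w [Hq _] Hw. auto. }
      eapply cov_mono; [| |apply (cov_union _ _ _ _ _ _ _ _
         (cov_union _ _ _ _ _ _ _ _ (Hl (fst x0 - s) fst (or_introl (fun w => eq_refl)))
                                     (Hl (fst x0 - s + 2 * s) fst (or_introl (fun w => eq_refl))))
         (cov_union _ _ _ _ _ _ _ _ (Hl (snd x0 - s) snd (or_intror (fun w => eq_refl)))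
                                     (Hl (snd x0 - s + 2 * s) snd (or_intror (fun w => eq_refl)))))]; [|lra].
      intros q _ Hq. assert (Hq' := Hq). apply nn_on in Hq'; [|easy]. unfold on_sq in Hq'. unfold El. tauto. }
  (* On the boundary itself the equality follows from continuity of both sides, since shifted points
     approach it from outside. *)
  assert (Hall : forall z, int_sq a b d z -> g z = H z).
  { intros z Iz. destruct (Req_dec (nn x0 z) s) as [Hz|Hz]; [|auto].
    apply Cmod_eq0_sub. apply Rle_antisym; [|apply Cmod_ge_0]. apply le_epsilon. intros e He. rewrite Rplus_0_l.
    destruct (Hgc z (e/2)) as [d1 [D1 H1]]; [lra|].
    destruct (cdiffable_ccont H z (HHd z Iz) (e/2)) as [d2 [D2 H2]]; [lra|].
    destruct (int_sq_open a b d z Iz) as [d3 [D3 H3]].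
    set (tau := Rmin d1 (Rmin d2 d3) / 4).
    assert (0 < Rmin d1 (Rmin d2 d3)) by (repeat apply Rmin_pos; lra).
    pose proof (Rmin_l d1 (Rmin d2 d3)). pose proof (Rmin_r d1 (Rmin d2 d3)).
    pose proof (Rmin_l d2 d3). pose proof (Rmin_r d2 d3).
    assert (Ht : 0 < tau) by (unfold tau; lra).
    set (w := off x0 s z tau).
    assert (Hw : Cmod (w - z) <= 2 * tau) by (apply off_dist; auto).
    assert (Hwn : nn x0 w <> s) by (apply off_nn; auto).
    specialize (H1 w ltac:(unfold tau in *; lra)). specialize (H2 w ltac:(unfold tau in *; lra)).
    specialize (H3 w ltac:(unfold tau in *; lra)).
    rewrite (Hoff w H3 Hwn) in H1.
    pose proof (Cmod_minus_le (g z) (H w) (H z)) as Q. rewrite (Cmod_minus_sym (g z) (H w)) in Q. lra. }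
  destruct (int_sq_open a b d p Ip) as [r [Hr Hi]].
  apply (cdiffable_ext_loc H g p r Hr); [|auto].
  intros w Hw. symmetry. auto.
Qed.

Lemma density alpha (U : Cset) (f : C -> C) (x0 : C) N eps : 0 < alpha < 1 -> Copen U -> 0 < N -> 0 < eps ->
  (forall z, Cmod (f z) <= N) ->
  (forall z w, Cmod (f z - f w) <= N * rpow (Cmod (z - w)) alpha) ->
  (forall e, e > 0 -> exists d, d > 0 /\ forall z w, Cmod (z - w) < d ->
     Cmod (f z - f w) <= e * rpow (Cmod (z - w)) alpha) ->
  (forall p, U p -> cdiffable f p) ->
  exists g, (forall z, Cmod (g z - f z) <= eps) /\
    (forall z w, Cmod ((g z - f z) - (g w - f w)) <= eps * rpow (Cmod (z - w)) alpha) /\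
    (forall e, e > 0 -> exists d, d > 0 /\ forall z w, Cmod (z - w) < d ->
       Cmod (g z - g w) <= e * rpow (Cmod (z - w)) alpha) /\
    (forall p, U p -> cdiffable g p) /\
    (exists V, Copen V /\ V x0 /\ forall p, V p -> cdiffable g p).
Proof.
  intros Ha HU HN Heps Hb HL Hl HUf.
  assert (Hfc := holder_ccont alpha f N (proj1 Ha) HN HL).
  (* Any exponent strictly between [alpha] and 1 would do. *)
  set (gam := (1 + alpha) / 2).
  assert (Hag : 0 < alpha < gam) by (unfold gam; lra). assert (Hg1 : gam < 1) by (unfold gam; lra).
  assert (HK4 := K4_pos alpha gam Hag Hg1). set (k4 := K4 alpha gam) in *.
  set (k5 := K5 alpha gam). assert (HK5 : 0 < k5) by (unfold k5, K5; fold k4; lra).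
  (* [k5 * eta] will bound the supremum of [u] and [2 * k4 * eta] its Lipschitz constant, the 2
     being the loss in [ext_modulus]. *)
  set (eta := eps / (k5 + 2 * k4)).
  assert (Heta : 0 < eta) by (apply Rdiv_lt_0_compat; lra).
  assert (Heta2 : (k5 + 2 * k4) * eta = eps) by (unfold eta; field; lra).
  destruct (Hl eta Heta) as [dl [Hdl Hdl']].
  (* Points of the square are at most [4 * s < dl] apart, so [f] has Lipschitz constant [eta] there;
     [s <= 1] makes s^alpha at most 1 in the sup bound. *)
  set (s := Rmin 1 (dl / 5)).
  assert (Hs : 0 < s) by (apply Rmin_pos; lra). assert (Hs1 : s <= 1) by apply Rmin_l.
  assert (Hs2 : s <= dl / 5) by apply Rmin_r.
  assert (Hmod1 : forall z w, nn x0 z <= s -> nn x0 w <= s -> Cmod (f z - f w) <= Om alpha gam eta 0 (Cmod (z - w))).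
  { intros z w Hz Hw. unfold Om. rewrite Rmult_0_l, Rplus_0_r. apply Hdl'.
    pose proof (Cmod_le_nrm (z - w)%C). pose proof (nrm_minus_le z x0 w). rewrite (nrm_sym x0 w) in H0.
    unfold nn in *. lra. }
  assert (Hu1 := u0_modulus x0 s f Hs Hfc alpha gam eta 0 Hag Hg1 (Rlt_le _ _ Heta) (Rle_refl 0) Hmod1).
  fold k4 in Hu1. set (v := u0 x0 s f) in *.
  destruct (ext_exists x0 s Hs v k4 alpha gam eta 0) as [u Hu]; auto; try lra.
  assert (Hub : forall z, Cmod (u z) <= eps).
  { apply (ext_bound x0 s Hs v u eps Hu). intros z Hz.
    eapply Rle_trans; [apply (u0_bound x0 s f Hs Hfc alpha gam eta 0); auto; lra|].
    fold k5. unfold Om. rewrite Rmult_0_l, Rplus_0_r.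
    assert (rpow s alpha <= 1).
    { eapply Rle_trans; [apply (rpow_mono s 1); lra|]. rewrite rpow_pos by lra.
      unfold Rpower. rewrite ln_1, Rmult_0_r, exp_0. lra. }
    pose proof (rpow_nonneg s alpha).
    assert (k5 * (eta * rpow s alpha) <= k5 * (eta * 1)) by (apply Rmult_le_compat_l; [lra|apply Rmult_le_compat_l; lra]).
    assert (0 < k4 * eta) by (apply Rmult_lt_0_compat; lra). lra. }
  assert (HuL : forall z w, Cmod (u z - u w) <= eps * rpow (Cmod (z - w)) alpha).
  { intros z w. eapply Rle_trans; [apply (ext_modulus x0 s Hs v u k4 alpha gam eta 0 Hu); auto; lra|].
    unfold Om. rewrite Rmult_0_l, Rplus_0_r, <- Rmult_assoc. apply Rmult_le_compat_r; [apply rpow_nonneg|].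
    assert (0 < k5 * eta) by (apply Rmult_lt_0_compat; lra). lra. }
  (* The same function [v] is estimated again with a modulus whose first coefficient is small. The
     constant [k4] does not depend on the coefficients, and the term with exponent [gam] is
     negligible at small distances. *)
  assert (Hul : forall e, 0 < e -> exists d, d > 0 /\ forall z w, Cmod (z - w) < d ->
       Cmod (u z - u w) <= e * rpow (Cmod (z - w)) alpha).
  { intros e He. set (e' := e / (4 * k4)). assert (He' : 0 < e') by (apply Rdiv_lt_0_compat; lra).
    destruct (Hl e' He') as [d' [Hd' Hd2]].
    (* Chosen so that N t^alpha <= e2 t^gam as soon as t is at least [d']. *)
    set (e2 := N / Rpower d' (gam - alpha)).
    assert (Hpd : 0 < Rpower d' (gam - alpha)) by apply Rpower_gt_0.
    assert (He2 : 0 < e2) by now apply Rdiv_lt_0_compat.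
    assert (Hsplit : forall t, 0 < t -> rpow t gam = Rpower t (gam - alpha) * rpow t alpha).
    { intros t Ht. rewrite !rpow_pos by easy. rewrite <- Rpower_plus. f_equal; ring. }
    assert (Hmod2 : forall z w, nn x0 z <= s -> nn x0 w <= s -> Cmod (f z - f w) <= Om alpha gam e' e2 (Cmod (z - w))).
    { intros z w _ _. unfold Om.
      assert (P1 : 0 <= e' * rpow (Cmod (z - w)) alpha) by (apply Rmult_le_pos; [lra|apply rpow_nonneg]).
      assert (P2 : 0 <= e2 * rpow (Cmod (z - w)) gam) by (apply Rmult_le_pos; [lra|apply rpow_nonneg]).
      destruct (Rlt_dec (Cmod (z - w)) d') as [H|H].
      - specialize (Hd2 z w H). lra.
      - apply Rle_trans with (e2 * rpow (Cmod (z - w)) gam); [|lra].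
        eapply Rle_trans; [apply HL|]. rewrite Hsplit by lra. rewrite <- Rmult_assoc.
        apply Rmult_le_compat_r; [apply rpow_nonneg|].
        replace N with (e2 * Rpower d' (gam - alpha)) at 1 by (unfold e2; field; lra).
        apply Rmult_le_compat_l; [lra|]. apply Rle_Rpower_l; lra. }
    assert (Hu2 := u0_modulus x0 s f Hs Hfc alpha gam e' e2 Hag Hg1 (Rlt_le _ _ He') (Rlt_le _ _ He2) Hmod2).
    fold v k4 in Hu2.
    assert (Hm2 := ext_modulus x0 s Hs v u k4 alpha gam e' e2 Hu Hag Hg1 (Rlt_le _ _ He') (Rlt_le _ _ He2) HK4 Hu2).
    destruct (rpow_small (gam - alpha) (e' / e2)) as [d [Hd Hsm]]; [lra|now apply Rdiv_lt_0_compat|].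
    exists d; split; [easy|]. intros z w Hzw.
    destruct (Ceq_dec z w) as [->|n].
    { rewrite Cmod_diag. apply Rmult_le_pos; [lra|apply rpow_nonneg]. }
    assert (Ht := Cmod_pos_sub _ _ n). set (t := Cmod (z - w)) in *.
    eapply Rle_trans; [apply Hm2|]. fold t. unfold Om. rewrite Hsplit by easy.
    specialize (Hsm t ltac:(lra)). rewrite rpow_pos in Hsm by easy.
    assert (e2 * Rpower t (gam - alpha) <= e').
    { apply Rle_trans with (e2 * (e' / e2)); [apply Rmult_le_compat_l; lra|right; field; lra]. }
    assert (e2 * (Rpower t (gam - alpha) * rpow t alpha) <= e' * rpow t alpha).
    { rewrite <- Rmult_assoc. apply Rmult_le_compat_r; [apply rpow_nonneg|easy]. }
    apply Rle_trans with (2 * k4 * (2 * e' * rpow t alpha)); [apply Rmult_le_compat_l; lra|].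
    right. unfold e'. field. lra. }
  set (g := fun z => (f z - u z)%C).
  assert (Hgf : forall z, (g z - f z)%C = (- u z)%C) by (intros; unfold g; ring).
  (* Off the boundary [g] equals [Fc] inside the square and [f + Fc] outside. *)
  set (Fc := fun z => (/ C2pi * CK f (fst x0 - s) (snd x0 - s) (2 * s) 1 z)%C).
  assert (HFc : forall z, nn x0 z <> s -> cdiffable Fc z).
  { intros z Hz. apply cdiffable_mult; [apply cdiffable_const|].
    eexists. apply (CK_diff f _ _ _ 1 z N); auto; [lra| |intros w _; auto].
    intros Hon. apply nn_on in Hon; auto. }
  assert (Hnear : forall z w, Cmod (w - z) < dd x0 s z -> nn x0 w <> s /\ (nn x0 w < s <-> nn x0 z < s)).
  { intros z w Hw. pose proof (nn_lip x0 z w) as Hn. pose proof (nrm_le_Cmod (z - w)%C) as Hc.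
    rewrite (Cmod_minus_sym z w) in Hc. unfold dd in Hw.
    assert (Hn' : Rabs (nn x0 z - nn x0 w) < Rabs (nn x0 z - s)) by lra.
    clear - Hn'. revert Hn'. unfold Rabs. repeat destruct Rcase_abs; intros; repeat split; intros; lra. }
  assert (Hin : forall z, nn x0 z < s -> cdiffable g z).
  { intros z Hz. apply (cdiffable_ext_loc Fc g z (dd x0 s z)); [apply dd_pos; lra| |apply HFc; lra].
    intros w Hw. destruct (Hnear z w Hw) as [H1 H2]. unfold g. rewrite (ext_off x0 s v u w Hu H1).
    unfold v, u0. destruct Rlt_dec as [H|H]; [unfold Fc; ring|]. exfalso. tauto. }
  assert (Hout : forall z, nn x0 z > s -> cdiffable f z -> cdiffable g z).
  { intros z Hz Hfz. apply (cdiffable_ext_loc (fun w => f w + Fc w)%C g z (dd x0 s z)); [apply dd_pos; lra| |].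
    - intros w Hw. destruct (Hnear z w Hw) as [H1 H2]. unfold g. rewrite (ext_off x0 s v u w Hu H1).
      unfold v, u0. destruct Rlt_dec as [H|H]; [exfalso; apply H2 in H; lra|]. unfold Fc. ring.
    - apply cdiffable_plus; [easy|]. apply HFc. lra. }
  exists g. split; [|split; [|split; [|split]]].
  - intros z. rewrite Hgf, Cmod_opp. auto.
  - intros z w. rewrite !Hgf. replace (- u z - - u w)%C with (- (u z - u w))%C by ring. rewrite Cmod_opp. auto.
  - intros e He. destruct (Hl (e/2)) as [d1 [D1 H1]]; [lra|]. destruct (Hul (e/2)) as [d2 [D2 H2]]; [lra|].
    exists (Rmin d1 d2). split; [apply Rmin_pos; lra|]. intros z w Hzw.
    pose proof (Rmin_l d1 d2). pose proof (Rmin_r d1 d2).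
    specialize (H1 z w ltac:(lra)). specialize (H2 z w ltac:(lra)).
    unfold g. replace (f z - u z - (f w - u w))%C with ((f z - f w) - (u z - u w))%C by ring.
    eapply Rle_trans; [apply Cmod_minus_triangle|]. lra.
  - intros p Up. apply (square_removable x0 s g alpha (N + eps) (N + eps) U p); auto; try lra.
    + intros z w. unfold g. replace (f z - u z - (f w - u w))%C with ((f z - f w) - (u z - u w))%C by ring.
      eapply Rle_trans; [apply Cmod_minus_triangle|]. specialize (HL z w). specialize (HuL z w). lra.
    + intros z. unfold g. eapply Rle_trans; [apply Cmod_minus_triangle|].
      specialize (Hb z). specialize (Hub z). lra.
    + intros z Uz Hz. destruct (Rlt_dec (nn x0 z) s) as [H|H]; [auto|]. apply Hout; auto. lra.
  - exists (fun z => nn x0 z < s). split; [|split; [|auto]].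
    + intros z Hz. exists (dd x0 s z). split; [apply dd_pos; lra|]. intros w. rewrite Cnorm_Cmod. intros Hw.
      destruct (Hnear z w Hw) as [_ H]. tauto.
    + unfold nn. replace (x0 - x0)%C with (RtoC 0 * 1)%C by ring. rewrite nrm_scal, Rabs_R0, Rmult_0_l. easy.
Qed.

(** * Lipschitz norms and the point derivation *)

Definition bounded_holder (alpha : R) (f : C -> C) (N : R) : Prop :=
  (forall z, Cmod (f z) <= N) /\
  (forall z w, Cmod (f z - f w) <= N * rpow (Cmod (z - w)) alpha).

Definition little_o (alpha : R) (f : C -> C) : Prop :=
  forall e, e > 0 -> exists d, d > 0 /\ forall z w, Cmod (z - w) < d ->
    Cmod (f z - f w) <= e * rpow (Cmod (z - w)) alpha.

Lemma bounded_holder_le alpha f N N' : N <= N' -> bounded_holder alpha f N -> bounded_holder alpha f N'.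
Proof.
  intros HN [H1 H2]. split.
  - intros z. specialize (H1 z); lra.
  - intros z w. eapply Rle_trans; [apply H2|]. apply Rmult_le_compat_r; [apply rpow_nonneg|easy].
Qed.

Lemma bounded_holder_minus alpha f g N M : bounded_holder alpha f N -> bounded_holder alpha g M ->
  bounded_holder alpha (fun z => f z - g z)%C (N + M).
Proof.
  intros [H1 H2] [K1 K2]. split.
  - intros z. eapply Rle_trans; [apply Cmod_minus_triangle|]. specialize (H1 z); specialize (K1 z); lra.
  - intros z w. replace (f z - g z - (f w - g w))%C with ((f z - f w) - (g z - g w))%C by ring.
    eapply Rle_trans; [apply Cmod_minus_triangle|]. specialize (H2 z w); specialize (K2 z w); lra.
Qed.

Lemma little_o_minus alpha f g : little_o alpha f -> little_o alpha g -> little_o alpha (fun z => f z - g z)%C.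
Proof.
  intros Hf Hg e He. destruct (Hf (e/2)) as [d1 [D1 H1]]; [lra|]. destruct (Hg (e/2)) as [d2 [D2 H2]]; [lra|].
  exists (Rmin d1 d2). split; [apply Rmin_pos; lra|]. intros z w Hzw.
  pose proof (Rmin_l d1 d2). pose proof (Rmin_r d1 d2).
  specialize (H1 z w ltac:(lra)). specialize (H2 z w ltac:(lra)).
  replace (f z - g z - (f w - g w))%C with ((f z - f w) - (g z - g w))%C by ring.
  eapply Rle_trans; [apply Cmod_minus_triangle|]. lra.
Qed.

Lemma analytic_on_cdiffable (W : Cset) (f : C -> C) : analytic_on W f <-> forall p, W p -> cdiffable f p.
Proof.
  split; intros H p Wp; destruct (H p Wp) as [L HL]; exists L; now apply has_cderiv_cdiff.
Qed.

Lemma InA_iff alpha U (f : C -> C) : InA alpha U f <->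
  (exists N, 0 < N /\ bounded_holder alpha f N) /\ little_o alpha f /\ (forall p, U p -> cdiffable f p).
Proof.
  unfold InA, lipAlpha, LipAlpha. rewrite analytic_on_cdiffable. split.
  - intros [[[[M HM] [k [Hk HL]]] Hl] HU]. split; [|split; auto].
    + exists (Rmax M 0 + k). pose proof (Rmax_l M 0). pose proof (Rmax_r M 0).
      split; [lra|]. split.
      * intros z. specialize (HM z). rewrite Cnorm_Cmod in HM. lra.
      * intros z w. specialize (HL z w). rewrite !Cnorm_Cmod in HL.
        eapply Rle_trans; [apply HL|]. apply Rmult_le_compat_r; [apply rpow_nonneg|lra].
    + intros e He. destruct (Hl e He) as [d [Hd H]]. exists d; split; [easy|]. intros z w Hzw.
      specialize (H z w). rewrite !Cnorm_Cmod in H. auto.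
  - intros [[N [HN [H1 H2]]] [Hl HU]]. split; [|auto]. split; [split|].
    + exists N. intros z. rewrite Cnorm_Cmod. auto.
    + exists N. split; [easy|]. intros z w. rewrite !Cnorm_Cmod. auto.
    + intros e He. destruct (Hl e He) as [d [Hd H]]. exists d; split; [easy|]. intros z w.
      rewrite !Cnorm_Cmod. auto.
Qed.

Lemma LipNorm_bounded_holder alpha (f : C -> C) nf : LipNorm alpha f nf -> 0 <= nf /\ bounded_holder alpha f nf.
Proof.
  intros [S [K [[HS _] [[HK _] ->]]]].
  assert (HS' : forall z, Cmod (f z) <= S).
  { intros z. rewrite <- Cnorm_Cmod. apply HS. eauto. }
  assert (HK' : forall z w, Cmod (f z - f w) <= K * rpow (Cmod (z - w)) alpha).
  { intros z w. specialize (HK z w). now rewrite !Cnorm_Cmod in HK. }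
  assert (HS0 : 0 <= S) by (eapply Rle_trans; [apply (Cmod_ge_0 (f 0))|apply HS']).
  assert (HK0 : 0 <= K).
  { specialize (HK' (RtoC 1) (RtoC 0)). replace (1 - 0)%C with (RtoC 1) in HK' by ring.
    rewrite Cmod_1, rpow_pos in HK' by lra. unfold Rpower in HK'. rewrite ln_1, Rmult_0_r, exp_0 in HK'.
    pose proof (Cmod_ge_0 (f 1 - f 0)%C). lra. }
  split; [lra|]. split.
  - intros z. specialize (HS' z). lra.
  - intros z w. eapply Rle_trans; [apply HK'|]. apply Rmult_le_compat_r; [apply rpow_nonneg|lra].
Qed.

(** The least constant is minus the supremum of the negated constants. The supremum of |f| and the
    least constant contribute one [N] each. *)
Lemma LipNorm_exists alpha (f : C -> C) N : bounded_holder alpha f N -> exists nf, LipNorm alpha f nf /\ nf <= 2 * N.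
Proof.
  intros [H1 H2].
  destruct (completeness (fun r => exists z, r = Cnorm (f z))) as [S HS].
  { exists N. intros r [z ->]. rewrite Cnorm_Cmod. auto. }
  { exists (Cnorm (f (RtoC 0))), (RtoC 0). easy. }
  set (X := fun r => IsLipConst alpha f (- r)).
  assert (HX : X (- N)).
  { unfold X. rewrite Ropp_involutive. intros z w. rewrite !Cnorm_Cmod. apply H2. }
  assert (Hlow : forall z w k, z <> w -> IsLipConst alpha f k ->
      Cmod (f z - f w) / rpow (Cmod (z - w)) alpha <= k).
  { intros z w k Hn Hk. specialize (Hk z w). rewrite !Cnorm_Cmod in Hk.
    change (Csub (f z) (f w)) with (f z - f w)%C in Hk. change (Csub z w) with (z - w)%C in Hk.
    assert (Hp := Cmod_pos_sub _ _ Hn). rewrite rpow_pos in * by easy.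
    assert (HP : 0 < Rpower (Cmod (z - w)) alpha) by apply Rpower_gt_0.
    apply Rmult_le_reg_r with (Rpower (Cmod (z - w)) alpha); [easy|].
    unfold Rdiv. rewrite Rmult_assoc, Rinv_l by lra. lra. }
  destruct (completeness X) as [K HK].
  { exists (- (Cmod (f 1 - f 0) / rpow (Cmod (1 - 0)) alpha)). intros r Hr.
    assert (n : RtoC 1 <> RtoC 0) by apply C1_nz.
    specialize (Hlow _ _ _ n Hr). lra. }
  { eauto. }
  exists (S + - K). split.
  - exists S, (- K). split; [easy|]. split; [|easy]. split.
    + intros z w. rewrite !Cnorm_Cmod.
      change (Csub (f z) (f w)) with (f z - f w)%C. change (Csub z w) with (z - w)%C.
      destruct (Ceq_dec z w) as [->|n]; [rewrite !Cmod_diag, rpow_0; lra|].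
      assert (Hq : Cmod (f z - f w) / rpow (Cmod (z - w)) alpha <= - K).
      { assert (K <= - (Cmod (f z - f w) / rpow (Cmod (z - w)) alpha)); [|lra].
        apply HK. intros r Hr. specialize (Hlow z w _ n Hr). lra. }
      assert (Hp := Cmod_pos_sub _ _ n). rewrite rpow_pos in * by easy.
      assert (HP : 0 < Rpower (Cmod (z - w)) alpha) by apply Rpower_gt_0.
      apply (Rmult_le_compat_r (Rpower (Cmod (z - w)) alpha)) in Hq; [|lra].
      unfold Rdiv in Hq. rewrite Rmult_assoc, Rinv_l in Hq by lra. lra.
    + intros k Hk. assert (- k <= K); [|lra]. apply HK. unfold X. now rewrite Ropp_involutive.
  - assert (S <= N). { apply HS. intros r [z ->]. rewrite Cnorm_Cmod. auto. }
    assert (- N <= K) by (apply HK; easy). lra.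
Qed.

(** * Linearity and bounds for iterated derivatives *)

Lemma HasDerivN_sub (W W' : Cset) n : (forall z, W' z -> W z) ->
  forall f g, HasDerivN W n f g -> HasDerivN W' n f g.
Proof.
  intros HW. induction n as [|n IH]; intros f g.
  - simpl. auto.
  - intros [h [Hh Hg]]. exists h; split; auto.
Qed.

Lemma HasDerivN_minus (W : Cset) n : forall f g f' g', HasDerivN W n f f' -> HasDerivN W n g g' ->
  HasDerivN W n (fun z => Csub (f z) (g z)) (fun z => Csub (f' z) (g' z)).
Proof.
  induction n as [|n IH]; intros f g f' g'.
  - simpl. intros H1 H2 z Wz. now rewrite H1, H2.
  - intros [h [Hh Hf]] [k [Hk Hg]]. exists (fun z => Csub (h z) (k z)). split; [now apply IH|].
    intros z Wz. apply has_cderiv_cdiff. apply (cdiff_minus h k).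
    + now apply has_cderiv_cdiff, Hf.
    + now apply has_cderiv_cdiff, Hg.
Qed.

Lemma Copen_inter (W W' : Cset) : Copen W -> Copen W' -> Copen (fun z => W z /\ W' z).
Proof.
  intros H H' z [Wz Wz']. destruct (H z Wz) as [r [Hr K]]. destruct (H' z Wz') as [r' [Hr' K']].
  exists (Rmin r r'). split; [apply Rmin_pos; lra|]. intros w Hw.
  pose proof (Rmin_l r r'). pose proof (Rmin_r r r'). split; [apply K|apply K']; lra.
Qed.

Lemma DerivNAt_minus f g n z v w : DerivNAt f n z v -> DerivNAt g n z w ->
  DerivNAt (fun z => f z - g z)%C n z (v - w)%C.
Proof.
  intros [W [HW [Wz [f' [Hf <-]]]]] [W' [HW' [Wz' [g' [Hg <-]]]]].
  exists (fun z => W z /\ W' z). split; [now apply Copen_inter|]. split; [easy|].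
  exists (fun z => Csub (f' z) (g' z)). split; [|easy].
  apply HasDerivN_minus.
  - apply (HasDerivN_sub W); [tauto|easy].
  - apply (HasDerivN_sub W'); [tauto|easy].
Qed.

(** Cauchy's estimate on a centred square of side [r / 3], which lies in the disc of radius [r] and
    has its boundary at distance [r / 6] from the centre. *)
Definition cauchy_const (t : nat) (r : R) : R :=
  INR (fact t) / (2 * PI) * (4 * (r / 3) * (/ (r / 6)) ^ S t).

Lemma cauchy_const_pos t r : 0 < r -> 0 < cauchy_const t r.
Proof.
  intros Hr. unfold cauchy_const. pose proof PI_RGT_0.
  apply Rmult_lt_0_compat; [apply Rdiv_lt_0_compat; [apply INR_fact_lt_0|lra]|].
  apply Rmult_lt_0_compat; [lra|]. apply pow_lt. apply Rinv_0_lt_compat. lra.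
Qed.

Lemma derivative_exists f t (W : Cset) y M : Copen W -> W y -> (forall p, W p -> cdiffable f p) ->
  (forall z, Cmod (f z) <= M) -> exists v, DerivNAt f t y v.
Proof.
  intros HW Wy Hf HM. destruct (square_in_open W y HW Wy) as [a [b [d [Hd [Iy Sy]]]]].
  exists (CD f a b d t y). apply (DerivNAt_CD_ex f t a b d y M); auto.
Qed.

Lemma derivative_bound f t y r v M : 0 < r -> (forall p, Cmod (p - y) < r -> cdiffable f p) ->
  (forall z, Cmod (f z) <= M) -> DerivNAt f t y v -> Cmod v <= cauchy_const t r * M.
Proof.
  intros Hr Hf HM Hv.
  set (a := fst y - r/6). set (b := snd y - r/6). set (d := r/3).
  assert (Iy : int_sq a b d y) by (unfold int_sq, a, b, d; lra).
  assert (Hf' : forall p, in_sq a b d p -> cdiffable f p).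
  { intros p Hp. apply Hf. pose proof (in_sq_dist a b d p y Hp (int_sq_in _ _ _ _ Iy)). unfold d in H; lra. }
  rewrite (DerivNAt_CD f t a b d y v M) by (auto; unfold d; lra).
  replace (cauchy_const t r * M) with (INR (fact t) / (2 * PI) * (4 * d * (M * (/ (r/6)) ^ S t)))
    by (unfold cauchy_const, d; ring).
  apply CD_bound; auto; try (unfold d; lra).
  - intros w Hw. pose proof (fst_le_Cmod (w - y)%C) as X1. pose proof (snd_le_Cmod (w - y)%C) as X2.
    cbn [fst snd Cminus Cplus Copp] in X1, X2. unfold on_sq, a, b, d in Hw.
    pose proof (Rle_abs (fst w + - fst y)). pose proof (Rle_abs (- (fst w + - fst y))).
    pose proof (Rle_abs (snd w + - snd y)). pose proof (Rle_abs (- (snd w + - snd y))).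
    rewrite !Rabs_Ropp in *. lra.
  - intros w Hw. apply cdiffable_ccont, Hf', on_sq_in; [unfold d; lra|easy].
Qed.

Lemma Cmod_polar rho theta : 0 <= rho -> Cmod (Cpolar rho theta) = rho.
Proof.
  intros Hr. unfold Cmod, Cpolar; cbn [fst snd].
  replace ((rho * cos theta) ^ 2 + (rho * sin theta) ^ 2)
    with (rho ^ 2 * (Rsqr (sin theta) + Rsqr (cos theta))) by (unfold Rsqr; ring).
  rewrite sin2_cos2, Rmult_1_r. now apply sqrt_pow2.
Qed.

Lemma polar_point_dist (x0 : C) rho theta : 0 <= rho -> Cmod (Cadd x0 (Cpolar rho theta) - x0) = rho.
Proof.
  intros Hr. change (Cadd x0 (Cpolar rho theta)) with (x0 + Cpolar rho theta)%C.
  set (p := Cpolar rho theta : C). replace (x0 + p - x0)%C with p by ring. now apply Cmod_polar.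
Qed.

Lemma Approx_exists alpha (U : Cset) (x0 : C) (f : C -> C) : 0 < alpha < 1 -> Copen U -> InA alpha U f ->
  exists fk, Approx alpha U x0 f fk.
Proof.
  intros Ha HU Hf. apply InA_iff in Hf. destruct Hf as [[N [HN [H1 H2]]] [Hl Hd]].
  assert (Hk : forall k, exists g, (InA alpha U g /\ exists V, Copen V /\ V x0 /\ analytic_on V g) /\
      bounded_holder alpha (fun z => Csub (g z) (f z)) (/ (INR k + 1))).
  { intros k. assert (Hp : 0 < / (INR k + 1)) by (apply Rinv_0_lt_compat; pose proof (pos_INR k); lra).
    destruct (density alpha U f x0 N (/ (INR k + 1)) Ha HU HN Hp H1 H2 Hl Hd) as [g [G1 [G2 [G3 [G4 [V [HV [Vx GV]]]]]]]].
    exists g. split; [split|].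
    - apply InA_iff. split; [|split; auto]. exists (N + / (INR k + 1)). split; [lra|].
      assert (Hgf : bounded_holder alpha (fun z => g z - f z)%C (/ (INR k + 1))) by (split; auto).
      assert (Hff : bounded_holder alpha (fun z => - f z)%C N).
      { split; intros; [rewrite Cmod_opp; auto|].
        replace (- f z - - f w)%C with (- (f z - f w))%C by ring. rewrite Cmod_opp. auto. }
      assert (Hsum := bounded_holder_minus _ _ _ _ _ Hgf Hff). destruct Hsum as [Q1 Q2].
      rewrite Rplus_comm. split.
      + intros z. specialize (Q1 z). cbv beta in Q1. now replace (g z - f z - - f z)%C with (g z) in Q1 by ring.
      + intros z w. specialize (Q2 z w). cbv beta in Q2.
        now replace (g z - f z - - f z - (g w - f w - - f w))%C with (g z - g w)%C in Q2 by ring.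
    - exists V. split; [easy|split; [easy|]]. now apply analytic_on_cdiffable.
    - split; auto. }
  destruct (ClassicalEpsilon.choice _ Hk) as [fk Hfk]. exists fk. split; [intros k; apply Hfk|].
  assert (Hnk : forall k, exists nk, LipNorm alpha (fun z => Csub (fk k z) (f z)) nk /\ nk <= 2 * / (INR k + 1)).
  { intros k. apply LipNorm_exists. apply Hfk. }
  destruct (ClassicalEpsilon.choice _ Hnk) as [Nk HNk]. exists Nk. split; [intros k; apply HNk|].
  intros e He. destruct (nfloor_ex (2 / e)) as [n0 [_ Hn0]]; [left; apply Rdiv_lt_0_compat; lra|].
  exists n0. intros n Hn. apply le_INR in Hn. unfold Rdist. rewrite Rminus_0_r.
  destruct (HNk n) as [Q1 Q2]. apply LipNorm_bounded_holder in Q1. rewrite Rabs_pos_eq by apply Q1.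
  apply Rle_lt_trans with (2 * / (INR n + 1)); [easy|].
  apply Rmult_lt_reg_r with (INR n + 1); [pose proof (pos_INR n); lra|].
  rewrite Rmult_assoc, Rinv_l, Rmult_1_r by (pose proof (pos_INR n); lra).
  apply Rmult_lt_reg_r with (/ e); [apply Rinv_0_lt_compat; lra|].
  replace (e * (INR n + 1) * / e) with (INR n + 1) by (field; lra). unfold Rdiv in Hn0. lra.
Qed.

Theorem theorem5
  (alpha : R) (U : Cset) (x0 : Cpx) (t : nat) (lam : R)
  (theta0 beta r ell K : R) :
  0 < alpha < 1 ->
  Copen U ->
  in_boundary U x0 ->
  (* cone condition: sector of half-opening beta around direction theta0 *)
  0 < beta < PI ->
  r > 0 ->
  (forall rho theta, 0 < rho < r -> Rabs (theta - theta0) < beta ->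
     U (Cadd x0 (Cpolar rho theta))) ->
  0 < ell < r ->
  K > 0 ->
  (forall s z, 0 < s <= ell ->
     ~ (exists rho theta, rho > 0 /\ Rabs (theta - theta0) < beta /\
          z = Cadd x0 (Cpolar rho theta)) ->
     Cnorm (Csub (Cadd x0 (Cpolar s theta0)) x0)
       <= K * Cnorm (Csub z (Cadd x0 (Cpolar s theta0)))) ->
  0 < lam < 1 ->
  (exists m : nat -> R,
     (forall n, LowerContent alpha (fun z => Ann x0 n z /\ ~ U z) (m n)) /\
     exists l, Un_cv (fun N => sum_f_R0 (fun n =>
        Rpower 2 ((INR t + 1 + lam) * INR (S n)) * m (S n)) N) l) ->
  exists Cst, Cst > 0 /\
    forall f, InA alpha U f ->
      exists L, ExtDeriv alpha U t x0 f L /\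
        forall nf, LipNorm alpha f nf ->
        forall s v, 0 < s <= ell ->
          DerivNAt f t (Cadd x0 (Cpolar s theta0)) v ->
          Cnorm (Csub v L) / rpow (Cnorm (Csub (Cadd x0 (Cpolar s theta0)) x0)) lam
            <= Cst * nf.
Proof.
  intros Ha HU _ Hbeta Hr Hsec Hell HK Hcone Hlam [m [Hm [l Hl]]].
  set (X := fun s => (Cadd x0 (Cpolar s theta0) : C)).
  assert (HXd : forall s, 0 <= s -> Cmod (X s - x0) = s) by (intros; now apply polar_point_dist).
  assert (Hcone' : forall s z, 0 < s <= ell -> ~ U z -> Cmod (z - x0) < r -> s <= K * Cmod (z - X s)).
  { intros s z Hs Uz Hz. specialize (Hcone s z Hs). rewrite !Cnorm_Cmod in Hcone.
    change (Csub (Cadd x0 (Cpolar s theta0)) x0) with (X s - x0)%C in Hcone.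
    rewrite HXd in Hcone by lra. apply Hcone. intros [rho [theta [Hrho [Hth ->]]]].
    apply Uz, Hsec; [|easy]. rewrite polar_point_dist in Hz by lra. lra. }
  assert (HXU : forall s, 0 < s <= ell -> U (X s)).
  { intros s Hs. apply Hsec; [lra|]. rewrite Rminus_diag, Rabs_R0. lra. }
  (* The cone inequality keeps the complement of [U] at distance [s / K] from the point [X s] of the
     ray, as long as one stays within [r] of [x0]. *)
  assert (HXb : forall s p, 0 < s <= ell -> Cmod (p - X s) < Rmin (s / K) (r - ell) -> U p).
  { intros s p Hs Hp. apply Classical_Prop.NNPP. intros Up.
    pose proof (Rmin_l (s / K) (r - ell)). pose proof (Rmin_r (s / K) (r - ell)).
    assert (Hpx : Cmod (p - x0) < r).
    { pose proof (Cmod_minus_le p (X s) x0). rewrite HXd in H1 by lra. lra. }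
    pose proof (Hcone' s p Hs Up Hpx).
    assert (K * Cmod (p - X s) < K * (s / K)) by (apply Rmult_lt_compat_l; lra).
    replace (K * (s / K)) with s in H2 by (field; lra). lra. }
  destruct (near_estimate alpha U x0 t lam K r m l) as [C1 [a1 [HC1 [Ha1 Hnear]]]]; auto.
  (* The estimate near [x0] reaches up to [s1]; beyond it, discs of the uniform radius [R1] around
     the ray lie in [U] and Cauchy's estimate takes over. *)
  set (s1 := Rmin a1 ell). assert (Hs1 : 0 < s1) by (apply Rmin_pos; lra).
  assert (Hs1a : s1 <= a1) by apply Rmin_l. assert (Hs1e : s1 <= ell) by apply Rmin_r.
  set (R1 := Rmin (s1 / K) (r - ell)).
  assert (HR1 : 0 < R1) by (apply Rmin_pos; [apply Rdiv_lt_0_compat; lra|lra]).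
  set (CB := cauchy_const t R1). assert (HCB : 0 < CB) by now apply cauchy_const_pos.
  (* The norm bound of the point derivation: the derivative at [x0] is compared with the one at
     [X s1], which [CB] controls. *)
  set (C3 := C1 * Rpower s1 lam + CB).
  assert (HP1 : 0 < Rpower s1 lam) by apply Rpower_gt_0.
  assert (HC3 : 0 < C3) by (unfold C3; assert (0 < C1 * Rpower s1 lam) by (apply Rmult_lt_0_compat; lra); lra).
  (* For s above [s1] the two derivatives are bounded separately by [CB] and [C3], and s^lam is at
     least s1^lam. *)
  set (C4 := C1 + (CB + C3) / Rpower s1 lam).
  assert (HC4 : 0 < C4) by (unfold C4; assert (0 < (CB + C3) / Rpower s1 lam) by (apply Rdiv_lt_0_compat; lra); lra).
  set (good := fun f : C -> C => little_o alpha f /\ (forall p, U p -> cdiffable f p) /\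
     exists V, Copen V /\ V x0 /\ forall p, V p -> cdiffable f p).
  assert (Hnear' : forall f N s v v0, 0 < N -> good f -> bounded_holder alpha f N -> 0 < s <= s1 ->
     DerivNAt f t (X s) v -> DerivNAt f t x0 v0 -> Cmod (v - v0) <= C1 * N * Rpower s lam).
  { intros f N s v v0 HN [G1 [G2 G3]] [B1 B2] Hs Hv Hv0. rewrite <- (HXd s) by lra.
    apply (Hnear f N (X s)); auto.
    - apply HXU; lra.
    - intros E. pose proof (HXd s ltac:(lra)) as Q. rewrite E, Cmod_diag in Q. lra.
    - rewrite HXd; lra.
    - intros z Uz Hz. rewrite HXd by lra. apply Hcone'; auto. lra. }
  assert (Hbig : forall f N s v, (forall p, U p -> cdiffable f p) -> bounded_holder alpha f N -> s1 <= s <= ell ->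
     DerivNAt f t (X s) v -> Cmod v <= CB * N).
  { intros f N s v G2 [B1 B2] Hs Hv. apply (derivative_bound f t (X s) R1); auto.
    intros p Hp. apply G2, (HXb s); [lra|]. eapply Rlt_le_trans; [apply Hp|].
    apply Rmin_glb; [|apply Rmin_r]. eapply Rle_trans; [apply Rmin_l|].
    apply Rmult_le_compat_r; [left; apply Rinv_0_lt_compat; lra|lra]. }
  assert (HE1 : forall f N v0, 0 < N -> good f -> bounded_holder alpha f N -> DerivNAt f t x0 v0 -> Cmod v0 <= C3 * N).
  { intros f N v0 HN Hg Hb Hv0.
    destruct (derivative_exists f t U (X s1) N) as [v Hv]; auto; [apply Hg|apply Hb|].
    pose proof (Hnear' f N s1 v v0 HN Hg Hb ltac:(lra) Hv Hv0).
    pose proof (Hbig f N s1 v (proj1 (proj2 Hg)) Hb ltac:(lra) Hv).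
    pose proof (Cmod_sub_le v0 v). rewrite Cmod_minus_sym in H1. unfold C3. lra. }
  assert (HE2 : forall f N s v v0, 0 < N -> good f -> bounded_holder alpha f N -> 0 < s <= ell ->
     DerivNAt f t (X s) v -> DerivNAt f t x0 v0 -> Cmod (v - v0) <= C4 * N * Rpower s lam).
  { intros f N s v v0 HN Hg Hb Hs Hv Hv0.
    assert (HPs : 0 < Rpower s lam) by apply Rpower_gt_0.
    destruct (Rle_dec s s1) as [H|H].
    - eapply Rle_trans; [apply (Hnear' f N s v v0); auto; lra|].
      apply Rmult_le_compat_r; [lra|]. apply Rmult_le_compat_r; [lra|]. unfold C4.
      assert (0 < (CB + C3) / Rpower s1 lam) by (apply Rdiv_lt_0_compat; lra). lra.
    - pose proof (Hbig f N s v (proj1 (proj2 Hg)) Hb ltac:(lra) Hv).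
      pose proof (HE1 f N v0 HN Hg Hb Hv0). pose proof (Cmod_minus_triangle v v0).
      apply Rle_trans with ((CB + C3) / Rpower s1 lam * N * Rpower s1 lam).
      + replace ((CB + C3) / Rpower s1 lam * N * Rpower s1 lam) with (CB * N + C3 * N) by (field; lra). lra.
      + assert (0 < (CB + C3) / Rpower s1 lam) by (apply Rdiv_lt_0_compat; lra).
        apply Rmult_le_compat; try lra.
        * apply Rmult_le_pos; lra.
        * apply Rmult_le_compat_r; [lra|]. unfold C4; lra.
        * apply Rle_Rpower_l; lra. }
  assert (good_minus : forall f g, good f -> good g -> good (fun z => f z - g z)%C).
  { intros f g [F1 [F2 [V [HV [Vx FV]]]]] [G1 [G2 [V' [HV' [Vx' GV]]]]]. split; [now apply little_o_minus|split].
    - intros p Up. apply cdiffable_minus; auto.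
    - exists (fun z => V z /\ V' z). split; [now apply Copen_inter|split; [easy|]].
      intros p [P1 P2]. apply cdiffable_minus; auto. }
  assert (Hgood : forall (f : C -> C) (fk : nat -> C -> C), Approx alpha U x0 f fk -> exists Nk, (forall k, good (fk k)) /\
     (forall k, 0 <= Nk k) /\ (forall k, bounded_holder alpha (fun z => fk k z - f z)%C (Nk k)) /\ Un_cv Nk 0).
  { intros f fk [H1 [Nk [H2 H3]]]. exists Nk. split; [|split; [|split; [|easy]]].
    - intros k. destruct (H1 k) as [HA [V [HV [Vx HVa]]]]. apply InA_iff in HA. destruct HA as [_ [P1 P2]].
      split; [easy|split; [easy|]]. exists V. split; [easy|split; [easy|]]. now apply analytic_on_cdiffable.
    - intros k. apply (LipNorm_bounded_holder _ _ _ (H2 k)).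
    - intros k. apply (LipNorm_bounded_holder _ _ _ (H2 k)). }
  (* Any two approximating sequences have close derivatives at [x0]; this yields both the Cauchy
     property and the independence of the limit from the sequence. The slack [e / C3] provides the
     positive bound that [HE1] asks for. *)
  assert (Hclose : forall (f : C -> C) (fk gk : nat -> C -> C) (Nk Mk : nat -> R) k j v w, good (fk k) -> good (gk j) ->
     bounded_holder alpha (fun z => fk k z - f z)%C (Nk k) -> bounded_holder alpha (fun z => gk j z - f z)%C (Mk j) ->
     0 <= Nk k -> 0 <= Mk j ->
     DerivNAt (fk k) t x0 v -> DerivNAt (gk j) t x0 w -> Cmod (v - w) <= C3 * (Nk k + Mk j)).
  { intros f fk gk Nk Mk k j v w Gf Gg Bf Bg Pf Pg Hv Hw. apply le_epsilon. intros e He.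
    assert (Hb := bounded_holder_minus _ _ _ _ _ Bf Bg).
    assert (Hee : 0 < e / C3) by (apply Rdiv_lt_0_compat; lra).
    assert (Hb' : bounded_holder alpha (fun z => fk k z - gk j z)%C (Nk k + Mk j + e / C3)).
    { destruct (bounded_holder_le alpha _ (Nk k + Mk j) (Nk k + Mk j + e / C3) ltac:(lra) Hb) as [Q1 Q2]. split.
      - intros z. specialize (Q1 z). cbv beta in Q1.
        now replace (fk k z - f z - (gk j z - f z))%C with (fk k z - gk j z)%C in Q1 by ring.
      - intros z z'. specialize (Q2 z z'). cbv beta in Q2.
        now replace (fk k z - f z - (gk j z - f z) - (fk k z' - f z' - (gk j z' - f z')))%C
          with (fk k z - gk j z - (fk k z' - gk j z'))%C in Q2 by ring. }
    replace (C3 * (Nk k + Mk j) + e) with (C3 * (Nk k + Mk j + e / C3)) by (field; lra).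
    apply (HE1 (fun z => fk k z - gk j z)%C); auto; [lra|].
    now apply DerivNAt_minus. }
  exists C4. split; [lra|]. intros f Hf.
  destruct (Approx_exists alpha U x0 f Ha HU Hf) as [fk Hfk].
  destruct (Hgood f fk Hfk) as [Nk [Gk [Pk [Bk Ck0]]]].
  apply InA_iff in Hf. destruct Hf as [[Nf [HNf Bf]] [Lf Df]].
  assert (Bfk : forall k nf, bounded_holder alpha f nf -> bounded_holder alpha (fk k) (nf + Nk k)).
  { intros k nf [Q1 Q2]. destruct (Bk k) as [Q3 Q4]. split.
    - intros z. specialize (Q1 z). specialize (Q3 z). cbv beta in Q3. pose proof (Cmod_sub_le (fk k z) (f z)). lra.
    - intros z w. specialize (Q2 z w). specialize (Q4 z w). cbv beta in Q4.
      replace (fk k z - fk k w)%C with ((f z - f w) + (fk k z - f z - (fk k w - f w)))%C by ring.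
      eapply Rle_trans; [apply Cmod_triangle|]. lra. }
  assert (HDex : forall k, exists v, DerivNAt (fk k) t x0 v).
  { intros k. destruct (Gk k) as [_ [_ [V [HV [Vx HVd]]]]].
    apply (derivative_exists (fk k) t V x0 (Nf + Nk k)); auto. apply (Bfk k Nf Bf). }
  destruct (ClassicalEpsilon.choice _ HDex) as [Dk HDk].
  destruct (C_complete Dk) as [L HL].
  { intros e He. destruct (Ck0 (e / (3 * C3))) as [n0 Hn0]; [apply Rdiv_lt_0_compat; lra|].
    exists n0. intros n k Hn Hk. pose proof (Hn0 n Hn) as Q1. pose proof (Hn0 k Hk) as Q2.
    unfold Rdist in Q1, Q2. rewrite Rminus_0_r, Rabs_pos_eq in Q1, Q2 by auto.
    eapply Rle_lt_trans; [apply (Hclose f fk fk Nk Nk n k); auto|].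
    assert (C3 * (Nk n + Nk k) <= C3 * (e / (3 * C3) + e / (3 * C3))) by (apply Rmult_le_compat_l; lra).
    replace (C3 * (e / (3 * C3) + e / (3 * C3))) with (2 * e / 3) in H by (field; lra). lra. }
  exists L. split.
  - split; [now exists fk|]. intros gk vk Hgk Hvk.
    destruct (Hgood f gk Hgk) as [Mk [Gg [Pg [Bg Cg0]]]].
    intros e He.
    destruct (Ck0 (e / (6 * C3))) as [n1 Hn1]; [apply Rdiv_lt_0_compat; lra|].
    destruct (Cg0 (e / (6 * C3))) as [n2 Hn2]; [apply Rdiv_lt_0_compat; lra|].
    destruct (HL (e / 3)) as [n3 Hn3]; [lra|].
    exists (max n1 (max n2 n3)). intros n Hn.
    specialize (Hn1 n ltac:(lia)). specialize (Hn2 n ltac:(lia)). specialize (Hn3 n ltac:(lia)).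
    unfold Rdist in *. rewrite Rminus_0_r in *. rewrite Rabs_pos_eq in Hn1, Hn2 by auto.
    rewrite Cnorm_Cmod, Rabs_pos_eq by apply Cmod_ge_0. change (Csub (vk n) L) with (vk n - L)%C.
    eapply Rle_lt_trans; [apply (Cmod_minus_le _ (Dk n))|].
    pose proof (Hclose f gk fk Mk Nk n n (vk n) (Dk n) (Gg n) (Gk n) (Bg n) (Bk n) (Pg n) (Pk n) (Hvk n) (HDk n)) as Q.
    assert (Q2 : C3 * (Mk n + Nk n) <= C3 * (e / (6 * C3) + e / (6 * C3))) by (apply Rmult_le_compat_l; lra).
    replace (C3 * (e / (6 * C3) + e / (6 * C3))) with (e / 3) in Q2 by (field; lra). lra.
  - intros nf Hnf s v Hs Hv.
    apply LipNorm_bounded_holder in Hnf. destruct Hnf as [Hnf0 Hnf].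
    rewrite !Cnorm_Cmod. change (Csub (Cadd x0 (Cpolar s theta0)) x0) with (X s - x0)%C.
    change (Csub v L) with (v - L)%C. rewrite HXd, rpow_pos by lra.
    assert (HPs : 0 < Rpower s lam) by apply Rpower_gt_0.
    apply Rmult_le_reg_r with (Rpower s lam); [easy|].
    unfold Rdiv. rewrite Rmult_assoc, Rinv_l, Rmult_1_r by lra.
    (* The radius shrinks with [s], so [Cs] is not uniform along the ray. It only multiplies the
       approximation error, and [n] is chosen after [s]. *)
    set (Rs := Rmin (s / K) (r - ell)).
    assert (HRs : 0 < Rs) by (apply Rmin_pos; [apply Rdiv_lt_0_compat; lra|lra]).
    set (Cs := cauchy_const t Rs). assert (HCs : 0 < Cs) by now apply cauchy_const_pos.
    apply le_epsilon. intros e He.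
    set (Q := Cs + C4 * Rpower s lam).
    assert (HQ : 0 < Q) by (unfold Q; assert (0 < C4 * Rpower s lam) by (apply Rmult_lt_0_compat; lra); lra).
    assert (Heq : 0 < e / (4 * Q)) by (apply Rdiv_lt_0_compat; lra).
    destruct (Ck0 (e / (4 * Q)) Heq) as [n1 Hn1]. destruct (HL (e / 2)) as [n2 Hn2]; [lra|].
    set (n := max n1 n2). specialize (Hn1 n ltac:(lia)). specialize (Hn2 n ltac:(lia)).
    unfold Rdist in Hn1. rewrite Rminus_0_r, Rabs_pos_eq in Hn1 by auto.
    (* Positive even when [nf] and [Nk n] vanish. All errors proportional to [M] add up to
       [Q * M <= e / 2]; the other half goes to the convergence of [Dk n] to [L]. *)
    set (M := Nk n + e / (4 * Q)). specialize (Pk n).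
    assert (HM : 0 < M) by (unfold M; lra).
    destruct (derivative_exists (fk n) t U (X s) (nf + Nk n)) as [vn Hvn]; auto.
    { apply (Gk n). } { apply (Bfk n nf Hnf). }
    assert (T1 : Cmod (vn - v) <= Cs * M).
    { apply (derivative_bound (fun z => fk n z - f z)%C t (X s) Rs); auto.
      - intros p Hp. assert (Up : U p) by (apply (HXb s); auto). apply cdiffable_minus; auto. apply (Gk n); auto.
      - intros z. destruct (Bk n) as [Q1 _]. specialize (Q1 z). cbv beta in Q1. unfold M. lra.
      - now apply DerivNAt_minus. }
    assert (T2 : Cmod (vn - Dk n) <= C4 * (nf + M) * Rpower s lam).
    { apply (HE2 (fk n) (nf + M) s); auto; [lra|].
      apply (bounded_holder_le alpha _ (nf + Nk n)); [unfold M; lra|auto]. }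
    pose proof (Cmod_minus_le v vn L) as T3. pose proof (Cmod_minus_le vn (Dk n) L) as T4.
    rewrite (Cmod_minus_sym v vn) in T3.
    assert (T5 : Q * M <= e / 2).
    { apply Rle_trans with (Q * (e / (4 * Q) + e / (4 * Q))); [apply Rmult_le_compat_l; [lra|unfold M; lra]|].
      right; field; lra. }
    unfold Q in T5. lra.
Qed.
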